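(* Let $W=W_{m_{st}}$ be the finite dihedral group with $m_{st}<\infty$ and suppose $\Lambda_{st}=\Bbbk$, i.e. $V^*=\Bbbk\rho_s\oplus\Bbbk\rho_t$. Then for every expression $\underline w$ in $s,t$ there are isomorphisms of (graded) right $R$-modules $$\mathrm{Ext}^{0,\bullet}_{R^e}(B_t,\mathrm{BS}(\underline w))\cong \ker\rho_s^e(\underline w)\,\underline{1}\,(-1)\cong\ker\rho_s^e(\underline w)(-1),$$ $$\mathrm{Ext}^{1,\bullet}_{R^e}(B_t,\mathrm{BS}(\underline w))\cong \ker\rho_s^e(\underline w)\,\underline{\rho_t t(\rho_t)}\,(-1)\ \oplus\ \widetilde{\mathbb D(\ker\rho_s^e(\underline w))}\,\underline{\rho_s}\,(-1)\cong \ker\rho_s^e(\underline w)(3)\oplus \mathbb D(\ker\rho_s^e(\underline w))(1),$$ $$\mathrm{Ext}^{2,\bullet}_{R^e}(B_t,\mathrm{BS}(\underline w))\cong \mathbb D(\ker\rho_s^e(\underline w))\,\underline{\rho_s\wedge\rho_t t(\rho_t)}\,(-1)\cong\mathbb D(\ker\rho_s^e(\underline w))(5).$$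
   Context: **Realization.** $\Bbbk$ is an integral domain of characteristic $0$; $W_{m_{st}}=\langle s,t\mid s^2=t^2=(st)^{m_{st}}=1\rangle$, $2\le m_{st}<\infty$. $V$ is a free $\Bbbk$-module of finite rank with dual $V^*$, with elements $\alpha_s,\alpha_t\in V^*$, $\alpha_s^\vee,\alpha_t^\vee\in V$, $\langle\alpha_i^\vee,\alpha_i\rangle=2$; $i\in\{s,t\}$ acts on $V$ by $v\mapsto v-\langle v,\alpha_i\rangle\alpha_i^\vee$ and on $V^*$ by $\lambda\mapsto\lambda-\langle\alpha_i^\vee,\lambda\rangle\alpha_i$, giving a representation of $W_{m_{st}}$. Standing assumptions: $a_{st}:=\langle\alpha_s^\vee,\alpha_t\rangle=\langle\alpha_t^\vee,\alpha_s\rangle=:a_{ts}$; with $[0]=0$, $[1]=1$, $[2]=-a_{st}=q+q^{-1}$, $[k+1]=[2][k]-[k-1]$, the realization is faithful, meaning $q$ is a primitive $2m_{st}$-th root of unity (so $[m_{st}]=0$), balanced ($[m_{st}-1]=1$), and $[k]$ is invertible in $\Bbbk$ for all $1\le k<m_{st}$ (lesser invertibility); $\alpha_s,\alpha_t$ are linearly independent; Demazure surjectivity holds (the maps $\langle-,\alpha_i\rangle:V\to\Bbbk$ and $\langle\alpha_i^\vee,-\rangle:V^*\to\Bbbk$ are surjective); there are $\rho_s,\rho_t\in V^*$ with $\langle\alpha_s^\vee,\rho_s\rangle=1=\langle\alpha_t^\vee,\rho_t\rangle$, $\langle\alpha_s^\vee,\rho_t\rangle=0=\langle\alpha_t^\vee,\rho_s\rangle$.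 Then $V^*=\Bbbk\rho_s\oplus\Bbbk\rho_t\oplus(V^* )^{s,t}$; $\Lambda_{st}$ is the dual of the exterior algebra of $(V^* )^{s,t}$, so $\Lambda_{st}=\Bbbk$ means $(V^* )^{s,t}=0$. **Bimodules.** $R=\mathrm{Sym}(V^* )$ with $V^*$ in degree $2$, $R^e=R\otimes_\Bbbk R$; $M(1)_d=M_{d+1}$. $B_i=R\otimes_{R^i}R(1)$; an expression is a finite word $\underline w=(s_1,\dots,s_n)$ in $s,t$ and $\mathrm{BS}(\underline w)=B_{s_1}\otimes_R\cdots\otimes_RB_{s_n}$. $\mathrm{Ext}^{k,\ell}_{R^e}(M,N)=\mathrm{Ext}^k(M,N(\ell))$ in graded $R$-bimodules, with right $R$-module structure induced from the right action on $N$; $\mathrm{Ext}^{k,\bullet}=\bigoplus_\ell\mathrm{Ext}^{k,\ell}$. $\rho_s^e(\underline w):\mathrm{BS}(\underline w)\to\mathrm{BS}(\underline w)$ is $b\mapsto\rho_sb-b\rho_s$. $\mathbb D(N)=\mathrm{Hom}_{-R}(N,R)$ is the graded space of right $R$-module homomorphisms, with right action $(f\cdot r)(b)=f(b)r$. **Bookkeeping symbols.** $\underline 1,\underline{\rho_s},\underline{\rho_tt(\rho_t)},\underline{\rho_s\wedge\rho_tt(\rho_t)}$ name the generators of the Koszul resolution $K_t$ of $B_t$ (the Koszul complex over $R^e$ on $\rho_tt(\rho_t)\otimes1-1\otimes\rho_tt(\rho_t)$ and $\rho_s\otimes1-1\otimes\rho_s$, shifted by $(1)$) on which a cocycle $K_t\to\mathrm{BS}(\underline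 w)$ is evaluated; as graded modules they act as internal shifts: $N\underline 1=N$, $N\underline{\rho_s}=N(2)$, $N\underline{\rho_tt(\rho_t)}=N(4)$, $N\underline{\rho_s\wedge\rho_tt(\rho_t)}=N(6)$. The tilde indicates that elements of $\mathbb D(\ker\rho_s^e(\underline w))$ (identified with the cokernel of $\rho_s^e(\underline w)$) must be lifted to cocycles; as a module $\widetilde{\mathbb D(N)}\cong\mathbb D(N)$. *)

(* Defs.v *)
From HB Require Import structures.
From mathcomp Require Import all_boot all_order all_algebra.
From mathcomp Require Import boolp functions.
From mathcomp Require Import mpoly.

Set Implicit Arguments.
Unset Strict Implicit.
Unset Printing Implicit Defensive.

Import GRing.Theory.
Local Open Scope ring_scope.
Local Open Scope quotient_scope.

Section Families.
Variables (R : nzRingType) (V : lmodType R).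
Implicit Type g : int -> V -> Prop.

Definition submod (P : V -> Prop) : Prop :=
  P 0 /\ forall (a : R) x y, P x -> P y -> P (a *: x + y).

Definition gspan g (x : V) : Prop :=
  exists s : seq V, (forall y, y \in s -> exists d, g d y) /\
    x = \sum_(y <- s) y.

Definition gfree g : Prop :=
  forall (s : seq int) (c : int -> V), uniq s -> (forall d, g d (c d)) ->
    \sum_(d <- s) c d = 0 -> forall d, d \in s -> c d = 0.

Lemma sum_if_eq (s : seq int) e (x : V) : uniq s ->
  \sum_(d <- s) (if d == e then x else 0) = if e \in s then x else 0.
Proof.
elim: s => [|d s IH] /=; first by rewrite big_nil.
move=> /andP[ds us]; rewrite big_cons IH // inE eq_sym.
by case: eqP => [->|_] /=; [rewrite (negPf ds) addr0|rewrite add0r].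
Qed.

Definition gsubgroups g : Prop :=
  forall d, g d 0 /\ forall x y, g d x -> g d y -> g d (x - y).

Lemma gspan0 g : gspan g 0.
Proof. by exists [::]; split => //; rewrite big_nil. Qed.

Lemma gspanD g x y : gspan g x -> gspan g y -> gspan g (x + y).
Proof.
move=> [s [hs ->]] [t [ht ->]]; exists (s ++ t); split; last by rewrite big_cat.
by move=> z; rewrite mem_cat => /orP[/hs|/ht].
Qed.

Lemma gspan1 g d x : g d x -> gspan g x.
Proof.
move=> gx; exists [:: x]; split; last by rewrite big_seq1.
by move=> y; rewrite inE => /eqP ->; exists d.
Qed.

Lemma gspan_ind g (Q : V -> Prop) : Q 0 ->
  (forall d x y, g d x -> Q y -> Q (x + y)) -> forall x, gspan g x -> Q x.
Proof.
move=> Q0 QD x [s [hs ->]] {x}; elim: s hs => [|y s IH] hs; first by rewrite big_nil.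
rewrite big_cons; have [d gd] := hs y (mem_head _ _).
by apply: QD gd _; apply: IH => z zs; apply: hs; rewrite inE zs orbT.
Qed.

Lemma gspan_sum g (I : Type) (s : seq I) (F : I -> V) :
  (forall i, gspan g (F i)) -> gspan g (\sum_(i <- s) F i).
Proof.
move=> hF; elim: s => [|i s IH]; first by rewrite big_nil; exact: gspan0.
by rewrite big_cons; apply: gspanD.
Qed.

Section Subgroups.
Variables (g : int -> V -> Prop) (hg : gsubgroups g).

Lemma gs0 d : g d 0. Proof. by case: (hg d). Qed.
Lemma gsB d x y : g d x -> g d y -> g d (x - y). Proof. by case: (hg d) => _; apply. Qed.
Lemma gsN d x : g d x -> g d (- x).
Proof. by move=> gx; rewrite -sub0r; apply: gsB => //; apply: gs0. Qed.
Lemma gsD d x y : g d x -> g d y -> g d (x + y).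
Proof. by move=> gx gy; rewrite -[y]opprK; apply: gsB => //; apply: gsN. Qed.
Lemma gs_sum d (I : Type) (s : seq I) (Q : pred I) (F : I -> V) :
  (forall i, Q i -> g d (F i)) -> g d (\sum_(i <- s | Q i) F i).
Proof.
move=> hF; elim: s => [|i s IH]; first by rewrite big_nil; exact: gs0.
by rewrite big_cons; case: ifP => // Qi; apply: gsD => //; apply: hF.
Qed.

Definition decomp (x : V) (s : seq int) (c : int -> V) : Prop :=
  [/\ uniq s, forall d, g d (c d), forall d, d \notin s -> c d = 0
    & x = \sum_(d <- s) c d].

Lemma gspan_decomp x : gspan g x -> exists s c, decomp x s c.
Proof.
move: x; apply: gspan_ind => [|e x y gx [s [c [us gc c0 ->]]]].
  by exists [::], (fun=> 0); split => //; [move=> d; exact: gs0|rewrite big_nil].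
pose c' d := (if d == e then x else 0) + c d.
have gc' d : g d (c' d).
  by rewrite /c'; apply: gsD => //; case: eqP => [->//|_]; apply: gs0.
pose s' := if e \in s then s else e :: s.
have us' : uniq s' by rewrite /s'; case: ifP => //= ->.
have es' : e \in s' by rewrite /s'; case: ifP => // _; rewrite mem_head.
have ss' d : d \in s -> d \in s'.
  by rewrite /s'; case: ifP => // _ ds; rewrite inE ds orbT.
exists s', c'; split => //.
  move=> d ds'; rewrite /c' c0; last by apply: contra ds'; apply: ss'.
  by rewrite addr0; case: eqP => // de; rewrite de es' in ds'.
rewrite big_split /= sum_if_eq // es'; congr (_ + _).
rewrite /s'; case: ifP => // es.
by rewrite big_cons c0 ?add0r // es.
Qed.

Lemma big_incl (W : nmodType) (s t : seq int) (F : int -> W) :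
  uniq s -> uniq t -> {subset s <= t} -> (forall d, d \notin s -> F d = 0) ->
  \sum_(d <- s) F d = \sum_(d <- t) F d.
Proof.
move=> us ut st F0.
rewrite (bigID [pred d | d \in s] (r := t)) /= [X in _ + X]big1 ?addr0; last by [].
rewrite -[RHS]big_filter; apply: perm_big; apply: uniq_perm => //.
  exact: filter_uniq.
move=> d; rewrite mem_filter; case ds: (d \in s) => //=.
by rewrite st.
Qed.

Lemma decomp_incl x s c t : decomp x s c -> uniq t -> {subset s <= t} ->
  x = \sum_(d <- t) c d.
Proof. by move=> [us gc c0 ->] ut st; exact: big_incl. Qed.

Hypothesis fg : gfree g.

Lemma decomp_uniq x s c s' c' : decomp x s c -> decomp x s' c' -> c =1 c'.
Proof.
move=> D D' d.
have ut : uniq (undup (d :: s ++ s')) by exact: undup_uniq.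
have E := decomp_incl D ut _; have E' := decomp_incl D' ut _.
case: D D' => us gc c0 _ [us' gc' c0' _].
have := fg ut (c := fun d => c d - c' d) _ _ (d := d).
rewrite mem_undup mem_head => H; apply/eqP; rewrite -subr_eq0; apply/eqP.
apply: H => // [e|]; first exact: gsB.
rewrite sumrB -E ?E' ?subrr //.
- by move=> e es; rewrite mem_undup inE mem_cat es !orbT.
- by move=> e es; rewrite mem_undup inE mem_cat es !orbT.
Qed.

End Subgroups.
End Families.

Section SubQuotientModules.
Variables (R : nzRingType) (V : lmodType R).

Definition subpred (P : V -> Prop) (_ : submod P) : {pred V} := fun x => `[< P x >].

Variables (P : V -> Prop) (HP : submod P).

Fact subpred_closed : submod_closed (subpred HP).
Proof.
case: (HP) => P0 PL; split; first exact/asboolP.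
by move=> a x y /asboolP Px /asboolP Py; apply/asboolP/PL.
Qed.
HB.instance Definition _ := GRing.isSubmodClosed.Build R V (subpred HP)
  (GRing.submod_closed_semi subpred_closed).
HB.instance Definition _ := GRing.isOppClosed.Build V (subpred HP)
  (GRing.zmod_closedN (GRing.submod_closedB subpred_closed)).

Record submodule := Submodule { submodule_val :> V; _ : submodule_val \in subpred HP }.

HB.instance Definition _ := [isSub for submodule_val].
HB.instance Definition _ := [Choice of submodule by <:].
HB.instance Definition _ := [SubChoice_isSubLmodule of submodule by <:].

Lemma submoduleP (x : submodule) : P (val x).
Proof. exact/asboolP/(valP x). Qed.

Definition to_submodule (x : V) (Px : P x) : submodule :=
  @Submodule x (introT (asboolP _) Px).

Definition quotient_module := Quotient.quot (subpred HP).
HB.instance Definition _ := GRing.Zmodule.on quotient_module.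

Definition qproj (x : V) : quotient_module := \pi_(Quotient.quot (subpred HP)) x.

Lemma qprojP x y : qproj x = qproj y <-> P (x - y).
Proof.
rewrite /qproj; split => [/eqP|/asboolP h].
  by rewrite -Quotient.idealrBE => /asboolP.
by apply/eqP; rewrite -Quotient.idealrBE.
Qed.

Lemma qproj_surj (q : quotient_module) : exists x, q = qproj x.
Proof. by exists (repr q); rewrite /qproj reprK. Qed.

Lemma qprojD x y : qproj (x + y) = qproj x + qproj y.
Proof. exact: raddfD. Qed.
Lemma qprojB x y : qproj (x - y) = qproj x - qproj y.
Proof. exact: raddfB. Qed.
Lemma qproj0 : qproj 0 = 0.
Proof. exact: raddf0. Qed.

Definition qscale (a : R) (q : quotient_module) : quotient_module := qproj (a *: repr q).

Lemma qscale_proj a x : qscale a (qproj x) = qproj (a *: x).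
Proof.
apply/qprojP; rewrite -scalerBr -[_ *: _]addr0; apply: HP.2; last exact: HP.1.
by apply/qprojP; rewrite {1}/qproj reprK.
Qed.

Fact qscaleA a b q : qscale a (qscale b q) = qscale (a * b) q.
Proof. by have [x ->] := qproj_surj q; rewrite !qscale_proj scalerA. Qed.
Fact qscale1 : left_id 1 qscale.
Proof. by move=> q; have [x ->] := qproj_surj q; rewrite !qscale_proj scale1r. Qed.
Fact qscaleDr : right_distributive qscale +%R.
Proof.
move=> a p q; have [x ->] := qproj_surj p; have [y ->] := qproj_surj q.
by rewrite -qprojD !qscale_proj scalerDr qprojD.
Qed.
Fact qscaleDl q : {morph qscale^~ q : a b / a + b}.
Proof.
by move=> a b; have [x ->] := qproj_surj q; rewrite !qscale_proj scalerDl qprojD.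
Qed.
HB.instance Definition _ := GRing.Zmodule_isLmodule.Build R quotient_module
  qscaleA qscale1 qscaleDr qscaleDl.

Lemma qprojZ a x : qproj (a *: x) = a *: qproj x.
Proof. by rewrite -qscale_proj. Qed.

End SubQuotientModules.

Section PolynomialRing.
Variables (k : idomainType) (n : nat).
Local Notation R := {mpoly k[n]}.

(* The variables are a basis of V^* and have degree 2; 0 lies in every degree. *)
Definition rdeg (e : int) (r : R) : Prop :=
  forall mm, mm \in msupp r -> e = (2 * mdeg mm)%:Z.

Lemma rdegP e r : rdeg e r <-> (forall mm, e <> (2 * mdeg mm)%:Z -> r@_mm = 0).
Proof.
split=> h mm; first by move=> ne; apply/eqP; rewrite mcoeff_eq0; apply/negP => /h.
move=> ms; apply/eqP; apply/negPn/negP => /eqP /h E.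
by move: ms; rewrite mcoeff_msupp E eqxx.
Qed.

Lemma rdeg_subgroups : gsubgroups rdeg.
Proof.
move=> d; split; first by apply/rdegP => mm _; rewrite mcoeff0.
move=> x y /rdegP hx /rdegP hy; apply/rdegP => mm ne.
by rewrite mcoeffB hx // hy // subr0.
Qed.

Lemma rdegC (c : k) : rdeg 0 c%:MP.
Proof.
move=> mm; rewrite msuppC; case: ifP => // _; rewrite inE => /eqP ->.
by rewrite mdeg0 muln0.
Qed.

Lemma rdegX mm : rdeg (2 * mdeg mm)%:Z 'X_[mm].
Proof. by move=> m'; rewrite msuppX inE => /eqP ->. Qed.

Lemma rdegM e e' r r' : rdeg e r -> rdeg e' r' -> rdeg (e + e') (r * r').
Proof.
move=> hr hr' mm /msuppM_le /allpairsP [[m1 m2] /= [/hr -> /hr' -> ->]].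
by rewrite mdegD mulnDr PoszD.
Qed.

Lemma rdegZ e (c : k) r : rdeg e r -> rdeg e (c *: r).
Proof.
move=> hr; rewrite -mul_mpolyC; have := rdegM (@rdegC c) hr; by rewrite add0r.
Qed.

Lemma rdeg_free : gfree (V := R^o) rdeg.
Proof.
move=> s c us gc E d ds; apply/mpolyP => mm; rewrite mcoeff0.
have [ed|/eqP ne] := eqVneq d (2 * mdeg mm)%:Z; last by move/rdegP: (gc d); apply.
have := congr1 (mcoeff mm) E; rewrite mcoeff0 raddf_sum /= (big_rem d) //=.
rewrite big1_seq ?addr0 // => e /andP[_]; rewrite mem_rem_uniq // !inE => /andP[ne _].
by move/rdegP: (gc e); apply; rewrite -ed; apply/eqP.
Qed.

Lemma rdeg_span (r : R) : gspan (V := R^o) rdeg r.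
Proof.
rewrite [r in gspan _ r]mpolyE; apply: gspan_sum => mm.
by apply: (@gspan1 _ R^o rdeg (2 * mdeg mm)%:Z); apply: rdegZ; exact: rdegX.
Qed.

Record is_grading (M : lmodType R) (g : int -> M -> Prop) : Prop := IsGrading {
  grading_subgroups : gsubgroups g;
  grading_scale : forall e d (r : R) x, rdeg e r -> g d x -> g (d + e) (r *: x);
  grading_span : forall x, gspan g x;
  grading_free : gfree g }.

(* As R is commutative, graded right R-modules are encoded by the left scaling
   of mathcomp: r *: x stands for x.r *)
Record grmod := Grmod {
  gr_sort :> lmodType R;
  gr : int -> gr_sort -> Prop;
  gr_grading : is_grading gr }.

Record is_left_action (M : grmod) (l : R -> M -> M) : Prop := IsLeftAction {
  left1 : forall x, l 1 x = x;
  leftM : forall a b x, l (a * b) x = l a (l b x);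
  leftDl : forall a b x, l (a + b) x = l a x + l b x;
  left_linear : forall a r x y, l a (r *: x + y) = r *: l a x + l a y;
  leftC : forall (c : k) x, l c%:MP x = c%:MP *: x;
  left_deg : forall e d a x, rdeg e a -> gr d x -> gr (d + e) (l a x) }.

Record grbimod := Grbimod {
  bi_mod :> grmod;
  lmul : R -> bi_mod -> bi_mod;
  lmul_action : is_left_action lmul }.

Definition homogeneous (M N : grmod) (l : int) (f : M -> N) : Prop :=
  forall d x, gr d x -> gr (d + l) (f x).

(* degree l maps M -> N, i.e. morphisms M -> N(l) *)
Definition right_hom (M N : grmod) (l : int) (f : M -> N) : Prop :=
  (forall r x y, f (r *: x + y) = r *: f x + f y) /\ homogeneous l f.

Definition bimod_hom (M N : grbimod) (l : int) (f : M -> N) : Prop :=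
  right_hom l f /\ forall r x, f (lmul r x) = lmul r (f x).

Definition griso (M N : grmod) : Prop :=
  exists f : M -> N, right_hom 0 f /\ bijective f.

Section Shift.
Variables (M : grmod) (l : int).
Fact shift_grading : is_grading (fun d (x : M) => gr (d + l) x).
Proof.
case: (gr_grading M) => gg gz gs gf; split.
- by move=> d; exact: gg.
- by move=> e d r x hr hx; rewrite addrAC; exact: gz.
- move=> x; have [s [hs ->]] := gs x; exists s; split => // y /hs [d gy].
  by exists (d - l); rewrite subrK.
- move=> s c us gc E d ds.
  have := gf [seq e + l | e <- s] (fun e => c (e - l)) _ _ _ (d + l).
  rewrite addrK; apply.
  + by rewrite map_inj_uniq //; exact: addIr.
  + by move=> e; rewrite -{1}[e](subrK l).
  + by rewrite big_map -[RHS]E; apply: eq_bigr => e _; rewrite addrK.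
  + exact: map_f.
Qed.
Definition shift : grmod := Grmod shift_grading.
End Shift.

Fact bishift_action (M : grbimod) l : is_left_action (M := shift M l) (@lmul M).
Proof.
case: (lmul_action M) => h1 hM hD hL hC hd; split=> //.
by move=> e d a x ha hx; rewrite /= addrAC; exact: hd.
Qed.
Definition bishift (M : grbimod) l : grbimod := Grbimod (bishift_action M l).

Section DirectSum.
Variables M N : grmod.
Fact dsum_grading :
  is_grading (fun d (x : (M * N)%type) => gr d x.1 /\ gr d x.2).
Proof.
case: (gr_grading M) => gg gz gs gf; case: (gr_grading N) => gg' gz' gs' gf'; split.
- move=> d; case: (gg d) (gg' d) => g0 gB [g0' gB']; split=> // x y [? ?] [? ?].
  by split; [exact: gB|exact: gB'].
- by move=> e d r x hr [? ?]; split; [exact: gz|exact: gz'].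
- move=> [x0 y0]; rewrite (_ : (x0, y0) = (x0, 0) + (0, y0)); last first.
    by congr (_, _); rewrite ?addr0 ?add0r.
  apply: gspanD.
    move: x0 (gs x0); apply: gspan_ind; first exact: gspan0.
    move=> d x x' gx; rewrite (_ : (x + x', 0) = (x, 0) + (x', 0)); last first.
      by congr (_, _); rewrite addr0.
    by apply: gspanD; apply: (gspan1 (d := d)); split => //; case: (gg' d).
  move: y0 (gs' y0); apply: gspan_ind; first exact: gspan0.
  move=> d x x' gx; rewrite (_ : (0, x + x') = (0, x) + (0, x')); last first.
    by congr (_, _); rewrite addr0.
  by apply: gspanD; apply: (gspan1 (d := d)); split => //; case: (gg d).
- move=> s c us gc E d ds.
  have E1 : \sum_(d <- s) (c d).1 = 0.
    by rewrite -(raddf_sum (@fst M N)) E.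
  have E2 : \sum_(d <- s) (c d).2 = 0.
    by rewrite -(raddf_sum (@snd M N)) E.
  have H1 := gf s _ us (fun d => (gc d).1) E1 d ds.
  have H2 := gf' s _ us (fun d => (gc d).2) E2 d ds.
  by move: H1 H2; case: (c d) => /= ? ? -> ->.
Qed.
Definition dsum : grmod := Grmod dsum_grading.
End DirectSum.

(* The submodule P of an ungraded module V, graded by the family g. *)
Section GradedSub.
Variables (V : lmodType R) (P : V -> Prop) (g : int -> V -> Prop).
Record is_graded_sub : Prop := IsGradedSub {
  gsub_mod : submod P;
  gsub_subgroups : gsubgroups g;
  gsub_scale : forall e d (r : R) x, rdeg e r -> g d x -> g (d + e) (r *: x);
  gsub_span : forall x, P x <-> gspan g x;
  gsub_free : gfree g }.
Hypothesis H : is_graded_sub.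
Fact gsub_grading :
  is_grading (fun d (x : submodule (gsub_mod H)) => g d (val x)).
Proof.
have [Hm gg gz gs gf] := H; split.
- move=> d; case: (gg d) => g0 gB; split; first by rewrite linear0.
  by move=> x y gx gy; rewrite linearB; exact: gB.
- by move=> e d r x hr hx; rewrite linearZ; exact: gz.
- move=> x.
  suff Q : forall y, gspan g y -> forall Py : P y,
      gspan (fun d (x : submodule (gsub_mod H)) => g d (val x))
            (to_submodule (gsub_mod H) Py).
    have -> : x = to_submodule (gsub_mod H) (submoduleP x) by apply: val_inj.
    by apply: Q; apply/gs; exact: submoduleP.
  apply: gspan_ind => [P0|d y z gy IH Pyz].
    rewrite (_ : to_submodule _ _ = 0); first exact: gspan0.
    by apply: val_inj; rewrite linear0.
  have Py : P y by apply/gs; exact: gspan1 gy.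
  have Pz : P z.
    rewrite -[z](addKr y) -scaleN1r; exact: (gsub_mod H).2.
  rewrite (_ : to_submodule _ _ = to_submodule (gsub_mod H) Py
                                  + to_submodule (gsub_mod H) Pz).
    by apply: gspanD (IH _); apply: (gspan1 (d := d)).
  by apply: val_inj; rewrite linearD.
- move=> s c us gc E d ds; apply: val_inj; rewrite linear0.
  apply: (gf s (fun d => val (c d))) => //.
  by rewrite -[LHS]linear_sum E linear0.
Qed.
Definition graded_sub : grmod := Grmod gsub_grading.
End GradedSub.

(* The direct sum of an independent family of subgroups of V. *)
Section SpanSub.
Variables (V : lmodType R) (g : int -> V -> Prop).
Hypotheses (gg : gsubgroups g)
  (gz : forall e d (r : R) x, rdeg e r -> g d x -> g (d + e) (r *: x)).
Fact gspan_scale r x : gspan g x -> gspan g (r *: x).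
Proof.
move: x; apply: gspan_ind => [|d x y gx IH]; first by rewrite scaler0; exact: gspan0.
rewrite scalerDr; apply: gspanD IH; move: r (rdeg_span r).
apply: gspan_ind => [|e r r' hr IH]; first by rewrite scale0r; exact: gspan0.
by rewrite scalerDl; apply: gspanD IH; apply: gspan1 (gz hr gx).
Qed.
Fact gspan_submod : submod (gspan g).
Proof.
split; first exact: gspan0.
by move=> a x y hx hy; apply: gspanD hy; exact: gspan_scale.
Qed.
Fact span_is_graded_sub : gfree g -> is_graded_sub (gspan g) g.
Proof. by move=> gf; split=> //; exact: gspan_submod. Qed.
End SpanSub.

(* The quotient M / (\bigoplus_d b_d), for b_d contained in M_d. *)
Section GradedQuot.
Variables (M : grmod) (b : int -> M -> Prop).
Record is_graded_family : Prop := IsGradedFamily {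
  gfam_sub : forall d x, b d x -> gr d x;
  gfam_subgroups : gsubgroups b;
  gfam_scale : forall e d (r : R) x, rdeg e r -> b d x -> b (d + e) (r *: x) }.
Hypothesis H : is_graded_family.
Fact gquot_submod : submod (gspan b).
Proof. exact: gspan_submod (gfam_scale H). Qed.
Fact gquot_grading :
  is_grading (fun d (q : quotient_module gquot_submod) =>
                exists x, gr d x /\ q = qproj gquot_submod x).
Proof.
case: (gr_grading M) => gg gz gs gf; split.
- move=> d; case: (gg d) => g0 gB; split; first by exists 0; rewrite qproj0.
  by move=> _ _ [x [gx ->]] [y [gy ->]]; exists (x - y); rewrite qprojB; split=> //; exact: gB.
- move=> e d r _ hr [x [hx ->]]; exists (r *: x); rewrite qprojZ; split=> //; exact: gz.
- move=> q; have [x ->] := qproj_surj q; move: x (gs x); apply: gspan_ind.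
    by rewrite qproj0; exact: gspan0.
  move=> d x y gx IH; rewrite qprojD; apply: gspanD IH.
  by apply: (gspan1 (d := d)); exists x.
- move=> s c us gc E d ds.
  pose x e := projT1 (cid (gc e)).
  have gx e : gr e (x e) by case: (projT2 (cid (gc e))).
  have cx e : c e = qproj gquot_submod (x e) by case: (projT2 (cid (gc e))).
  have : gspan b (\sum_(e <- s) x e).
    rewrite -[\sum_(_ <- _) _]subr0; apply/(qprojP gquot_submod); rewrite qproj0 -[RHS]E.
    elim: (s) => [|e s' IH]; first by rewrite !big_nil qproj0.
    by rewrite !big_cons qprojD IH cx.
  move=> /(gspan_decomp (gfam_subgroups H)) [t [y [ut by_ y0 Ey]]].
  have Dy : decomp (@gr M) (\sum_(e <- s) x e) t y.
    by split=> // e; apply: gfam_sub.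
  pose x' e := if e \in s then x e else 0.
  have Dx : decomp (@gr M) (\sum_(e <- s) x e) s x'.
    split=> //.
    - by move=> e; rewrite /x'; case: ifP => // _; case: (gg e).
    - by move=> e /negPf es; rewrite /x' es.
    - by rewrite big_seq [RHS]big_seq; apply: eq_bigr => e; rewrite /x' => ->.
  have Exy : x' d = y d := decomp_uniq gg gf Dx Dy d.
  rewrite cx -(qproj0 gquot_submod); apply/qprojP; rewrite subr0.
  by move: Exy; rewrite /x' ds => ->; exact: gspan1 (by_ d).
Qed.
Definition graded_quot : grmod := Grmod gquot_grading.
End GradedQuot.

End PolynomialRing.

Section Components.
Variables (k : idomainType) (n : nat).
Implicit Types M N : grmod k n.

Lemma gr0 M d : gr d (0 : M).
Proof. exact: gs0 (grading_subgroups (gr_grading M)) d. Qed.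

Lemma gr_decomp M (x : M) : exists sc, decomp (@gr _ _ M) x sc.1 sc.2.
Proof.
have [s [c D]] := gspan_decomp (grading_subgroups (gr_grading M))
  (grading_span (gr_grading M) x).
by exists (s, c).
Qed.

Definition gsupp M (x : M) : seq int := (projT1 (cid (gr_decomp x))).1.
Definition gcomp M (x : M) : int -> M := (projT1 (cid (gr_decomp x))).2.

Lemma gcompP M (x : M) : decomp (@gr _ _ M) x (gsupp x) (gcomp x).
Proof. exact: projT2 (cid (gr_decomp x)). Qed.

Lemma gcomp_gr M (x : M) d : gr d (gcomp x d).
Proof. by case: (gcompP x). Qed.

Lemma gcomp_eq M (x : M) s c : decomp (@gr _ _ M) x s c -> gcomp x =1 c.
Proof.
by apply: decomp_uniq (gcompP x); case: (gr_grading M).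
Qed.

Lemma gcompD M (x y : M) d : gcomp (x + y) d = gcomp x d + gcomp y d.
Proof.
have [ux gx x0 _] := gcompP x; have [uy gy y0 _] := gcompP y.
pose s := undup (gsupp x ++ gsupp y).
have Ex : x = \sum_(e <- s) gcomp x e.
  apply: decomp_incl (gcompP x) (undup_uniq _) _ => e es.
  by rewrite mem_undup mem_cat es.
have Ey : y = \sum_(e <- s) gcomp y e.
  apply: decomp_incl (gcompP y) (undup_uniq _) _ => e es.
  by rewrite mem_undup mem_cat es orbT.
rewrite (@gcomp_eq _ _ s (fun d => gcomp x d + gcomp y d)) //; split.
- exact: undup_uniq.
- by move=> e; apply: gsD => //; case: (gr_grading M).
- by move=> e; rewrite mem_undup mem_cat negb_or => /andP[/x0 -> /y0 ->]; rewrite addr0.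
- by rewrite big_split /= -Ex -Ey.
Qed.

Lemma gcomp_homog M (x : M) d e : gr e x -> gcomp x d = if d == e then x else 0.
Proof.
move=> gx; rewrite (@gcomp_eq _ _ [:: e] (fun d => if d == e then x else 0)) //.
split=> //.
- by move=> i; case: eqP => [->//|_]; exact: gr0.
- by move=> i; rewrite inE => /negPf ->.
- by rewrite big_seq1 eqxx.
Qed.

Lemma gcomp_map M N e (f : M -> N) (x : M) d :
  {morph f : x y / x + y} -> (forall d x, gr d x -> gr (d + e) (f x)) ->
  gcomp (f x) d = f (gcomp x (d - e)).
Proof.
move=> fD fg; have f0 : f 0 = 0.
  by apply: (addIr (f 0)); rewrite -fD !add0r.
have [us gx x0 Ex] := gcompP x.
rewrite (@gcomp_eq _ _ [seq i + e | i <- gsupp x] (fun d => f (gcomp x (d - e)))) //.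
split.
- by rewrite map_inj_uniq //; exact: addIr.
- by move=> i; rewrite -{1}[i](subrK e); apply: fg.
- move=> i hi; rewrite x0 //; apply: contra hi => hi.
  by apply/mapP; exists (i - e); rewrite ?subrK.
- rewrite big_map {1}Ex (big_morph f fD f0).
  by apply: eq_bigr => i _; rewrite addrK.
Qed.

End Components.

Section Bimodules.
Variables (k : idomainType) (n : nat).
Local Notation R := {mpoly k[n]}.
Local Notation grmod := (grmod k n).
Local Notation grbimod := (grbimod k n).

Fact regular_grading : is_grading (M := R^o) (@rdeg k n).
Proof.
split; [exact: rdeg_subgroups| |exact: rdeg_span|exact: rdeg_free].
by move=> e d r x hr hx; rewrite addrC; exact: rdegM.
Qed.
Definition Rmod : grmod := Grmod regular_grading.

Fact regular_action : is_left_action (M := Rmod) (fun a x => a * x).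
Proof.
split=> [x|a b x|a b x|a r x y|c x|e d a x ha hx].
- exact: mul1r.
- by rewrite mulrA.
- exact: mulrDl.
- by rewrite mulrDr; congr (_ + _); exact: mulrCA.
- by [].
- by rewrite addrC; exact: rdegM.
Qed.
Definition Rbim : grbimod := Grbimod regular_action.

Section LeftActionTheory.
Variable M : grbimod.
Lemma lmulDr a (x y : M) : lmul a (x + y) = lmul a x + lmul a y.
Proof. by have := left_linear (lmul_action M) a 1 x y; rewrite !scale1r. Qed.
Lemma lmul0r a : lmul a 0 = 0 :> M.
Proof. by apply: (addIr (lmul a 0)); rewrite -lmulDr !add0r. Qed.
Lemma lmulZ a r (x : M) : lmul a (r *: x) = r *: lmul a x.
Proof.
by have := left_linear (lmul_action M) a r x 0; rewrite !addr0 lmul0r addr0.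
Qed.
Lemma lmulDl a b (x : M) : lmul (a + b) x = lmul a x + lmul b x.
Proof. exact: (leftDl (lmul_action M)). Qed.
Lemma lmul0l (x : M) : lmul 0 x = 0.
Proof. by apply: (addIr (lmul 0 x)); rewrite -lmulDl !add0r. Qed.
End LeftActionTheory.

(* A graded k-subalgebra of R; closure under products is not needed. *)
Record graded_scalars (A : R -> Prop) : Prop := GradedScalars {
  scal_const : forall c : k, A c%:MP;
  scal_span : forall a, A a -> gspan (V := R^o) (fun d x => rdeg d x /\ A x) a }.

Section Tensor.
Variables (A : R -> Prop) (hA : graded_scalars A) (M N : grbimod).

(* M \otimes_A N is the commutative monoid of formal sums of pairs modulo the
   following congruence; it is a group by (- x) \otimes y + x \otimes y = 0 *)
Inductive tensor_eq : seq (M * N) -> seq (M * N) -> Prop :=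
| te_refl s : tensor_eq s s
| te_sym s t : tensor_eq s t -> tensor_eq t s
| te_trans s t u : tensor_eq s t -> tensor_eq t u -> tensor_eq s u
| te_cat s s' t t' : tensor_eq s s' -> tensor_eq t t' ->
    tensor_eq (s ++ t) (s' ++ t')
| te_comm s t : tensor_eq (s ++ t) (t ++ s)
| te_zero y : tensor_eq [:: (0, y)] [::]
| te_addl x x' y : tensor_eq [:: (x + x', y)] [:: (x, y); (x', y)]
| te_addr x y y' : tensor_eq [:: (x, y + y')] [:: (x, y); (x, y')]
| te_bal a x y : A a -> tensor_eq [:: (a *: x, y)] [:: (x, lmul a y)].

Definition tensor_eqb (_ : graded_scalars A) (s t : seq (M * N)) : bool :=
  `[< tensor_eq s t >].
Fact tensor_eqb_equiv : equiv_class_of (tensor_eqb hA).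
Proof.
split=> [s|s t|t s u].
- by apply/asboolP; exact: te_refl.
- by apply/asboolP/asboolP; exact: te_sym.
- by move=> /asboolP h /asboolP h'; apply/asboolP; exact: te_trans h h'.
Qed.
Canonical tensor_equiv := EquivRelPack tensor_eqb_equiv.
Canonical tensor_enc := defaultEncModRel (tensor_eqb hA).
Definition tensor_type := {eq_quot (tensor_eqb hA)}.
HB.instance Definition _ := Choice.on tensor_type.

Definition tclass (s : seq (M * N)) : tensor_type := \pi_({eq_quot (tensor_eqb hA)}) s.

Lemma tclassP s t : tclass s = tclass t <-> tensor_eq s t.
Proof.
by rewrite /tclass; split=> [/eqmodP /asboolP|h] //; apply/eqmodP/asboolP.
Qed.
Definition trepr (x : tensor_type) : seq (M * N) := repr x.
Lemma treprK x : tclass (trepr x) = x.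
Proof. exact: reprK. Qed.
Lemma trepr_class s : tensor_eq (trepr (tclass s)) s.
Proof. by apply/tclassP; rewrite treprK. Qed.

Definition tadd x y := tclass (trepr x ++ trepr y).
Definition topp x := tclass [seq (- p.1, p.2) | p <- trepr x].
Lemma tadd_class s t : tadd (tclass s) (tclass t) = tclass (s ++ t).
Proof. by apply/tclassP; apply: te_cat; exact: trepr_class. Qed.
Fact taddA : associative tadd.
Proof.
by move=> x y z; rewrite -[x]treprK -[y]treprK -[z]treprK !tadd_class catA.
Qed.
Fact taddC : commutative tadd.
Proof.
move=> x y; rewrite -[x]treprK -[y]treprK !tadd_class.
by apply/tclassP; exact: te_comm.
Qed.
Fact tadd0 : left_id (tclass [::]) tadd.
Proof. by move=> x; rewrite -[x]treprK tadd_class. Qed.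
Fact taddN : left_inverse (tclass [::]) topp tadd.
Proof.
move=> x; rewrite -{2}[x]treprK tadd_class; apply/tclassP.
elim: (trepr x) => [|[a b] s IH] /=; first exact: te_refl.
have -> : [:: (- a, b) & [seq (- p.1, p.2) | p <- s] ++ (a, b) :: s]
        = ([:: (- a, b)] ++ [seq (- p.1, p.2) | p <- s]) ++ ([:: (a, b)] ++ s) by [].
apply: (@te_trans _ ([seq (- p.1, p.2) | p <- s] ++ [:: (- a, b)] ++ [:: (a, b)] ++ s)).
  by rewrite catA; apply: te_cat (te_refl _); exact: te_comm.
rewrite -[[::]]cats0.
apply: (@te_trans _ ([seq (- p.1, p.2) | p <- s] ++ s)); last first.
  by rewrite cats0.
apply: te_cat (te_refl _) _; rewrite catA -[s in X in tensor_eq _ X]cat0s.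
apply: te_cat (te_refl _); apply: te_trans (te_zero b).
by rewrite -[0](addNr a); apply: te_sym; exact: te_addl.
Qed.
HB.instance Definition _ := GRing.isZmodule.Build tensor_type taddA taddC tadd0 taddN.

Definition tens (x : M) (y : N) : tensor_type := tclass [:: (x, y)].

Lemma tclass_sum s : tclass s = \sum_(p <- s) tens p.1 p.2.
Proof.
elim: s => [|[x y] s IH]; first by rewrite big_nil.
by rewrite big_cons -IH [RHS]tadd_class.
Qed.
Lemma tclass_cat s t : tclass (s ++ t) = tclass s + tclass t.
Proof. by rewrite -tadd_class. Qed.

Definition balanced (Z : zmodType) (f : M -> N -> Z) : Prop :=
  [/\ forall x x' y, f (x + x') y = f x y + f x' y,
      forall x y y', f x (y + y') = f x y + f x y'
    & forall a x y, A a -> f (a *: x) y = f x (lmul a y)].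

Lemma balanced0l (Z : zmodType) (f : M -> N -> Z) y : balanced f -> f 0 y = 0.
Proof. by case=> hD _ _; apply: (addIr (f 0 y)); rewrite -hD !add0r. Qed.
Lemma balanced0r (Z : zmodType) (f : M -> N -> Z) x : balanced f -> f x 0 = 0.
Proof. by case=> _ hD _; apply: (addIr (f x 0)); rewrite -hD !add0r. Qed.

Lemma tens_balanced : balanced tens.
Proof.
split=> [x x' y|x y y'|a x y ha]; rewrite -?tclass_cat; apply/tclassP.
- exact: te_addl.
- exact: te_addr.
- exact: te_bal.
Qed.

Definition tlift (Z : zmodType) (f : M -> N -> Z) (x : tensor_type) : Z :=
  \sum_(p <- trepr x) f p.1 p.2.

Lemma tlift_class (Z : zmodType) (f : M -> N -> Z) s : balanced f ->
  tlift f (tclass s) = \sum_(p <- s) f p.1 p.2.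
Proof.
move=> hf; rewrite /tlift; move: (trepr_class s); move: (trepr _) => t.
elim=> {s t} //=.
- by move=> s t u _ -> _ ->.
- by move=> s s' t t' _ E _ E'; rewrite !big_cat /= E E'.
- by move=> s t; rewrite !big_cat /= addrC.
- by move=> y; rewrite big_seq1 big_nil /= balanced0l.
- by move=> x x' y; rewrite !big_cons !big_nil /= !addr0; case: hf.
- by move=> x y y'; rewrite !big_cons !big_nil /= !addr0; case: hf.
- by move=> a x y ha; rewrite !big_seq1 /=; case: hf => _ _; apply.
Qed.

Section Lift.
Variables (Z : zmodType) (f : M -> N -> Z) (hf : balanced f).
Lemma tlift_tens x y : tlift f (tens x y) = f x y.
Proof. by rewrite tlift_class // big_seq1. Qed.
Lemma tliftD x y : tlift f (x + y) = tlift f x + tlift f y.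
Proof.
by rewrite -[x]treprK -[y]treprK -tclass_cat !tlift_class // big_cat.
Qed.
Lemma tlift0 : tlift f 0 = 0.
Proof. by apply: (addIr (tlift f 0)); rewrite -tliftD !add0r. Qed.
Lemma tlift_sum I (s : seq I) F :
  tlift f (\sum_(i <- s) F i) = \sum_(i <- s) tlift f (F i).
Proof.
elim: s => [|i s IH]; first by rewrite !big_nil tlift0.
by rewrite !big_cons tliftD IH.
Qed.
End Lift.

Lemma tens_ind (Q : tensor_type -> Prop) : Q 0 ->
  (forall x y, Q (tens x y)) -> (forall x y, Q x -> Q y -> Q (x + y)) ->
  forall x, Q x.
Proof.
move=> Q0 Q1 QD x; rewrite -[x]treprK tclass_sum.
by elim: (trepr x) => [|p s IH]; rewrite ?big_nil // big_cons; exact: QD.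
Qed.

Definition tscale (r : R) := tlift (fun x y => tens x (r *: y)).
Definition tlmul (a : R) := tlift (fun x y => tens (lmul a x) y).

Fact tscale_balanced r : balanced (fun x y => tens x (r *: y)).
Proof.
case: tens_balanced => h1 h2 h3; split=> [x x' y|x y y'|a x y ha].
- exact: h1.
- by rewrite scalerDr h2.
- by rewrite h3 // lmulZ.
Qed.
Fact tlmul_balanced r : balanced (fun x y => tens (lmul r x) y).
Proof.
case: tens_balanced => h1 h2 h3; split=> [x x' y|x y y'|a x y ha].
- by rewrite lmulDr h1.
- exact: h2.
- by rewrite lmulZ h3.
Qed.
Lemma tscale_tens r x y : tscale r (tens x y) = tens x (r *: y).
Proof. exact: tlift_tens (tscale_balanced r) _ _. Qed.
Lemma tlmul_tens r x y : tlmul r (tens x y) = tens (lmul r x) y.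
Proof. exact: tlift_tens (tlmul_balanced r) _ _. Qed.
Lemma tscaleD r x y : tscale r (x + y) = tscale r x + tscale r y.
Proof. exact: tliftD (tscale_balanced r) _ _. Qed.
Lemma tlmulD r x y : tlmul r (x + y) = tlmul r x + tlmul r y.
Proof. exact: tliftD (tlmul_balanced r) _ _. Qed.
Lemma tscale0 r : tscale r 0 = 0.
Proof. exact: tlift0 (tscale_balanced r). Qed.
Lemma tlmul0 r : tlmul r 0 = 0.
Proof. exact: tlift0 (tlmul_balanced r). Qed.

Fact tscaleA a b x : tscale a (tscale b x) = tscale (a * b) x.
Proof.
move: x; apply: tens_ind => [|x y|x y hx hy]; rewrite ?tscale0 //.
- by rewrite !tscale_tens scalerA.
- by rewrite !tscaleD hx hy.
Qed.
Fact tscale1 : left_id 1 tscale.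
Proof.
apply: tens_ind => [|x y|x y hx hy]; rewrite ?tscale0 //.
- by rewrite !tscale_tens scale1r.
- by rewrite !tscaleD hx hy.
Qed.
Fact tscaleDr : right_distributive tscale +%R.
Proof. exact: tscaleD. Qed.
Fact tscaleDl x : {morph tscale^~ x : a b / a + b}.
Proof.
move=> a b; move: x; apply: tens_ind => [|x y|x y hx hy]; rewrite ?tscale0 ?addr0 //.
- by rewrite !tscale_tens scalerDl; case: tens_balanced.
- by rewrite !tscaleD hx hy addrACA.
Qed.
HB.instance Definition _ := GRing.Zmodule_isLmodule.Build R tensor_type
  tscaleA tscale1 tscaleDr tscaleDl.

Definition tdeg (d : int) (x : tensor_type) : Prop :=
  exists s : seq (M * N), x = \sum_(p <- s) tens p.1 p.2 /\
    forall p, p \in s -> exists i, gr i p.1 /\ gr (d - i) p.2.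


Definition tcomp_fun (d : int) (x : M) (y : N) : tensor_type :=
  \sum_(i <- gsupp x) tens (gcomp x i) (gcomp y (d - i)).

Lemma tcomp_funE d x y s : uniq s -> {subset gsupp x <= s} ->
  tcomp_fun d x y = \sum_(i <- s) tens (gcomp x i) (gcomp y (d - i)).
Proof.
have [ux gx x0 _] := gcompP x => us ss; apply: big_incl => // i /x0 ->.
exact: balanced0l tens_balanced.
Qed.

Lemma tcomp_balanced d : balanced (tcomp_fun d).
Proof.
have [tD tD' tb] := tens_balanced.
have hD x x' y : tcomp_fun d (x + x') y = tcomp_fun d x y + tcomp_fun d x' y.
  pose s := undup (gsupp x ++ gsupp x' ++ gsupp (x + x')).
  have us : uniq s := undup_uniq _.
  rewrite !(@tcomp_funE _ _ _ s) //.
  - by rewrite -big_split; apply: eq_bigr => i _; rewrite gcompD tD.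
  - by move=> i hi; rewrite mem_undup !mem_cat hi !orbT.
  - by move=> i hi; rewrite mem_undup !mem_cat hi.
  - by move=> i hi; rewrite mem_undup !mem_cat hi !orbT.
have hD' x y y' : tcomp_fun d x (y + y') = tcomp_fun d x y + tcomp_fun d x y'.
  by rewrite -big_split; apply: eq_bigr => i _; rewrite gcompD tD'.
split=> // a x y /(scal_span hA); move: a x y.
suff H : forall a, gspan (V := R^o) (fun d x => rdeg d x /\ A x) a ->
    forall x y, tcomp_fun d (a *: x) y = tcomp_fun d x (lmul a y).
  by move=> a x y ha; exact: H.
apply: gspan_ind => [x y|e a b [ha Aa] IH x y].
  rewrite scale0r lmul0l.
  have -> : tcomp_fun d 0 y = 0 by apply: (addIr (tcomp_fun d 0 y)); rewrite -hD !add0r.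
  by apply: (addIr (tcomp_fun d x 0)); rewrite -hD' !add0r.
rewrite scalerDl lmulDl hD hD' IH; congr (_ + _).
pose s := undup (gsupp x ++ [seq i - e | i <- gsupp (a *: x)]).
have us : uniq s := undup_uniq _.
rewrite (@tcomp_funE _ x _ s) //; last first.
  by move=> i hi; rewrite mem_undup !mem_cat hi.
rewrite (@tcomp_funE _ _ _ [seq i + e | i <- s]); first last.
- move=> i hi; apply/mapP; exists (i - e); rewrite ?subrK //.
  by rewrite mem_undup mem_cat (map_f (fun i => i - e)) ?orbT.
- by rewrite map_inj_uniq //; exact: addIr.
rewrite big_map; apply: eq_bigr => i _.
rewrite (@gcomp_map _ _ _ _ e (fun x : M => a *: x)); first last.
- by move=> j z gz; exact: grading_scale (gr_grading M) _ _ _ _ ha gz.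
- by move=> ? ?; rewrite scalerDr.
rewrite (@gcomp_map _ _ _ _ e (fun y : N => lmul a y)); first last.
- by move=> j z gz; exact: left_deg (lmul_action N) _ _ _ _ ha gz.
- by move=> ? ?; rewrite lmulDr.
by rewrite addrK tb // opprD addrA.
Qed.

Lemma tcomp_tdeg d e x : tdeg e x ->
  tlift (tcomp_fun d) x = if d == e then x else 0.
Proof.
move=> [s [-> hs]]; rewrite (tlift_sum (tcomp_balanced d)).
have -> : (if d == e then \sum_(p <- s) tens p.1 p.2 else 0) =
  \sum_(p <- s) (if d == e then tens p.1 p.2 else 0).
  by case: eqP => // _; rewrite big1.
apply: eq_big_seq => p /hs [i [g1 g2]]; rewrite (tlift_tens (tcomp_balanced d)).
have [ux gx x0 _] := gcompP p.1.
rewrite (@tcomp_funE _ _ _ (undup (i :: gsupp p.1))) ?undup_uniq //; last first.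
  by move=> j hj; rewrite mem_undup inE hj orbT.
transitivity (\sum_(j <- undup (i :: gsupp p.1))
    if j == i then (if d == e then tens p.1 p.2 else 0) else 0).
  apply: eq_bigr => j _; rewrite (gcomp_homog _ g1) (gcomp_homog _ g2).
  case: (j =P i) => [->|_]; last exact: balanced0l tens_balanced.
  rewrite (can_eq (subrK i)).
  by case: eqP => // _; exact: balanced0r tens_balanced.
by rewrite (@sum_if_eq _ [the lmodType R of tensor_type]) ?undup_uniq // mem_undup mem_head.
Qed.

Fact tensor_grading : is_grading (M := tensor_type) tdeg.
Proof.
split.
- move=> d; split; first by exists [::]; rewrite big_nil; split.
  move=> _ _ [s [-> hs]] [t [-> ht]].
  exists (s ++ [seq (- p.1, p.2) | p <- t]); split; last first.
    move=> p; rewrite mem_cat => /orP[/hs //|/mapP[q /ht [i [g1 g2]] ->]].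
    by exists i; split => //; apply: gsN => //; case: (gr_grading M).
  rewrite big_cat big_map -sumrN; congr (_ + _); apply: eq_bigr => p _ /=.
  apply: (addIr (tens p.1 p.2)); have [tD _ _] := tens_balanced.
  by rewrite addNr -tD addNr (balanced0l _ tens_balanced).
- move=> e d r _ hr [s [-> hs]]; exists [seq (p.1, r *: p.2) | p <- s]; split.
    by rewrite big_map scaler_sumr; apply: eq_bigr => p _; exact: tscale_tens.
  move=> _ /mapP[p /hs [i [g1 g2]] ->]; exists i; split => //=.
  by rewrite addrAC; exact: grading_scale (gr_grading N) _ _ _ _ hr g2.
- have [tD tD' _] := tens_balanced.
  apply: tens_ind => [|x y|x y]; [exact: gspan0| |exact: gspanD].
  move: x (grading_span (gr_grading M) x); apply: gspan_ind => [|i x x' gx IH].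
    by rewrite (balanced0l _ tens_balanced); exact: gspan0.
  rewrite tD; apply: gspanD IH; move: y (grading_span (gr_grading N) y).
  apply: gspan_ind => [|j y y' gy IH].
    by rewrite (balanced0r _ tens_balanced); exact: gspan0.
  rewrite tD'; apply: gspanD IH; apply: (gspan1 (d := i + j)).
  exists [:: (x, y)]; rewrite big_seq1; split => // p; rewrite inE => /eqP -> /=.
  by exists i; rewrite addrAC subrr add0r.
- move=> s c us gc E d ds.
  have := congr1 (tlift (tcomp_fun d)) E.
  rewrite (tlift_sum (tcomp_balanced d)) (tlift0 (tcomp_balanced d)) => <-.
  transitivity (\sum_(e <- s) if e == d then c d else 0).
    by rewrite (@sum_if_eq _ [the lmodType R of tensor_type]) // ds.
  apply: eq_bigr => e _; rewrite (tcomp_tdeg _ (gc e)) eq_sym.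
  by case: eqP => // ->.
Qed.
Definition tensor_grmod : grmod := Grmod tensor_grading.

Fact tensor_action : is_left_action (M := tensor_grmod) tlmul.
Proof.
have [tD tD' tb] := tens_balanced.
split.
- apply: tens_ind => [|x y|x y hx hy]; rewrite ?tlmul0 //.
    by rewrite tlmul_tens (left1 (lmul_action M)).
  by rewrite tlmulD hx hy.
- move=> a b; apply: tens_ind => [|x y|x y hx hy]; rewrite ?tlmul0 //.
    by rewrite !tlmul_tens (leftM (lmul_action M)).
  by rewrite !tlmulD hx hy.
- move=> a b; apply: tens_ind => [|x y|x y hx hy]; rewrite ?tlmul0 ?addr0 //.
    by rewrite !tlmul_tens lmulDl tD.
  by rewrite !tlmulD hx hy addrACA.
- move=> a r x y; rewrite tlmulD; congr (_ + _).
  move: x; apply: tens_ind => [|x z|x z hx hz]; rewrite ?scaler0 ?tlmul0 ?scaler0 //.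
    by rewrite ![_ *: _]tscale_tens !tlmul_tens [RHS]tscale_tens.
  by rewrite scalerDr !tlmulD hx hz scalerDr.
- move=> c; apply: tens_ind => [|x y|x y hx hy]; rewrite ?tlmul0 ?scaler0 //.
    rewrite tlmul_tens [RHS]tscale_tens (leftC (lmul_action M)) tb; last exact: scal_const.
    by rewrite (leftC (lmul_action N)).
  by rewrite tlmulD hx hy scalerDr.
- move=> e d a _ ha [s [-> hs]]; exists [seq (lmul a p.1, p.2) | p <- s]; split.
    rewrite big_map [LHS](tlift_sum (tlmul_balanced a)); apply: eq_bigr => p _.
    exact: tlmul_tens.
  move=> _ /mapP[p /hs [i [g1 g2]] ->]; exists (i + e); split => /=.
    exact: left_deg (lmul_action M) _ _ _ _ ha g1.
  by rewrite opprD addrACA subrr addr0.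
Qed.
Definition tensor : grbimod := Grbimod tensor_action.

End Tensor.

Section RightHomTheory.
Variables (M N : grmod) (l : int) (f : M -> N) (hf : right_hom l f).
Lemma right_homD x y : f (x + y) = f x + f y.
Proof. by rewrite -[x in LHS]scale1r hf.1 scale1r. Qed.
Lemma right_hom0 : f 0 = 0.
Proof. by apply: (addIr (f 0)); rewrite -right_homD !add0r. Qed.
Lemma right_homZ r x : f (r *: x) = r *: f x.
Proof. by rewrite -[r *: x]addr0 hf.1 right_hom0 addr0. Qed.
Lemma right_hom_sum I (s : seq I) F :
  f (\sum_(i <- s) F i) = \sum_(i <- s) f (F i).
Proof. exact: (big_morph f right_homD right_hom0). Qed.
End RightHomTheory.

Section HomFamilies.
Variables M N : grmod.
Local Notation V := ((M -> N) : lmodType R).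

Lemma right_hom_free (c : int -> M -> N) s : uniq s ->
  (forall l, right_hom l (c l)) -> \sum_(l <- s) c l = 0 :> V ->
  forall l, l \in s -> c l = 0.
Proof.
move=> us hc E l ls; have [gg _ _ gf] := gr_grading N.
apply/funext => x; move: x (grading_span (gr_grading M) x).
apply: gspan_ind => [|d x y gx IH]; first exact: (right_hom0 (hc l)).
rewrite (right_homD (hc l)) IH addr0.
have Ex : \sum_(i <- s) c i x = 0.
  by have := congr1 (fun h : M -> N => h x) E; rewrite fct_sumE.
have := gf [seq d + i | i <- s] (fun i => c (i - d) x) _ _ _ (d + l).
rewrite addrAC subrr add0r; apply.
- by rewrite map_inj_uniq //; exact: addrI.
- by move=> i; rewrite -{1}[i](subrK d) addrC; exact: (hc _).2.
- rewrite big_map -[RHS]Ex; apply: eq_bigr => i _.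
  by rewrite addrAC subrr add0r.
- exact: map_f.
Qed.

Lemma right_hom_subgroups : gsubgroups (V := V) (@right_hom k n M N).
Proof.
have [gg _ _ _] := gr_grading N.
move=> l; split.
  split=> [r x y|d x _]; last exact: gs0 gg _.
  by change (0 = r *: 0 + 0 :> N); rewrite scaler0 addr0.
move=> f f' [hf1 hf2] [hf1' hf2']; split=> [r x y|d x gx].
  change (f (r *: x + y) - f' (r *: x + y) = r *: (f x - f' x) + (f y - f' y)).
  by rewrite hf1 hf1' scalerBr opprD addrACA.
by apply: (gsB gg); [exact: hf2|exact: hf2'].
Qed.

Lemma right_hom_scale e d (r : R) (f : V) : rdeg e r -> right_hom d f ->
  right_hom (d + e) (r *: f).
Proof.
move=> hr [hf1 hf2]; split=> [a x y|i x gx].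
  change (r *: f (a *: x + y) = a *: (r *: f x) + r *: f y).
  by rewrite hf1 scalerDr !scalerA mulrC.
by rewrite addrA; exact: grading_scale (gr_grading N) _ _ _ _ hr (hf2 _ _ gx).
Qed.

(* \bigoplus_l Hom_{-R}(M, N(l)) *)
Fact right_hom_is_graded :
  is_graded_sub (gspan (V := V) (@right_hom k n M N)) (@right_hom k n M N).
Proof.
apply: span_is_graded_sub; first exact: right_hom_subgroups.
  exact: right_hom_scale.
by move=> s c us hc E; exact: right_hom_free.
Qed.
Definition graded_right_hom : grmod := graded_sub right_hom_is_graded.
End HomFamilies.

Definition dual (N : grmod) : grmod := graded_right_hom N Rmod.

Section Kernel.
Variables (M N : grmod) (l : int) (f : M -> N) (hf : right_hom l f).
Fact kernel_is_graded :
  is_graded_sub (fun x => f x = 0) (fun d x => gr d x /\ f x = 0).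
Proof.
have [gg gz gs gf] := gr_grading M.
split.
- split=> [|a x y hx hy]; first exact: right_hom0 hf.
  by rewrite hf.1 hx hy scaler0 addr0.
- move=> d; split; first by split; [exact: gr0|exact: right_hom0 hf].
  move=> x y [gx fx] [gy fy]; split; first exact: gsB.
  by rewrite addrC -scaleN1r hf.1 fx fy scaler0 addr0.
- move=> e d r x hr [gx fx]; split; first exact: gz.
  by rewrite (right_homZ hf) fx scaler0.
- move=> x; split=> [fx|[s [hs ->]]].
    have [us gx x0 Ex] := gcompP x.
    have H d : d \in gsupp x -> f (gcomp x d) = 0.
      move=> ds; have [_ _ _ gfN] := gr_grading N.
      have := gfN [seq i + l | i <- gsupp x] (fun i => f (gcomp x (i - l))) _ _ _ (d + l).
      rewrite addrK; apply.
      + by rewrite map_inj_uniq //; exact: addIr.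
      + by move=> i; rewrite -{1}[i](subrK l); apply: hf.2.
      + rewrite big_map -[RHS]fx [in RHS]Ex (right_hom_sum hf).
        by apply: eq_bigr => i _; rewrite addrK.
      + exact: map_f.
    rewrite Ex big_seq; elim: (gsupp x) {1 3}(gsupp x) H => [|d s IH] t H.
      by rewrite big_nil; exact: gspan0.
    rewrite big_cons; case: ifP => [dt|_]; last exact: IH.
    by apply: gspanD (IH _ H); apply: (gspan1 (d := d)); split=> //; exact: H.
  rewrite (right_hom_sum hf) big1_seq // => y /andP[_ /hs]; by case=> d [].
- move=> s c us hc; apply: gf => // d; by case: (hc d).
Qed.
Definition kernel : grmod := graded_sub kernel_is_graded.
End Kernel.

Definition projective (P : grbimod) : Prop :=
  forall (M N : grbimod) (p : M -> N) (f : P -> N),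
    bimod_hom 0 p -> bimod_hom 0 f -> (forall y, exists x, p x = y) ->
    exists g : P -> M, bimod_hom 0 g /\ forall x, p (g x) = f x.

Record projective_resolution (M : grbimod) := ProjectiveResolution {
  res_obj :> nat -> grbimod;
  res_aug : res_obj 0 -> M;
  res_d : forall i, res_obj i.+1 -> res_obj i;
  res_projective : forall i, projective (res_obj i);
  res_aug_hom : bimod_hom 0 res_aug;
  res_d_hom : forall i, bimod_hom 0 (@res_d i);
  res_aug_surj : forall y, exists x, res_aug x = y;
  res_exact0 : forall x, res_aug x = 0 <-> exists z, @res_d 0 z = x;
  res_exact : forall i x, @res_d i x = 0 <-> exists z, @res_d i.+1 z = x }.

Section Ext.
Variables (M : grbimod) (P : projective_resolution M) (N : grbimod).

Lemma bimod_hom_comp (X Y Z : grbimod) l l' (f : X -> Y) (g : Y -> Z) :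
  bimod_hom l f -> bimod_hom l' g -> bimod_hom (l + l') (g \o f).
Proof.
move=> [[f1 f2] f3] [[g1 g2] g3]; split; first split.
- by move=> r x y /=; rewrite f1 g1.
- by move=> d x gx /=; rewrite addrA; exact/g2/f2.
- by move=> r x /=; rewrite f3 g3.
Qed.

Definition cocycle i (l : int) (f : P i -> N) : Prop :=
  bimod_hom l f /\ forall x, f (res_d x) = 0.

Definition coboundary i (l : int) : (P i -> N) -> Prop :=
  match i return (P i -> N) -> Prop with
  | 0%N => fun f => f = 0
  | j.+1 => fun f => exists g : P j -> N, bimod_hom l g /\ f = g \o @res_d _ P j
  end.

Lemma bimod_hom_subgroups (X Y : grbimod) :
  gsubgroups (V := (X -> Y) : lmodType R) (@bimod_hom k n X Y).
Proof.
move=> l; have [h0 hB] := @right_hom_subgroups X Y l; split.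
  by split=> // r x; change (0 = lmul r 0 :> Y); rewrite lmul0r.
move=> f g [hf1 hf2] [hg1 hg2]; split; first exact: hB.
move=> r x; change (f (lmul r x) - g (lmul r x) = lmul r (f x - g x)).
by rewrite hf2 hg2 lmulDr -[- g x]scaleN1r lmulZ scaleN1r.
Qed.

Lemma bimod_hom_scale (X Y : grbimod) e d (r : R) (f : (X -> Y) : lmodType R) :
  rdeg e r -> bimod_hom d f -> bimod_hom (d + e) (r *: f).
Proof.
move=> hr [hf1 hf2]; split; first exact: right_hom_scale.
by move=> a x; change (r *: f (lmul a x) = lmul a (r *: f x)); rewrite hf2 lmulZ.
Qed.

Section Degree.
Variable i : nat.
Local Notation V := ((P i -> N) : lmodType R).

Lemma cocycle_subgroups : gsubgroups (V := V) (@cocycle i).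
Proof.
move=> l; have [h0 hB] := @bimod_hom_subgroups (P i) N l; split; first by split.
move=> f g [hf1 hf2] [hg1 hg2]; split; first exact: hB.
by move=> x; change (f (res_d x) - g (res_d x) = 0); rewrite hf2 hg2 subr0.
Qed.

Lemma cocycle_scale e d (r : R) (f : V) : rdeg e r -> cocycle d f ->
  cocycle (d + e) (r *: f).
Proof.
move=> hr [hf1 hf2]; split; first exact: bimod_hom_scale.
by move=> x; change (r *: f (res_d x) = 0); rewrite hf2 scaler0.
Qed.

Fact cocycles_are_graded :
  is_graded_sub (gspan (V := V) (@cocycle i)) (@cocycle i).
Proof.
apply: span_is_graded_sub; first exact: cocycle_subgroups.
  exact: cocycle_scale.
by move=> s c us hc E; apply: right_hom_free E => // l; case: (hc l) => -[].
Qed.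
Definition cocycles : grmod := graded_sub cocycles_are_graded.

Lemma coboundary_cocycle l (f : V) : coboundary l f -> cocycle l f.
Proof.
case: (i) f => [f ->|j f [g [hg ->]]].
  by have [] := @bimod_hom_subgroups (P 0) N l.
split; first by rewrite -[l]add0r; apply: bimod_hom_comp hg; exact: res_d_hom.
move=> x /=; have -> : res_d (res_d x) = 0 by apply/res_exact; exists x.
exact: right_hom0 hg.1.
Qed.

Lemma coboundary0 l : coboundary l (0 : V).
Proof.
case: (i) => //= j; exists (0 : (P j -> N) : lmodType R); split=> //.
by case: (@bimod_hom_subgroups (P j) N l).
Qed.

Lemma coboundaryB l (f g : V) :
  coboundary l f -> coboundary l g -> coboundary l (f - g).
Proof.
case: (i) f g => [f g -> ->|j f g /= [f' [hf ->]] [g' [hg ->]]] /=.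
  by rewrite subr0.
exists ((f' : (P j -> N) : lmodType R) - g'); split; last by [].
by have [_] := @bimod_hom_subgroups (P j) N l; apply.
Qed.

Lemma coboundary_scale e d (r : R) (f : V) : rdeg e r -> coboundary d f ->
  coboundary (d + e) (r *: f).
Proof.
move=> hr; case: (i) f => [f ->|j f /= [f' [hf ->]]] /=; first by rewrite scaler0.
by exists (r *: (f' : (P j -> N) : lmodType R)); split=> //; exact: bimod_hom_scale.
Qed.

Fact coboundaries_are_graded :
  is_graded_family (M := cocycles) (fun l f => coboundary l (val f)).
Proof.
split.
- by move=> l f; exact: coboundary_cocycle.
- move=> l; split; first exact: coboundary0.
  by move=> f g; exact: coboundaryB.
- by move=> e d r f; exact: coboundary_scale.
Qed.

(* \bigoplus_l Ext^i(M, N(l)), with right R-action (f.r)(x) = f(x).r *)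
Definition Ext : grmod := graded_quot coboundaries_are_graded.
End Degree.
End Ext.
End Bimodules.

Inductive gen := gen_s | gen_t.

Section Realization.
Variables (k : idomainType) (n : nat).
Local Notation R := {mpoly k[n]}.

(* V = k^n and its dual V^*; the coordinates on V are the variables of R = Sym(V^* ) *)
Definition pairing (v : 'cV[k]_n) (lam : 'rV[k]_n) : k := (lam *m v) 0 0.

Definition refl (a : 'rV[k]_n) (av : 'cV[k]_n) (v : 'cV[k]_n) : 'cV[k]_n :=
  v - pairing v a *: av.
Definition corefl (a : 'rV[k]_n) (av : 'cV[k]_n) (lam : 'rV[k]_n) : 'rV[k]_n :=
  lam - pairing av lam *: a.

(* the quantum number [d], as a function of two = [2] *)
Fixpoint qnum (two : k) (d : nat) : k :=
  match d with
  | 0%N => 0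
  | d'.+1 => if d' is d''.+1 then two * qnum two d' - qnum two d'' else 1
  end.

Record realization (m : nat) := Realization {
  root : gen -> 'rV[k]_n;
  coroot : gen -> 'cV[k]_n;
  rho : gen -> 'rV[k]_n;
  pairing_root i : pairing (coroot i) (root i) = 2;
  refl_order v :
    iter m (fun u => refl (root gen_s) (coroot gen_s)
                       (refl (root gen_t) (coroot gen_t) u)) v = v;
  corefl_order lam :
    iter m (fun u => corefl (root gen_s) (coroot gen_s)
                       (corefl (root gen_t) (coroot gen_t) u)) lam = lam;
  a_st := pairing (coroot gen_s) (root gen_t);
  cartan_symmetric : pairing (coroot gen_t) (root gen_s) = a_st;
  (* q may live in an extension of k *)
  faithful : exists (K : fieldType) (iota : {rmorphism k -> K}) (q : K),
    [/\ injective iota, (2 * m).-primitive_root q & iota (- a_st) = q + q^-1];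
  balanced_qnum : qnum (- a_st) m.-1 = 1;
  lesser_invertibility d : (1 <= d < m)%N -> qnum (- a_st) d \is a GRing.unit;
  roots_free a b : a *: root gen_s + b *: root gen_t = 0 -> a = 0 /\ b = 0;
  demazure_root i c : exists v, pairing v (root i) = c;
  demazure_coroot i c : exists lam, pairing (coroot i) lam = c;
  rho_ss : pairing (coroot gen_s) (rho gen_s) = 1;
  rho_tt : pairing (coroot gen_t) (rho gen_t) = 1;
  rho_st : pairing (coroot gen_s) (rho gen_t) = 0;
  rho_ts : pairing (coroot gen_t) (rho gen_s) = 0 }.

Definition linform (lam : 'rV[k]_n) : R := \sum_(j < n) lam 0 j *: 'X_j.

Lemma linform_deg lam : rdeg 2 (linform lam).
Proof.
apply: (gs_sum (V := R^o) (@rdeg_subgroups k n)) => j _; apply: rdegZ.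
have := @rdegX k n U_(j); by rewrite mdeg1.
Qed.

Variables (m : nat) (Rz : realization m).

Definition act_dual (i : gen) : 'rV[k]_n -> 'rV[k]_n := corefl (root Rz i) (coroot Rz i).

Definition Lambda_st_trivial : Prop :=
  forall lam, (forall i, act_dual i lam = lam) -> lam = 0.

Definition act_poly (i : gen) (p : R) : R :=
  p \mPo [tuple linform (act_dual i (delta_mx 0 j)) | j < n].

Definition invariant (i : gen) (p : R) : Prop := act_poly i p = p.

Lemma act_poly_deg i d p : rdeg d p -> rdeg d (act_poly i p).
Proof.
move=> hp; rewrite /act_poly comp_mpolyE big_seq.
apply: (gs_sum (V := R^o) (@rdeg_subgroups k n)) => mm /hp ->; apply: rdegZ.
have -> : (2 * mdeg mm)%:Z = \sum_(j < n) (2 * mm j)%:Z.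
  by rewrite mdegE big_distrr /=; apply: (big_morph Posz PoszD).
apply: (big_ind2 (fun (e : int) (r : R) => rdeg e r)).
- exact: rdegC.
- by move=> e r e' r'; exact: rdegM.
move=> j _; rewrite tnth_mktuple.
elim: (mm j) => [|c IH]; first by rewrite muln0 expr0; exact: rdegC.
by rewrite exprS mulnS PoszD; apply: rdegM IH; exact: linform_deg.
Qed.

Fact invariant_scalars i : graded_scalars (invariant i).
Proof.
split=> [c|a ha]; first by rewrite /invariant /act_poly comp_mpolyC.
have [s [c [us gc c0 Ea]]] := gspan_decomp (@rdeg_subgroups k n) (rdeg_span a).
have E : \sum_(d <- s) (act_poly i (c d) - c d) = 0 :> R^o.
  have Es : \sum_(d <- s) act_poly i (c d) = act_poly i (\sum_(d <- s) c d).
    by rewrite /act_poly raddf_sum.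
  by rewrite sumrB [X in X - _]Es -Ea [X in X - _]ha subrr.
have gc' d : rdeg d (act_poly i (c d) - c d).
  by apply: (gsB (V := R^o) (@rdeg_subgroups k n)) => //; exact: act_poly_deg.
have inv d : d \in s -> invariant i (c d).
  by move=> ds; apply/eqP; rewrite -subr_eq0; apply/eqP/(rdeg_free us gc' E).
exists (map c s); rewrite big_map; split=> // _ /mapP[d ds ->].
by exists d; split=> //; exact: inv.
Qed.

Fact all_scalars : graded_scalars (fun _ : R => True).
Proof.
split=> // a _; move: (rdeg_span a) => [s [hs ->]]; exists s; split=> // y /hs [d gy].
by exists d.
Qed.

(* B_i = R \otimes_{R^i} R(1) *)
Definition B (i : gen) : grbimod k n :=
  bishift (tensor (invariant_scalars i) (Rbim k n) (Rbim k n)) 1.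

Definition BS (w : seq gen) : grbimod k n :=
  foldr (fun i M => tensor all_scalars (B i) M) (Rbim k n) w.

Section RhoE.
Variable w : seq gen.
Definition rho_s_e (b : BS w) : BS w :=
  lmul (linform (rho Rz gen_s)) b - linform (rho Rz gen_s) *: b.

Fact rho_s_e_hom : right_hom 2 rho_s_e.
Proof.
rewrite /rho_s_e; split=> [r x y|d x gx].
  rewrite lmulDr lmulZ scalerDr scalerBr !scalerA [r * _]mulrC opprD.
  by rewrite addrACA.
apply: (gsB (grading_subgroups (gr_grading (BS w)))).
  exact: left_deg (lmul_action (BS w)) _ _ _ _ (@linform_deg _) gx.
exact: grading_scale (gr_grading (BS w)) _ _ _ _ (@linform_deg _) gx.
Qed.

Definition ker_rho_s_e : grmod k n := kernel rho_s_e_hom.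
End RhoE.

End Realization.

(* Generators of the Koszul resolution of B_t, before its shift by (1); next to
   a module they only shift it. *)
Inductive koszul_gen := ul_one | ul_rho_s | ul_rho_t_t_rho_t | ul_rho_s_wedge_rho_t_t_rho_t.

Definition koszul_deg (x : koszul_gen) : int :=
  match x with
  | ul_one => 0
  | ul_rho_s => 2
  | ul_rho_t_t_rho_t => 4
  | ul_rho_s_wedge_rho_t_t_rho_t => 6
  end.

Definition at_gen (k : idomainType) (n : nat) (M : grmod k n) (x : koszul_gen) :
  grmod k n := shift M (koszul_deg x).

(* The tilde records that classes have to be lifted to cocycles; it does not
   change the module. *)
Definition tilde (k : idomainType) (n : nat) (M : grmod k n) : grmod k n := M.

(* Main.v *)
(* The quadratic invariant z of W acts in the same way from the left and from the
   right on BS(w), and rho_t t(rho_t) = rho_s^2 - z.  So on BS(w) the Koszul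
   differential of rho_t t(rho_t) is a multiple of f := rho_s^e(w), and after a
   change of basis the Koszul complex has cohomology ker f, ker f + coker f and
   coker f.

   BS(w) has a perfect pairing for which left multiplications, hence f, are
   self-adjoint.  It identifies coker f with D(ker f) as soon as f is von Neumann
   regular: f g f = f for a graded right R-linear g.  Let p_(i, d), for d <= m, be
   the product of the rho_i (x) 1 - 1 (x) x_j, where x_0, ..., x_(d-1) are the
   images of rho_i under the alternating products of j < d reflections; then
   f = p_(s, 1).  All p_(i, d) are regular on BS(w), by induction on w: on
   B_i (x) M = M + rho_i M, with i' the other reflection, p_(i', d) is diagonal,
   p_(i, d) is equivalent to diag(p_(i', d-1), p_(i', d+1)) when [d] is
   invertible, and p_(i, m) = - p_(i', m). *)

Require Import Defs.
From mathcomp Require Import all_boot all_order all_algebra.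
From mathcomp Require Import boolp functions.
From mathcomp Require Import mpoly.
From mathcomp Require Import ring.

Set Implicit Arguments.
Unset Strict Implicit.
Unset Printing Implicit Defensive.

Import GRing.Theory.
Local Open Scope ring_scope.

(** * The enveloping algebra and its action on bimodules *)

(** The pairing always gives a map coker f -> D(ker f). It is an isomorphism only if functionals on
    ker f extend to BS(w) and functionals killing ker f factor through f. Neither is automatic over
    R; a quasi-inverse g provides both, since z - g(f z) is a projection onto ker f. The operator f
    = p_(s, 1) alone does not carry the induction on w: when the letter s is added, p_(s, 1) turns
    into p_(t, 0) and p_(t, 2), so all d have to be treated together. The spreading stops at d = m,
    where [m] = 0 and [m-1] = 1 turn p_(i, m) into -p_(i', m) and no p_(i', m+1) arises. The
    identities behind the induction are plane geometry over the right factor: in the coordinates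
    rho_s (x) 1 and rho_t (x) 1, the equation z (x) 1 = 1 (x) z is a conic and p_(i, d) is a product
    of parallel lines. On the conic, p_(i, d) equals p_(i', d-1) times one further line; eliminating
    rho_i (x) 1 between this line and the conic yields the two factors that lead from p_(i', d-1) to
    p_(i', d+1). The elimination divides by [d], the coefficient of rho_i (x) 1 in the line. *)

Section EnvelopingAlgebra.
Variables (k : idomainType) (n : nat).
Local Notation R := {mpoly k[n]}.
(* R^e = R \otimes_k R: the variables of the outer ring are those of the left
   factor, its coefficients are the right factor. *)
Local Notation E := {mpoly R[n]}.

Definition left_el : R -> E := map_mpoly (@mpolyC n k).
Definition right_el : R -> E := @mpolyC n R.

Lemma left_elD a b : left_el (a + b) = left_el a + left_el b.
Proof. exact: (rmorphD (map_mpoly (@mpolyC n k))). Qed.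
Lemma left_elB a b : left_el (a - b) = left_el a - left_el b.
Proof. exact: (rmorphB (map_mpoly (@mpolyC n k))). Qed.
Lemma left_elM a b : left_el (a * b) = left_el a * left_el b.
Proof. exact: (rmorphM (map_mpoly (@mpolyC n k))). Qed.
Lemma left_el0 : left_el 0 = 0.
Proof. exact: (rmorph0 (map_mpoly (@mpolyC n k))). Qed.
Lemma left_el1 : left_el 1 = 1.
Proof. exact: (rmorph1 (map_mpoly (@mpolyC n k))). Qed.
Lemma right_elD a b : right_el (a + b) = right_el a + right_el b.
Proof. exact: mpolyCD. Qed.
Lemma right_elB a b : right_el (a - b) = right_el a - right_el b.
Proof. exact: mpolyCB. Qed.
Lemma right_elN a : right_el (- a) = - right_el a.
Proof. exact: mpolyCN. Qed.
Lemma right_elM a b : right_el (a * b) = right_el a * right_el b.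
Proof. exact: mpolyCM. Qed.
Lemma right_el0 : right_el 0 = 0.
Proof. exact: mpolyC0. Qed.
Lemma right_el1 : right_el 1 = 1.
Proof. exact: mpolyC1. Qed.

Lemma left_elX mm : left_el 'X_[mm] = 'X_[mm].
Proof. exact: map_mpolyX. Qed.

Lemma left_elC c : left_el c%:MP = right_el c%:MP.
Proof. exact: map_mpolyC. Qed.

Lemma right_el_scale r e : right_el r * e = r *: e.
Proof. exact: mul_mpolyC. Qed.

(** [mpolyind] adds whole monomials; splitting them into variables leaves left multiplication by a
    single variable as the only case where relations of R^e have to be used. *)
Lemma polyE_ind (Q : E -> Prop) :
  (forall r, Q (right_el r)) -> (forall i e, Q e -> Q ('X_i * e)) ->
  (forall e e', Q e -> Q e' -> Q (e + e')) -> forall e, Q e.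
Proof.
move=> QC QX QD; elim/mpolyind => [|r mm e _ _ He].
  by rewrite -right_el0; exact: QC.
apply: QD => //; rewrite -right_el_scale mulrC mpolyXE_id.
elim: (index_enum _) => [|i s IH]; first by rewrite big_nil mul1r.
rewrite big_cons -mulrA; elim: (mm i) => [|d IHd]; first by rewrite expr0 mul1r.
by rewrite exprS -mulrA; exact: QX.
Qed.

Section Action.
Variable M : grbimod k n.
Implicit Types (e : E) (x y : M).

Definition eact e x : M := \sum_(mm <- msupp e) e@_mm *: lmul 'X_[mm] x.

(** Makes sums over different supports comparable on a common list; monomials outside the support
    contribute 0. *)
Lemma eact_wide e x (s : seq 'X_{1..n}) : uniq s -> {subset msupp e <= s} ->
  eact e x = \sum_(mm <- s) e@_mm *: lmul 'X_[mm] x.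
Proof.
move=> us ss; rewrite /eact (bigID (mem (msupp e)) (r := s)) /= [X in _ + X]big1.
  rewrite addr0 -[RHS]big_filter; apply: perm_big; apply: uniq_perm.
  - exact: msupp_uniq.
  - exact: filter_uniq.
  - move=> mm; rewrite mem_filter; case h: (mm \in msupp e) => //=.
    by rewrite ss.
by move=> mm; rewrite -mcoeff_eq0 => /eqP ->; rewrite scale0r.
Qed.

Lemma eactDl e e' x : eact (e + e') x = eact e x + eact e' x.
Proof.
pose s := undup (msupp e ++ msupp e').
have us : uniq s := undup_uniq _.
rewrite !(@eact_wide _ _ s) //.
- by rewrite -big_split; apply: eq_bigr => mm _; rewrite mcoeffD scalerDl.
- by move=> mm h; rewrite mem_undup mem_cat h orbT.
- by move=> mm h; rewrite mem_undup mem_cat h.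
- by move=> mm /msuppD_le h; rewrite mem_undup.
Qed.

Lemma eact_linear e r x y : eact e (r *: x + y) = r *: eact e x + eact e y.
Proof.
rewrite /eact scaler_sumr -big_split; apply: eq_bigr => mm _ /=.
by rewrite (left_linear (lmul_action M)) scalerDr !scalerA mulrC.
Qed.
Lemma eactDr e x y : eact e (x + y) = eact e x + eact e y.
Proof. by have := eact_linear e 1 x y; rewrite !scale1r. Qed.
Lemma eact0 e : eact e 0 = 0.
Proof. by apply: (addIr (eact e 0)); rewrite -eactDr !add0r. Qed.
Lemma eactZ e r x : eact e (r *: x) = r *: eact e x.
Proof. by have := eact_linear e r x 0; rewrite eact0 !addr0. Qed.
Lemma eactNr e x : eact e (- x) = - eact e x.
Proof. by rewrite -[- x]scaleN1r eactZ scaleN1r. Qed.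
Lemma eactBr e x y : eact e (x - y) = eact e x - eact e y.
Proof. by rewrite eactDr eactNr. Qed.

Lemma eactZl r e x : eact (r *: e) x = r *: eact e x.
Proof.
rewrite (@eact_wide _ _ (msupp e)) ?msupp_uniq //; last exact: msuppZ_le.
by rewrite scaler_sumr; apply: eq_bigr => mm _; rewrite mcoeffZ scalerA.
Qed.

Lemma eactX mm x : eact 'X_[mm] x = lmul 'X_[mm] x.
Proof. by rewrite /eact msuppX big_seq1 mcoeffX eqxx scale1r. Qed.

Lemma eact_right r x : eact (right_el r) x = r *: x.
Proof.
rewrite -[right_el r]mulr1 right_el_scale eactZl -mpolyX0 eactX mpolyX0.
by rewrite (left1 (lmul_action M)).
Qed.

Lemma eact1 x : eact 1 x = x.
Proof. by rewrite -right_el1 eact_right scale1r. Qed.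
Lemma eact0l x : eact 0 x = 0.
Proof. by rewrite -right_el0 eact_right scale0r. Qed.
Lemma eactNl e x : eact (- e) x = - eact e x.
Proof. by rewrite -[- e]scaleN1r eactZl scaleN1r. Qed.
Lemma eactBl e e' x : eact (e - e') x = eact e x - eact e' x.
Proof. by rewrite eactDl eactNl. Qed.

(** The left and right actions commute, so it is enough to compare products of monomials. *)
Lemma eactM e e' x : eact (e * e') x = eact e (eact e' x).
Proof.
elim/mpolyind: e => [|r mm e _ _ He]; first by rewrite mul0r !eact0l.
rewrite mulrDl !eactDl He -scalerAl !eactZl; congr (_ *: _ + _).
elim/mpolyind: e' {e He} => [|r' mm' e _ _ He]; first by rewrite mulr0 !eact0l eact0.
rewrite mulrDr !eactDl eactDr He -scalerAr !eactZl eactZ; congr (_ *: _ + _).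
by rewrite -mpolyXD !eactX mpolyXD (leftM (lmul_action M)).
Qed.

Lemma eact_left a x : eact (left_el a) x = lmul a x.
Proof.
elim/mpolyind: a => [|c mm a _ _ Ha]; first by rewrite left_el0 eact0l lmul0l.
have -> : c *: 'X_[mm] = c%:MP * 'X_[mm] :> R by rewrite mul_mpolyC.
rewrite left_elD eactDl lmulDl; congr (_ + _); last exact: Ha.
rewrite left_elM eactM left_elC eact_right left_elX eactX.
by rewrite (leftM (lmul_action M)) (leftC (lmul_action M)).
Qed.

End Action.

Lemma bimod_hom_eact (M N : grbimod k n) l (f : M -> N) e x :
  bimod_hom l f -> f (eact e x) = eact e (f x).
Proof.
move=> [hf hl]; rewrite /eact (right_hom_sum hf); apply: eq_bigr => mm _.
by rewrite (right_homZ hf) hl.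
Qed.

(** Total degree: a left variable counts 2, and its coefficient in the right factor must be
    homogeneous of the remaining degree. *)
Definition edeg (d : int) (e : E) : Prop :=
  forall mm, rdeg (d - (2 * mdeg mm)%:Z) e@_mm.

Fact edeg_grading : is_grading (M := E) edeg.
Proof.
have [r0 rB] : (forall d, rdeg d (0 : R)) /\
    forall d (x y : R), rdeg d x -> rdeg d y -> rdeg d (x - y).
  by split=> d; case: (@rdeg_subgroups k n d).
split.
- move=> d; split; first by move=> mm; rewrite mcoeff0.
  by move=> x y hx hy mm; rewrite mcoeffB; exact: rB.
- move=> e d r x hr hx mm; rewrite mcoeffZ addrAC addrC; exact: rdegM.
- move=> x; rewrite [x]mpolyE; apply: gspan_sum => mm.
  move: (rdeg_span x@_mm); move: (x@_mm); apply: gspan_ind => [|d r r' hr IH].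
    by rewrite scale0r; exact: gspan0.
  rewrite scalerDl; apply: gspanD IH; apply: (gspan1 (d := d + (2 * mdeg mm)%:Z)) => m'.
  rewrite mcoeffZ mcoeffX; case: eqP => [<-|_]; last by rewrite mulr0.
  by rewrite mulr1 addrK.
- move=> s c us gc E0 d ds; apply/mpolyP => mm; rewrite mcoeff0.
  have := @rdeg_free k n [seq d - (2 * mdeg mm)%:Z | d <- s]
    (fun d => (c (d + (2 * mdeg mm)%:Z))@_mm) _ _ _ (d - (2 * mdeg mm)%:Z).
  rewrite subrK; apply.
  + by rewrite map_inj_uniq //; exact: addIr.
  + by move=> i; rewrite -{1}[i](addrK (2 * mdeg mm)%:Z); exact: gc.
  + rewrite big_map -[RHS](mcoeff0 _ mm) -E0 raddf_sum; apply: eq_bigr => i _.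
    by rewrite subrK.
  + exact: (map_f (fun i => i - (2 * mdeg mm)%:Z)).
Qed.
Definition Egrmod : grmod k n := Grmod edeg_grading.

Lemma edeg_right d r : rdeg d r -> edeg d (right_el r).
Proof.
move=> hr mm; rewrite mcoeffC; case: eqP => [->|_]; last first.
  by rewrite mulr0; case: (@rdeg_subgroups k n (d - (2 * mdeg mm)%:Z)).
by rewrite mulr1 mdeg0 muln0 subr0.
Qed.

Lemma edegD d e e' : edeg d e -> edeg d e' -> edeg d (e + e').
Proof. exact: gsD (grading_subgroups edeg_grading) _ _ _. Qed.

Lemma edegN d e : edeg d e -> edeg d (- e).
Proof. exact: gsN (grading_subgroups edeg_grading) _ _. Qed.

Lemma edegB d e e' : edeg d e -> edeg d e' -> edeg d (e - e').
Proof. exact: gsB (grading_subgroups edeg_grading) _ _ _. Qed.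

Lemma edegM d d' e e' : edeg d e -> edeg d' e' -> edeg (d + d') (e * e').
Proof.
have gg := @rdeg_subgroups k n.
move=> he he' mm; rewrite mcoeffM; apply: (gs_sum (V := R^o) gg) => -[m1 m2] /= /eqP Em.
have Ed : mdeg mm = (mdeg m1 + mdeg m2)%N by rewrite -mdegD -Em.
have Es (a b c : nat) : a = (b + c)%N ->
    d + d' - (2 * a)%:Z = (d - (2 * b)%:Z) + (d' - (2 * c)%:Z).
  by move=> ->; rewrite mulnDr PoszD opprD addrACA.
by rewrite (Es _ _ _ Ed); exact: rdegM.
Qed.

Lemma edeg_left d a : rdeg d a -> edeg d (left_el a).
Proof.
move=> ha mm; rewrite mcoeff_map_mpoly /=.
have [->|ne] := eqVneq d (2 * mdeg mm)%:Z; first by rewrite subrr; exact: rdegC.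
rewrite (iffLR (rdegP _ _) ha) ?mpolyC0; last exact/eqP.
by case: (@rdeg_subgroups k n (d - (2 * mdeg mm)%:Z)).
Qed.

Fact E_action : is_left_action (M := Egrmod) (fun a e => left_el a * e).
Proof.
split=> [x|a b x|a b x|a r x y|c x|e d a x ha hx].
- by rewrite left_el1 mul1r.
- by rewrite left_elM mulrA.
- by rewrite left_elD mulrDl.
- by rewrite mulrDr -scalerAr.
- by rewrite left_elC right_el_scale.
- by rewrite /= addrC; apply: edegM => //; exact: edeg_left.
Qed.
Definition Ebim : grbimod k n := Grbimod E_action.

Lemma eact_E (e x : Ebim) : eact e x = e * x.
Proof.
rewrite /eact [e in RHS]mpolyE mulr_suml; apply: eq_bigr => mm _.
by rewrite -scalerAl; congr (_ *: _); rewrite -left_elX.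
Qed.

Lemma eact_deg (M : grbimod k n) d c e (x : M) :
  edeg d e -> gr c x -> gr (c + d) (eact e x).
Proof.
move=> he hx; apply: (gs_sum (grading_subgroups (gr_grading M))) => mm _.
have -> : c + d = c + (2 * mdeg mm)%:Z + (d - (2 * mdeg mm)%:Z) by ring.
apply: (grading_scale (gr_grading M)); first exact: he.
by apply: (left_deg (lmul_action M)) => //; exact: rdegX.
Qed.

End EnvelopingAlgebra.

(** * Polynomials over the invariants of a reflection *)

Section Demazure.
Variables (k : idomainType) (n : nat).
Local Notation R := {mpoly k[n]}.

Lemma linform_linear c lam mu :
  linform (c *: lam + mu) = c%:MP * linform lam + linform mu :> R.
Proof.
rewrite /linform mulr_sumr -big_split; apply: eq_bigr => j _ /=.
by rewrite !mxE scalerDl mul_mpolyC scalerA.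
Qed.

Lemma linform0 : linform 0 = 0 :> R.
Proof. by rewrite /linform big1 // => j _; rewrite mxE scale0r. Qed.

Lemma linformZ c lam : linform (c *: lam) = c%:MP * linform lam :> R.
Proof. by rewrite -[c *: lam]addr0 linform_linear linform0 addr0. Qed.

Lemma linformD lam mu : linform (lam + mu) = linform lam + linform mu :> R.
Proof. by rewrite -[lam]scale1r linform_linear mpolyC1 mul1r scale1r. Qed.

Lemma linformB lam mu : linform (lam - mu) = linform lam - linform mu :> R.
Proof. by rewrite -scaleN1r linformD linformZ mpolyCN mpolyC1 mulN1r. Qed.

Lemma linform_delta j : linform (delta_mx 0 j) = 'X_j :> R.
Proof.
rewrite /linform (bigD1 j) //= big1 ?addr0 => [|i ne]; first by rewrite mxE !eqxx scale1r.
by rewrite mxE eqxx (negPf ne) scale0r.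
Qed.

Lemma linform_sum (I : Type) (s : seq I) (F : I -> 'rV[k]_n) :
  linform (\sum_(i <- s) F i) = \sum_(i <- s) linform (F i) :> R.
Proof. exact: (big_morph _ linformD linform0). Qed.

Lemma linform_inj lam : linform lam = 0 :> R -> lam = 0.
Proof.
move=> h; apply/rowP => j; rewrite mxE.
have := congr1 (mcoeff U_(j)) h; rewrite mcoeff0 => <-.
rewrite raddf_sum /= (bigD1 j) //= big1 ?addr0 => [|i ne].
  by rewrite mcoeffZ mcoeffXU eqxx mulr1.
by rewrite mcoeffZ mcoeffXU (negPf ne) mulr0.
Qed.

Lemma pairing_linear v (c : k) lam mu :
  pairing v (c *: lam + mu : 'rV[k]_n) = c * pairing v lam + pairing v mu.
Proof. by rewrite /pairing mulmxDl -scalemxAl !mxE. Qed.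
Lemma pairing0 v : pairing v (0 : 'rV[k]_n) = 0.
Proof. by rewrite /pairing mul0mx mxE. Qed.
Lemma pairingZ v (c : k) (lam : 'rV[k]_n) : pairing v (c *: lam) = c * pairing v lam.
Proof. by rewrite -[c *: lam]addr0 pairing_linear pairing0 addr0. Qed.
Lemma pairingD v (lam mu : 'rV[k]_n) :
  pairing v (lam + mu) = pairing v lam + pairing v mu.
Proof. by have := pairing_linear v 1 lam mu; rewrite scale1r mul1r. Qed.
Lemma pairingB v (lam mu : 'rV[k]_n) :
  pairing v (lam - mu) = pairing v lam - pairing v mu.
Proof. by rewrite -scaleN1r pairingD pairingZ mulN1r. Qed.

Lemma mpolyR_ind (Q : R -> Prop) :
  (forall c, Q c%:MP) -> (forall i a, Q a -> Q ('X_i * a)) ->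
  (forall a b, Q a -> Q b -> Q (a + b)) -> forall a, Q a.
Proof.
move=> QC QX QD; elim/mpolyind => [|c mm a _ _ Ha].
  by rewrite -mpolyC0; exact: QC.
apply: QD => //; rewrite -mul_mpolyC mulrC mpolyXE_id.
elim: (index_enum _) => [|i s IH]; first by rewrite big_nil mul1r.
rewrite big_cons -mulrA; elim: (mm i) => [|d IHd]; first by rewrite expr0 mul1r.
by rewrite exprS -mulrA; exact: QX.
Qed.

(** Multiplication by [a] moves each component of [b] up by d, so [a] kills all components outside
    degree e - d; R being a domain, they vanish. *)
Lemma rdeg_cancel e d (a b : R) : a != 0 -> rdeg d a -> rdeg e (a * b) -> rdeg (e - d) b.
Proof.
move=> a0 ha hab; pose RM := @Rmod k n.
have fg j x : gr j (x : RM) -> gr (j + d) (a * x : RM).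
  by move=> hx; rewrite /= addrC; exact: rdegM.
have [us gx x0 Ex] := gcompP (b : RM).
suff -> : b = gcomp (b : RM) (e - d) by exact: (gcomp_gr (M := RM)).
rewrite {1}Ex; case hs : (e - d \in gsupp (b : RM)); last first.
  rewrite x0 ?hs // big1_seq // => i /andP[_ hi].
  have := @gcomp_map _ _ RM RM d _ (b : RM) (i + d) (fun x y => mulrDr a x y) fg.
  rewrite addrK (gcomp_homog (M := RM) _ hab).
  case: eqP => [Ei|_ /esym/eqP]; first by rewrite -Ei addrK hi in hs.
  by rewrite mulf_eq0 (negPf a0) => /eqP.
rewrite (big_rem (e - d)) //= [X in _ + X]big1_seq ?addr0 // => i /andP[_].
rewrite mem_rem_uniq // inE => /andP[ne hi].
have := @gcomp_map _ _ RM RM d _ (b : RM) (i + d) (fun x y => mulrDr a x y) fg.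
rewrite addrK (gcomp_homog (M := RM) _ hab).
case: eqP => [Ei|_ /esym/eqP]; first by rewrite -Ei addrK eqxx in ne.
by rewrite mulf_eq0 (negPf a0) => /eqP.
Qed.

Variables (m : nat) (Rz : realization k n m).
Local Notation act := (act_poly Rz).
Local Notation lroot i := (linform (Defs.root Rz i)).
Local Notation lrho i := (linform (rho Rz i)).

Lemma rho_pairing i : pairing (coroot Rz i) (rho Rz i) = 1.
Proof. by case: i; [exact: rho_ss|exact: rho_tt]. Qed.

Lemma act_polyD i a b : act i (a + b) = act i a + act i b.
Proof. by rewrite /act_poly rmorphD. Qed.
Lemma act_polyB i a b : act i (a - b) = act i a - act i b.
Proof. by rewrite /act_poly rmorphB. Qed.
Lemma act_polyM i a b : act i (a * b) = act i a * act i b.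
Proof. by rewrite /act_poly rmorphM. Qed.
Lemma act_polyC i c : act i c%:MP = c%:MP.
Proof. by rewrite /act_poly comp_mpolyC. Qed.

Lemma act_linform i lam : act i (linform lam) = linform (act_dual Rz i lam).
Proof.
rewrite {1}/linform /act_poly raddf_sum /=.
rewrite {2}[lam](row_sum_delta lam) /act_dual /corefl.
transitivity (\sum_(j < n) (lam 0 j)%:MP * linform (act_dual Rz i (delta_mx 0 j))).
  apply: eq_bigr => j _; rewrite comp_mpolyZ comp_mpolyXU -mul_mpolyC.
  by rewrite -tnth_nth tnth_mktuple.
rewrite linformB linform_sum linformZ.
rewrite (big_morph (pairing (coroot Rz i)) (pairingD _) (pairing0 _)).
rewrite rmorph_sum mulr_suml -sumrB; apply: eq_bigr => j _.
by rewrite /act_dual /corefl linformB !linformZ pairingZ rmorphM /= mulrBr mulrA.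
Qed.

Lemma act_lrho i : act i (lrho i) = lrho i - lroot i.
Proof.
by rewrite act_linform /act_dual /corefl rho_pairing scale1r linformB.
Qed.

Lemma lroot_neq0 i : lroot i != 0.
Proof.
apply/negP => /eqP /linform_inj h; have [v] := demazure_root Rz i 1.
by rewrite h pairing0 => /esym/eqP; rewrite oner_eq0.
Qed.

Lemma invariantD i a b : Defs.invariant Rz i a -> Defs.invariant Rz i b -> Defs.invariant Rz i (a + b).
Proof. by rewrite /Defs.invariant act_polyD => -> ->. Qed.
Lemma invariantM i a b : Defs.invariant Rz i a -> Defs.invariant Rz i b -> Defs.invariant Rz i (a * b).
Proof. by rewrite /Defs.invariant act_polyM => -> ->. Qed.
Lemma invariantB i a b : Defs.invariant Rz i a -> Defs.invariant Rz i b -> Defs.invariant Rz i (a - b).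
Proof. by rewrite /Defs.invariant act_polyB => -> ->. Qed.
Lemma invariantC i c : Defs.invariant Rz i c%:MP.
Proof. by rewrite /Defs.invariant act_polyC. Qed.

Lemma act_lroot i : act i (lroot i) = - lroot i.
Proof.
rewrite act_linform /act_dual /corefl pairing_root linformB linformZ.
by rewrite mpolyC_nat; ring.
Qed.

Definition trace_rho i : R := lrho i + act i (lrho i).
Definition norm_rho i : R := lrho i * act i (lrho i).

Lemma act_act_lrho i : act i (act i (lrho i)) = lrho i.
Proof. by rewrite act_lrho act_polyB act_lrho act_lroot; ring. Qed.
Lemma invariant_trace i : Defs.invariant Rz i (trace_rho i).
Proof. by rewrite /Defs.invariant act_polyD act_act_lrho addrC. Qed.
Lemma invariant_norm i : Defs.invariant Rz i (norm_rho i).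
Proof. by rewrite /Defs.invariant act_polyM act_act_lrho mulrC. Qed.
Lemma lrho_sqr i : lrho i * lrho i = trace_rho i * lrho i - norm_rho i.
Proof. by rewrite /trace_rho /norm_rho; ring. Qed.

(** Since rho_i pairs to 1 with the coroot, each variable is a multiple of rho_i plus an invariant
    form, and rho_i^2 reduces by [lrho_sqr]. Averaging over the reflection instead would need 2 to
    be invertible. *)
Lemma invariant_split i a :
  exists pq : R * R, [/\ Defs.invariant Rz i pq.1, Defs.invariant Rz i pq.2 & a = pq.1 + lrho i * pq.2].
Proof.
elim/mpolyR_ind: a => [c|j a [[p q] [/= hp hq ->]]|a b [[p q] [/= hp hq ->]] [[p' q'] [/= hp' hq' ->]]].
- exists (c%:MP, 0); split; rewrite /= ?mulr0 ?addr0 //; first exact: invariantC.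
  by rewrite -mpolyC0; exact: invariantC.
- have [c [mu [hmu ->]]] : exists c (mu : R), Defs.invariant Rz i mu /\ 'X_j = c%:MP * lrho i + mu.
    pose c := pairing (coroot Rz i) (delta_mx 0 j).
    exists c, (linform (delta_mx 0 j - c *: rho Rz i)); split.
      rewrite /Defs.invariant act_linform /act_dual /corefl pairingB pairingZ rho_pairing mulr1.
      by rewrite subrr scale0r subr0.
    by rewrite linformB linformZ linform_delta addrC subrK.
  exists (mu * p - c%:MP * (norm_rho i * q), c%:MP * p + mu * q + c%:MP * trace_rho i * q).
  have hc := invariantC i c; have hN := invariant_norm i; have hT := invariant_trace i.
  split=> /=.
  + by apply: invariantB; apply: invariantM => //; apply: invariantM.
  + by apply: invariantD; [apply: invariantD|]; apply: invariantM => //; apply: invariantM.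
  + by rewrite /norm_rho /trace_rho; ring.
- exists (p + p', q + q'); split=> /=; try exact: invariantD.
  by rewrite mulrDr addrACA.
Qed.

(** Subtracting the reflected equation leaves alpha_i (q - q') = 0, and alpha_i is nonzero in a
    domain. *)
Lemma invariant_split_uniq i p q p' q' :
  Defs.invariant Rz i p -> Defs.invariant Rz i q -> Defs.invariant Rz i p' -> Defs.invariant Rz i q' ->
  p + lrho i * q = p' + lrho i * q' -> p = p' /\ q = q'.
Proof.
move=> hp hq hp' hq' Epq.
have Eq : q = q'.
  have := congr1 (act i) Epq.
  rewrite !act_polyD !act_polyM hp hq hp' hq' act_lrho => Epq'.
  apply/eqP; rewrite -subr_eq0.
  have : lroot i * (q - q') == 0.
    apply/eqP; transitivity ((p + lrho i * q) - (p' + lrho i * q') -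
      (p + (lrho i - lroot i) * q - (p' + (lrho i - lroot i) * q'))); first by ring.
    by rewrite Epq Epq' !subrr.
  by rewrite mulf_eq0 (negPf (lroot_neq0 i)).
by split=> //; move: Epq; rewrite Eq => /addIr.
Qed.

Definition split_coef i a : R * R := projT1 (cid (invariant_split i a)).
(* Coordinates in the basis 1, rho_i of R over R^i; coef1 is the Demazure
   operator. *)
Definition coef0 i a : R := (split_coef i a).1.
Definition coef1 i a : R := (split_coef i a).2.

Lemma coef0_inv i a : Defs.invariant Rz i (coef0 i a).
Proof. by rewrite /coef0 /split_coef; case: cid => -[p q] []. Qed.
Lemma coef1_inv i a : Defs.invariant Rz i (coef1 i a).
Proof. by rewrite /coef1 /split_coef; case: cid => -[p q] []. Qed.
Lemma coefE i a : a = coef0 i a + lrho i * coef1 i a.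
Proof. by rewrite {1}/coef1 /coef0 /split_coef; case: cid => -[p q] []. Qed.

Lemma coef_eq i a p q : Defs.invariant Rz i p -> Defs.invariant Rz i q -> a = p + lrho i * q ->
  coef0 i a = p /\ coef1 i a = q.
Proof.
move=> hp hq Ea.
apply: (invariant_split_uniq (coef0_inv i a) (coef1_inv i a) hp hq).
by rewrite -(coefE i a).
Qed.

Lemma coefD i a b :
  coef0 i (a + b) = coef0 i a + coef0 i b /\ coef1 i (a + b) = coef1 i a + coef1 i b.
Proof.
apply: coef_eq; [apply: invariantD; exact: coef0_inv|apply: invariantD; exact: coef1_inv|].
by rewrite {1}(coefE i a) {1}(coefE i b) mulrDr addrACA.
Qed.

Lemma coefM i c a : Defs.invariant Rz i c ->
  coef0 i (c * a) = c * coef0 i a /\ coef1 i (c * a) = c * coef1 i a.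
Proof.
move=> hc; apply: coef_eq; try (apply: invariantM => //).
- exact: coef0_inv.
- exact: coef1_inv.
- by rewrite {1}(coefE i a) mulrDr mulrCA.
Qed.

Lemma coef_rho i a : 
  coef0 i (lrho i * a) = - norm_rho i * coef1 i a /\
  coef1 i (lrho i * a) = coef0 i a + trace_rho i * coef1 i a.
Proof.
have h0 := coef0_inv i a; have h1 := coef1_inv i a.
have hN := invariant_norm i; have hT := invariant_trace i.
apply: coef_eq.
- by rewrite mulNr -sub0r; apply: invariantB; [rewrite -mpolyC0; exact: invariantC|exact: invariantM].
- by apply: invariantD => //; exact: invariantM.
- by rewrite {1}(coefE i a) /norm_rho /trace_rho; ring.
Qed.

(** [coef1] is the divided difference (a - s_i(a)) / alpha_i, so it loses the degree of alpha_i. *)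
Lemma coef1_deg i e a : rdeg e a -> rdeg (e - 2) (coef1 i a).
Proof.
move=> ha; apply: (@rdeg_cancel _ _ (lroot i)).
- exact: lroot_neq0.
- exact: linform_deg.
- have -> : lroot i * coef1 i a = a - act i a.
    rewrite {2 3}(coefE i a) act_polyD act_polyM coef0_inv coef1_inv act_lrho; ring.
  by apply: (gsB (V := R^o) (@rdeg_subgroups k n)) => //; exact: act_poly_deg.
Qed.

Lemma coef0_deg i e a : rdeg e a -> rdeg e (coef0 i a).
Proof.
move=> ha; have -> : coef0 i a = a - lrho i * coef1 i a.
  by rewrite {2}(coefE i a) addrK.
apply: (gsB (V := R^o) (@rdeg_subgroups k n)) => //.
rewrite -[e](subrK 2) addrC; apply: rdegM; first exact: linform_deg.
exact: coef1_deg.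
Qed.

End Demazure.

(** * Tensoring with B_i *)

Section Induction.
Variables (k : idomainType) (n m : nat) (Rz : realization k n m) (i : gen).
Local Notation R := {mpoly k[n]}.
Local Notation lrho i := (linform (rho Rz i)).

(* T = R \otimes_{R^i} M(1) = M(1) \oplus rho_i M(-1), with coordinates c0, c1. *)
Record induced (M T : grbimod k n) (j : M -> T) (c0 c1 : T -> M) : Prop := Induced {
  ind_j : right_hom (-1) j;
  ind_c0 : right_hom 1 c0;
  ind_c1 : right_hom (-1) c1;
  ind_inv : forall a x, Defs.invariant Rz i a -> j (lmul a x) = lmul a (j x);
  ind_split : forall t, t = j (c0 t) + lmul (lrho i) (j (c1 t));
  ind_c0K : forall x y, c0 (j x + lmul (lrho i) (j y)) = x;
  ind_c1K : forall x y, c1 (j x + lmul (lrho i) (j y)) = y }.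

Section Coordinate.
Variables (c : R -> R) (e : int).
Hypotheses (cD : forall a b, c (a + b) = c a + c b)
  (cM : forall a b, Defs.invariant Rz i a -> c (a * b) = a * c b)
  (cdeg : forall d a, rdeg d a -> rdeg (d + e) (c a)).
Local Notation hB := (invariant_scalars Rz i).

(** [c] will be [coef0] with e = 0 or [coef1] with e = -2; the shift in B_i then adds 1 to the
    degree. *)
Definition Bcoef : B Rz i -> R :=
  tlift (hA := hB) (M := Rbim k n) (N := Rbim k n) (fun a r => c a * r).

Fact Bcoef_balanced :
  balanced (Defs.invariant Rz i) (M := Rbim k n) (N := Rbim k n) (fun a r => c a * r).
Proof.
split=> [x x' y|x y y'|a x y ha]; first by rewrite cD mulrDl.
  by rewrite mulrDr.
by rewrite cM // -mulrA mulrCA.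
Qed.

Lemma Bcoef_tens a r : Bcoef (tens hB a r) = c a * r.
Proof. exact: (tlift_tens hB Bcoef_balanced). Qed.

Lemma BcoefD x y : Bcoef (x + y) = Bcoef x + Bcoef y.
Proof. exact: tliftD Bcoef_balanced _ _. Qed.
Lemma Bcoef0 : Bcoef 0 = 0.
Proof. exact: tlift0 Bcoef_balanced. Qed.

Lemma Bcoef_hom : right_hom (N := Rmod k n) (e + 1) Bcoef.
Proof.
split=> [r x y|d x [s [-> hs]]].
  rewrite BcoefD; congr (_ + _).
  move: x; apply: tens_ind => [|a b|x x' hx hx'].
  - by rewrite scaler0 !Bcoef0 scaler0.
  - by rewrite [r *: _]tscale_tens !Bcoef_tens [LHS]mulrCA.
  - by rewrite scalerDr !BcoefD hx hx' [RHS]scalerDr.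
rewrite [X in gr _ X](tlift_sum Bcoef_balanced).
rewrite big_seq; apply: (gs_sum (V := R^o) (@rdeg_subgroups k n)) => p /hs [d' [h1 h2]].
rewrite (tlift_tens _ Bcoef_balanced).
have -> : d + (e + 1) = d' + e + (d + 1 - d') by ring.
by apply: rdegM => //; exact: cdeg.
Qed.

Variable M : grbimod k n.
Local Notation hR := (@all_scalars k n).
Local Notation T := (tensor hR (B Rz i) M).

Definition Tcoef : T -> M := tlift (hA := hR) (fun b x => lmul (Bcoef b) x).

Fact Tcoef_balanced :
  balanced (fun _ => True) (M := B Rz i) (N := M) (fun b x => lmul (Bcoef b) x).
Proof.
split=> [x x' y|x y y'|a x y ha]; last first.
- by rewrite (right_homZ Bcoef_hom) -(leftM (lmul_action M)) mulrC.
- exact: lmulDr.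
- by rewrite (right_homD Bcoef_hom) lmulDl.
Qed.

Lemma Tcoef_tens b x : Tcoef (tens hR b x) = lmul (Bcoef b) x.
Proof. exact: (tlift_tens hR Tcoef_balanced). Qed.

Lemma TcoefD x y : Tcoef (x + y) = Tcoef x + Tcoef y.
Proof. exact: tliftD Tcoef_balanced _ _. Qed.
Lemma Tcoef0 : Tcoef 0 = 0.
Proof. exact: tlift0 Tcoef_balanced. Qed.

Lemma Tcoef_hom : right_hom (e + 1) Tcoef.
Proof.
split=> [r x y|d x [s [-> hs]]].
  rewrite TcoefD; congr (_ + _).
  move: x; apply: tens_ind => [|a b|x x' hx hx'].
  - by rewrite scaler0 !Tcoef0 scaler0.
  - by rewrite [r *: _]tscale_tens !Tcoef_tens lmulZ.
  - by rewrite scalerDr !TcoefD hx hx' [RHS]scalerDr.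
rewrite [X in gr _ X](tlift_sum Tcoef_balanced).
rewrite big_seq; apply: (gs_sum (grading_subgroups (gr_grading M))) => p /hs [d' [h1 h2]].
rewrite (tlift_tens _ Tcoef_balanced).
have -> : d + (e + 1) = (d - d') + (d' + (e + 1)) by ring.
by apply: (left_deg (lmul_action M)) => //; exact: Bcoef_hom.2.
Qed.
End Coordinate.

Lemma coef0D a b : coef0 Rz i (a + b) = coef0 Rz i a + coef0 Rz i b.
Proof. by case: (coefD Rz i a b). Qed.
Lemma coef1D a b : coef1 Rz i (a + b) = coef1 Rz i a + coef1 Rz i b.
Proof. by case: (coefD Rz i a b). Qed.
Lemma coef0M a b : Defs.invariant Rz i a -> coef0 Rz i (a * b) = a * coef0 Rz i b.
Proof. by move=> /(coefM b)[]. Qed.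
Lemma coef1M a b : Defs.invariant Rz i a -> coef1 Rz i (a * b) = a * coef1 Rz i b.
Proof. by move=> /(coefM b)[]. Qed.
Lemma coef0_deg0 d a : rdeg d a -> rdeg (d + 0) (coef0 Rz i a).
Proof. by rewrite addr0; exact: coef0_deg. Qed.

Local Notation B0 := (Bcoef (coef0 Rz i)).
Local Notation B1 := (Bcoef (coef1 Rz i)).
Definition one_B : B Rz i := tens (invariant_scalars Rz i) (1 : Rbim k n) (1 : Rbim k n).

(** In x \otimes y with x = [coef0] x + rho_i [coef1] x, both coefficients are invariant and cross
    the tensor sign. *)
Lemma B_split b : b = B0 b *: one_B + B1 b *: lmul (lrho i) one_B.
Proof.
have [tD tD' tb] := tens_balanced (invariant_scalars Rz i) (Rbim k n) (Rbim k n).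
move: b; apply: tens_ind => [|x y|x y hx hy].
- rewrite (right_hom0 (Bcoef_hom coef0D coef0M coef0_deg0)).
  by rewrite (right_hom0 (Bcoef_hom coef1D coef1M (@coef1_deg _ _ _ Rz i))) !scale0r addr0.
- rewrite [B0 _](Bcoef_tens coef0D coef0M) [B1 _](Bcoef_tens coef1D coef1M).
  rewrite [lmul _ one_B]tlmul_tens [X in _ = X + _]tscale_tens [X in _ = _ + X]tscale_tens.
  rewrite [RHS](_ : _ =
    tens (invariant_scalars Rz i) (1 : Rbim k n) (lmul (coef0 Rz i x) y) +
    tens (invariant_scalars Rz i) (lrho i : Rbim k n) (lmul (coef1 Rz i x) y)); last first.
    by congr (_ + _); congr (tens _ _ _); exact: mulr1.
  rewrite -!tb; [|exact: coef1_inv|exact: coef0_inv].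
  rewrite {1}(coefE Rz i x) tD; congr (_ + _); congr (tens _ _ _).
    by rewrite [RHS]mulr1.
  by rewrite [RHS]mulrC.
- rewrite (right_homD (Bcoef_hom coef0D coef0M coef0_deg0)).
  rewrite (right_homD (Bcoef_hom coef1D coef1M (@coef1_deg _ _ _ Rz i))).
  by rewrite !scalerDl addrACA; congr (_ + _); [exact: hx|exact: hy].
Qed.

Lemma coef_one : coef0 Rz i 1 = 1 /\ coef1 Rz i 1 = 0.
Proof.
apply: coef_eq; last by rewrite mulr0 addr0.
- by have := invariantC Rz i 1; rewrite mpolyC1.
- by have := invariantC Rz i 0; rewrite mpolyC0.
Qed.

Lemma coef0_one_B : B0 one_B = 1.
Proof.
by rewrite (Bcoef_tens coef0D coef0M) mulr1; case: coef_one.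
Qed.
Lemma coef1_one_B : B1 one_B = 0.
Proof.
by rewrite (Bcoef_tens coef1D coef1M) mulr1; case: coef_one.
Qed.

Lemma coef_rho_one_B : B0 (lmul (lrho i) one_B) = 0 /\ B1 (lmul (lrho i) one_B) = 1.
Proof.
rewrite [lmul _ one_B]tlmul_tens (Bcoef_tens coef0D coef0M) (Bcoef_tens coef1D coef1M).
rewrite !mulr1 -[lmul _ _]/(lrho i * 1); have [-> ->] := coef_rho Rz i 1.
by have [-> ->] := coef_one; rewrite !mulr0 addr0.
Qed.

Section InducedTensor.
Variable M : grbimod k n.
Local Notation hR := (@all_scalars k n).
Local Notation T := (tensor hR (B Rz i) M).
Local Notation T0 := (@Tcoef (coef0 Rz i) M).
Local Notation T1 := (@Tcoef (coef1 Rz i) M).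

Definition tensor_unit (x : M) : T := tens hR one_B x.

Lemma tensor_induced : induced tensor_unit T0 T1.
Proof.
have [tD tD' tb] := tens_balanced hR (B Rz i) M.
have [uD uD' ub] := tens_balanced (invariant_scalars Rz i) (Rbim k n) (Rbim k n).
have h0 := Tcoef_hom coef0D coef0M coef0_deg0 M.
have h1 := Tcoef_hom coef1D coef1M (@coef1_deg _ _ _ Rz i) M.
have u_hom : right_hom (-1) tensor_unit.
  split=> [r x y|d x gx].
    by rewrite /tensor_unit tD' [r *: tens _ _ _]tscale_tens.
  exists [:: (one_B, x)]; rewrite big_seq1; split=> // p; rewrite inE => /eqP -> /=.
  (* The shift in B_i puts 1 \otimes 1 in degree -1. *)
  exists (-1); split; last by rewrite opprK subrK.
  exists [:: (1, 1)]; rewrite big_seq1; split=> // q; rewrite inE => /eqP -> /=.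
  by exists 0; split; rewrite -mpolyC1; exact: rdegC.
have lmul_unit a x : lmul a (tensor_unit x) = tens hR (lmul a one_B) x by exact: tlmul_tens.
have [lb0 lb1] := coef_rho_one_B.
split=> //.
- move=> a x ha; rewrite lmul_unit.
  transitivity (tens hR (a *: one_B) x); first by rewrite tb.
  congr (tens _ _ _); rewrite [LHS]tscale_tens [RHS]tlmul_tens.
  transitivity (tens (invariant_scalars Rz i) (a *: (1 : Rbim k n)) (1 : Rbim k n)) => //.
  by rewrite ub.
- move=> t; rewrite lmul_unit; move: t; apply: tens_ind => [|b x|x y hx hy].
  + rewrite (right_hom0 h0) (right_hom0 h1) /tensor_unit.
    by rewrite !(balanced0r _ (tens_balanced hR (B Rz i) M)) addr0.
  + rewrite (Tcoef_tens coef0D coef0M coef0_deg0) (Tcoef_tens coef1D coef1M (@coef1_deg _ _ _ Rz i)).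
    by rewrite {1}(B_split b) tD; congr (_ + _); exact: tb.
  + rewrite (right_homD h0) (right_homD h1) /tensor_unit !tD' addrACA.
    by congr (_ + _); [exact: hx|exact: hy].
- move=> x y; rewrite lmul_unit (right_homD h0) /tensor_unit.
  by rewrite !(Tcoef_tens coef0D coef0M coef0_deg0) coef0_one_B lb0 lmul0l addr0 (left1 (lmul_action M)).
- move=> x y; rewrite lmul_unit (right_homD h1) /tensor_unit.
  by rewrite !(Tcoef_tens coef1D coef1M (@coef1_deg _ _ _ Rz i)) coef1_one_B lb1 lmul0l add0r (left1 (lmul_action M)).
Qed.
End InducedTensor.
End Induction.

(** * Self-duality of Bott-Samelson bimodules *)

Section Pairing.
Variables (k : idomainType) (n m : nat) (Rz : realization k n m).
Local Notation R := {mpoly k[n]}.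

(** [pair_nondeg] and [pair_repr] identify M with its graded right dual; [pair_lmul] is what makes
    rho_s^e(w) self-adjoint. *)
Record perfect_pairing (M : grbimod k n) (b : M -> M -> R) : Prop := PerfectPairing {
  pair_sym : forall x y, b x y = b y x;
  pair_linear : forall r x y z, b (r *: x + y) z = r * b x z + b y z;
  pair_deg : forall d e x y, gr d x -> gr e y -> rdeg (d + e) (b x y);
  pair_lmul : forall a x y, b (lmul a x) y = b x (lmul a y);
  pair_nondeg : forall x, (forall y, b x y = 0) -> x = 0;
  pair_repr : forall l (phi : M -> R), right_hom (N := Rmod k n) l phi ->
    exists x, gr l x /\ forall y, phi y = b x y }.

Section Theory.
Variables (M : grbimod k n) (b : M -> M -> R) (hb : perfect_pairing b).
Lemma pairDl x y z : b (x + y) z = b x z + b y z.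
Proof. by have := pair_linear hb 1 x y z; rewrite scale1r mul1r. Qed.
Lemma pair0l z : b 0 z = 0.
Proof. by apply: (addIr (b 0 z)); rewrite -pairDl !add0r. Qed.
Lemma pairZl r x z : b (r *: x) z = r * b x z.
Proof. by have := pair_linear hb r x 0 z; rewrite pair0l !addr0. Qed.
Lemma pairBl x y z : b (x - y) z = b x z - b y z.
Proof. by rewrite -scaleN1r pairDl pairZl mulN1r. Qed.
Lemma pairDr x y z : b z (x + y) = b z x + b z y.
Proof. by rewrite !(pair_sym hb z) pairDl. Qed.
Lemma pairZr r x z : b z (r *: x) = r * b z x.
Proof. by rewrite !(pair_sym hb z) pairZl. Qed.
Lemma pair0r z : b z 0 = 0.
Proof. by rewrite (pair_sym hb) pair0l. Qed.
End Theory.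

Lemma perfect_pairing_regular : perfect_pairing (M := Rbim k n) (fun x y => x * y).
Proof.
split=> [x y|r x y z|d e x y|a x y|x h|l phi [h1 h2]].
- exact: mulrC.
- by rewrite mulrDl -mulrA.
- exact: rdegM.
- by rewrite /= mulrCA mulrA.
- by rewrite -[x]mulr1 h.
- exists (phi 1); split; first by rewrite -[l]add0r; apply: h2; rewrite -mpolyC1; exact: rdegC.
  move=> y; rewrite mulrC -[RHS](right_homZ (N := Rmod k n) (conj h1 h2) y (1 : Rbim k n)).
  by congr phi; rewrite [RHS]mulr1.
Qed.

Section Induced.
Variables (i : gen) (M T : grbimod k n) (j : M -> T) (c0 c1 : T -> M).
Hypothesis (hj : induced Rz i j c0 c1).
Local Notation lrho := (linform (rho Rz i)).
Local Notation tau := (trace_rho Rz i).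
Local Notation nu := (norm_rho Rz i).

Let j0 := right_hom0 (ind_j hj).
Let c00 := right_hom0 (ind_c0 hj).
Let c10 := right_hom0 (ind_c1 hj).

Lemma ind_c0_j x : c0 (j x) = x.
Proof. by have := ind_c0K hj x 0; rewrite j0 lmul0r addr0. Qed.
Lemma ind_c1_j x : c1 (j x) = 0.
Proof. by have := ind_c1K hj x 0; rewrite j0 lmul0r addr0. Qed.

Lemma ind_c_inv a t : Defs.invariant Rz i a ->
  c0 (lmul a t) = lmul a (c0 t) /\ c1 (lmul a t) = lmul a (c1 t).
Proof.
move=> ha.
have -> : lmul a t = j (lmul a (c0 t)) + lmul lrho (j (lmul a (c1 t))).
  rewrite {1}(ind_split hj t) lmulDr !(ind_inv hj) //.
  by rewrite -!(leftM (lmul_action T)) mulrC.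
by rewrite (ind_c0K hj) (ind_c1K hj).
Qed.

Lemma ind_c_rho t :
  c0 (lmul lrho t) = lmul (- nu) (c1 t) /\ c1 (lmul lrho t) = c0 t + lmul tau (c1 t).
Proof.
have hN : Defs.invariant Rz i (- nu).
  rewrite -sub0r; apply: invariantB (invariant_norm Rz i).
  by rewrite -mpolyC0; exact: invariantC.
have -> : lmul lrho t = j (lmul (- nu) (c1 t)) + lmul lrho (j (c0 t + lmul tau (c1 t))).
  rewrite {1}(ind_split hj t) (right_homD (ind_j hj)) !lmulDr !(ind_inv hj) //.
    by rewrite -!(leftM (lmul_action T)) lrho_sqr lmulDl [tau * _]mulrC addrA addrC.
  exact: invariant_trace.
by rewrite (ind_c0K hj) (ind_c1K hj).
Qed.

Variables (b : M -> M -> R) (hb : perfect_pairing b).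

(** Modelled on the Frobenius form of R over R^i, which sends (a, a') to the Demazure operator of a
    a': in the basis 1, rho_i its Gram matrix is ((0, 1), (1, tau)), as rho_i^2 = tau rho_i - nu. *)
Definition induced_pairing (u v : T) : R :=
  b (c0 u) (c1 v) + b (c1 u) (c0 v) + b (lmul tau (c1 u)) (c1 v).

(** The Gram matrix has determinant -1, so perfection passes from [b] without denominators. Left
    multiplications need only be checked for invariants and for rho_i, in view of [coefE]. *)
Lemma induced_pairing_perfect : perfect_pairing induced_pairing.
Proof.
have hJ := ind_j hj; have h0 := ind_c0 hj; have h1 := ind_c1 hj.
have sym u v : induced_pairing u v = induced_pairing v u.
  rewrite /induced_pairing [b (c0 u) _](pair_sym hb) [b (c1 u) (c0 v)](pair_sym hb).
  rewrite [b (lmul tau (c1 u)) _](pair_lmul hb) [b (c1 u) (lmul _ _)](pair_sym hb).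
  by ring.
split=> //.
- move=> r x y z; rewrite /induced_pairing h0.1 h1.1 (left_linear (lmul_action M)).
  by rewrite !(pair_linear hb); ring.
- move=> d e x y gx gy; apply: (gsD (V := R^o) (@rdeg_subgroups k n)).
    apply: (gsD (V := R^o) (@rdeg_subgroups k n)).
      have -> : d + e = (d + 1) + (e + -1) by ring.
      by apply: (pair_deg hb); [exact: h0.2|exact: h1.2].
    have -> : d + e = (d + -1) + (e + 1) by ring.
    by apply: (pair_deg hb); [exact: h1.2|exact: h0.2].
  have -> : d + e = (d + -1 + 2) + (e + -1) by ring.
  apply: (pair_deg hb); last exact: h1.2.
  apply: (left_deg (lmul_action M)); last exact: h1.2.
  rewrite /trace_rho act_lrho; apply: (gsD (V := R^o) (@rdeg_subgroups k n)).
    exact: linform_deg.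
  by apply: (gsB (V := R^o) (@rdeg_subgroups k n)); exact: linform_deg.
- have hinv a u v : Defs.invariant Rz i a ->
      induced_pairing (lmul a u) v = induced_pairing u (lmul a v).
    move=> ha; rewrite /induced_pairing.
    have [-> ->] := ind_c_inv u ha; have [-> ->] := ind_c_inv v ha.
    rewrite -(leftM (lmul_action M)) mulrC (leftM (lmul_action M)).
    by rewrite !(pair_lmul hb).
  have hrho u v : induced_pairing (lmul lrho u) v = induced_pairing u (lmul lrho v).
    rewrite /induced_pairing.
    have [-> ->] := ind_c_rho u; have [-> ->] := ind_c_rho v.
    rewrite !lmulDr !(pairDl hb) !(pairDr hb) !(pair_lmul hb).
    by ring.
  have hD a a' u v : induced_pairing (lmul (a + a') u) v =
      induced_pairing (lmul a u) v + induced_pairing (lmul a' u) v.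
    rewrite lmulDl /induced_pairing (right_homD h0) (right_homD h1) lmulDr.
    by rewrite !(pairDl hb); ring.
  move=> a u v; rewrite (coefE Rz i a) hD [in RHS]sym hD ![induced_pairing _ u]sym.
  have i0 := coef0_inv Rz i a; have i1 := coef1_inv Rz i a.
  rewrite hinv //; congr (_ + _).
  by rewrite (leftM (lmul_action T)) hrho hinv // -!(leftM (lmul_action T)) mulrC.
- move=> x h.
  (* Pairing with j y isolates c1 x; once that vanishes, pairing with rho_i j y isolates c0 x. *)
  have e1 : c1 x = 0.
    apply: (pair_nondeg hb) => y; rewrite -[RHS](h (j y)) /induced_pairing.
    by rewrite ind_c0_j ind_c1_j !(pair0r hb) add0r addr0.
  have e0 : c0 x = 0.
    apply: (pair_nondeg hb) => y; rewrite -[RHS](h (lmul lrho (j y))) /induced_pairing.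
    have [-> ->] := ind_c_rho (j y).
    by rewrite e1 ind_c0_j ind_c1_j !lmul0r !(pair0l hb) !addr0.
  by rewrite (ind_split hj x) e0 e1 j0 lmul0r addr0.
- move=> l phi hphi.
  have hl0 : right_hom (N := Rmod k n) (l + -1) (phi \o j).
    split=> [r x y|d x gx] /=; first by rewrite hJ.1 hphi.1.
    have -> : d + (l + -1) = d + -1 + l by ring.
    by apply: hphi.2; exact: hJ.2.
  have hl1 : right_hom (N := Rmod k n) (l + 1) (fun x => phi (lmul lrho (j x))).
    split=> [r x y|d x gx] /=; first by rewrite hJ.1 (left_linear (lmul_action T)) hphi.1.
    have -> : d + (l + 1) = (d + -1 + 2) + l by ring.
    apply: hphi.2; apply: (left_deg (lmul_action T)); first exact: linform_deg.
    exact: hJ.2.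
  have [x0 [g0 E0]] := pair_repr hb hl0; have [x1 [g1 E1]] := pair_repr hb hl1.
  (* [x0] and [x1] represent phi on j M and on rho_i j M; applying the inverse Gram matrix to them
     gives these coordinates. *)
  exists (j (x1 - lmul tau x0) + lmul lrho (j x0)); split.
    apply: (gsD (grading_subgroups (gr_grading T))).
      rewrite -[l](addrK 1); apply: hJ.2.
      apply: (gsB (grading_subgroups (gr_grading M))) => //.
      have -> : l + 1 = l + -1 + 2 by ring.
      apply: (left_deg (lmul_action M)) => //.
      rewrite /trace_rho act_lrho; apply: (gsD (V := R^o) (@rdeg_subgroups k n)).
        exact: linform_deg.
      by apply: (gsB (V := R^o) (@rdeg_subgroups k n)); exact: linform_deg.
    have -> : l = l + -1 + -1 + 2 by ring.
    by apply: (left_deg (lmul_action T)); [exact: linform_deg|exact: hJ.2].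
  move=> y; rewrite {1}(ind_split hj y) (right_homD hphi).
  rewrite [phi (j _)]E0 [phi _]E1 /induced_pairing (ind_c0K hj) (ind_c1K hj).
  by rewrite (pairBl hb); ring.
Qed.
End Induced.
End Pairing.

(** * Quantum numbers and the polynomials p_(i, d) *)

Definition other (i : gen) : gen := if i is gen_s then gen_t else gen_s.

Lemma otherK i : other (other i) = i.
Proof. by case: i. Qed.

Section QuantumNumbers.
Variables (k : idomainType) (n m : nat) (Rz : realization k n m).
Local Notation two := (- a_st Rz).

Lemma qnumSS d : qnum two d.+2 = two * qnum two d.+1 - qnum two d.
Proof. by []. Qed.

(** The form u^2 - [2] u v + v^2 is preserved by the recursion (u, v) -> (v, [2] v - u), and it is 1
    at (0, 1). *)
Lemma qnum_quadric d :
  qnum two d.+1 ^+ 2 = two * qnum two d * qnum two d.+1 - qnum two d ^+ 2 + 1.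
Proof.
elim: d => [|d IH]; first by rewrite /=; ring.
by rewrite qnumSS; ring: IH.
Qed.

(** In K one has (q - q^-1) [d] = q^d - q^-d, which vanishes at d = m because q^(2m) = 1. And q
    differs from q^-1, since otherwise 2m would divide 2. *)
Lemma qnum_order : (2 <= m)%N -> qnum two m = 0.
Proof.
move=> m2; have [K [iota [q [inj prim E2]]]] := faithful Rz.
apply: inj; rewrite rmorph0; set w := iota two in E2.
have q0 : q != 0.
  apply/negP => /eqP q0; have := prim_expr_order prim.
  by rewrite q0 expr0n muln_eq0 /= -leqn0 leqNgt (leq_trans _ m2) //= => /esym/eqP; rewrite oner_eq0.
have Hd d : (q - q^-1) * iota (qnum two d) = q ^+ d - q^-1 ^+ d /\
            (q - q^-1) * iota (qnum two d.+1) = q ^+ d.+1 - q^-1 ^+ d.+1.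
  elim: d => [|d [IH0 IH1]]; first by rewrite /= rmorph0 rmorph1 mulr0 mulr1 !expr0 subrr !expr1.
  split=> //; rewrite qnumSS rmorphB rmorphM -/w E2 mulrBr IH0 mulrCA IH1 !exprS.
  by field.
have [/eqP] := Hd m; have qm : q ^+ m = q^-1 ^+ m.
  have h : q ^+ m * q ^+ m = 1 by rewrite -exprD addnn -mul2n (prim_expr_order prim).
  by rewrite exprVn; apply: (mulfI (expf_neq0 m q0)); rewrite h mulfV // expf_neq0.
rewrite qm subrr mulf_eq0 => /orP[|/eqP //]; rewrite subr_eq0 => /eqP qq.
have : q ^+ 2 = 1 by rewrite expr2 {1}qq mulVf.
move/eqP; rewrite -(prim_order_dvd prim) => dv.
by have := leq_trans (leq_mul (leqnn 2) m2) (dvdn_leq (isT : 0 < 2)%N dv).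
Qed.

End QuantumNumbers.

Section RankTwo.
Variables (k : idomainType) (n m : nat) (Rz : realization k n m).
Hypothesis rank2 : Lambda_st_trivial Rz.
Local Notation R := {mpoly k[n]}.
Local Notation E := {mpoly R[n]}.
Local Notation lrho i := (linform (rho Rz i)).
Local Notation lroot i := (linform (Defs.root Rz i)).
Local Notation two := ((- a_st Rz)%:MP : R).
Local Notation qn d := ((qnum (- a_st Rz) d)%:MP : R).

(** The difference of the two sides pairs to 0 with both coroots, hence is fixed by both
    reflections; this is where triviality of Lambda_st enters. *)
Lemma rho_span lam : lam = pairing (coroot Rz gen_s) lam *: rho Rz gen_s +
  pairing (coroot Rz gen_t) lam *: rho Rz gen_t.
Proof.
apply/eqP; rewrite -subr_eq0; apply/eqP/rank2 => i.
rewrite /act_dual /corefl pairingB pairingD !pairingZ.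
by case: i; rewrite ?rho_ss ?rho_tt ?rho_st ?rho_ts mulr0 mulr1 ?addr0 ?add0r subrr scale0r subr0.
Qed.

Lemma lroot_rho i : lroot i = lrho i + lrho i - two * lrho (other i).
Proof.
rewrite [Defs.root Rz i]rho_span linformD !linformZ.
case: i; rewrite pairing_root ?cartan_symmetric mpolyC_nat mpolyCN -/(a_st Rz);
  rewrite /=; ring.
Qed.

Lemma act_rho i : act_poly Rz i (lrho i) = two * lrho (other i) - lrho i.
Proof. by rewrite act_lrho lroot_rho; ring. Qed.

Lemma invariant_other i : Defs.invariant Rz i (lrho (other i)).
Proof.
rewrite /Defs.invariant act_linform /act_dual /corefl.
by case: i; rewrite /= ?rho_st ?rho_ts scale0r subr0.
Qed.

Definition quad : R :=
  lrho gen_s * lrho gen_s - two * lrho gen_s * lrho gen_t + lrho gen_t * lrho gen_t.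

Lemma quadE i : quad = lrho i * lrho i - two * lrho i * lrho (other i) + lrho (other i) * lrho (other i).
Proof. by case: i => //=; rewrite /quad; ring. Qed.

(** With i' the other reflection, [quad] is rho_i'^2 - rho_i s_i(rho_i): the square of an invariant
    minus a norm. *)
Lemma invariant_quad i : Defs.invariant Rz i quad.
Proof.
rewrite /Defs.invariant (quadE i) act_polyD act_polyB !act_polyM act_polyC.
rewrite act_rho (invariant_other i); ring.
Qed.

Local Notation X i := (left_el (lrho i)).
Local Notation Cr := (@right_el k n).
Local Notation cent := (left_el quad - right_el quad : E).

(* The image of rho_i under the alternating product of d reflections in which i
   acts first. *)
Definition xi i d : R :=
  if odd d then qn d.+1 * lrho (other i) - qn d * lrho i
  else qn d.+1 * lrho i - qn d * lrho (other i).

(* For 0 < d <= m, R^e / (cent, desc_poly i d) is the indecomposable Soergel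
   bimodule of the element of length d with left descent other i. *)
Definition desc_poly i d : E := \prod_(j < d) (X i - Cr (xi i j)).

(** Absorbs the parity of d: in terms of it, [xi] obeys the uniform formulas [xiE] and
    [xi_otherE]. *)
Definition line_const i d : R := if odd d then lrho (other i) else lrho i.

(** The form [xi] with left and right exchanged: xi(i, d) \otimes 1 - 1 \otimes rho_i for even d,
    and the same with [other i] for odd d. It is the residual factor in [desc_poly_line]. *)
Definition line i d : E := 
  Cr (qn d.+1) * X i - Cr (qn d) * X (other i) - Cr (line_const i d).

Lemma desc_polyS i d : desc_poly i d.+1 = desc_poly i d * (X i - Cr (xi i d)).
Proof. by rewrite /desc_poly big_ord_recr. Qed.

Lemma desc_poly0 i : desc_poly i 0 = 1.
Proof. by rewrite /desc_poly big_ord0. Qed.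

Lemma desc_poly1 i : desc_poly i 1 = X i - Cr (lrho i).
Proof.
by rewrite desc_polyS desc_poly0 mul1r /xi /= mpolyC0 mpolyC1 mul1r mul0r subr0.
Qed.

Lemma left_quad i : left_el quad =
  X i * X i - Cr two * X i * X (other i) + X (other i) * X (other i) :> E.
Proof.
rewrite (quadE i) left_elD left_elB [left_el (_ * lrho (other i))]left_elM.
by rewrite [left_el (two * _)]left_elM [left_el (lrho i * _)]left_elM left_elC left_elM.
Qed.

Lemma right_quad i : Cr quad =
  Cr (lrho i) * Cr (lrho i) - Cr two * Cr (lrho i) * Cr (lrho (other i)) + Cr (lrho (other i)) * Cr (lrho (other i)).
Proof. by rewrite (quadE i) right_elD right_elB !right_elM. Qed.

Lemma qnR_SS d : qn d.+2 = two * qn d.+1 - qn d.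
Proof. by rewrite qnumSS mpolyCB mpolyCM. Qed.

Lemma qnE_quadric d : Cr (qn d.+1) * Cr (qn d.+1) =
  Cr two * Cr (qn d) * Cr (qn d.+1) - Cr (qn d) * Cr (qn d) + 1.
Proof.
rewrite -!right_elM -right_el1 -right_elB -right_elD; congr right_el.
by rewrite -!mpolyCM -mpolyC1 -mpolyCB -mpolyCD -!expr2 qnum_quadric.
Qed.

(** The exchange of factors in the induction for [desc_poly_line]: both products agree on the conic
    ql = qr. The relation between c0 and c1 is [qnum_quadric]. *)
Lemma line_step (S : comNzRingType) (Y Y' y y' c0 c1 c2 w e0 e1 ql qr : S) :
  c1 * c1 = w * c0 * c1 - c0 * c0 + 1 -> c2 = w * c1 - c0 ->
  ql = Y * Y - w * Y * Y' + Y' * Y' -> qr = y * y - w * y * y' + y' * y' ->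
  e0 = c1 * y' - c0 * y -> e1 = c2 * y' - c1 * y ->
  (c1 * Y - c0 * Y' - y) * (Y - e1) =
  (Y' - e0) * (c2 * Y - c1 * Y' - y') + c1 * (ql - qr).
Proof. by move=> h -> -> -> -> ->; ring: h. Qed.

(** Eliminates X between the line c1 X = c0 Y + y and the conic X^2 - w X Y + Y^2 = qr: the left
    side is c1^2 times the equation of the conic, and e0, e1 are the Y-coordinates of the two
    intersection points. *)
Lemma line_norm (S : comNzRingType) (Y y y' c0 c1 c2 w e0 e1 qr : S) :
  c1 * c1 = w * c0 * c1 - c0 * c0 + 1 -> c2 = w * c1 - c0 ->
  qr = y * y - w * y * y' + y' * y' ->
  e0 = c1 * y' - c0 * y -> e1 = c2 * y - c1 * y' ->
  (c0 * Y + y) * (c0 * Y + y) - c1 * w * Y * (c0 * Y + y) + c1 * c1 * (Y * Y - qr) =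
  (Y - e0) * (Y - e1).
Proof. by move=> h -> -> -> ->; ring: h. Qed.

Lemma xiE i d : Cr (xi i d.+1) = Cr (qn d.+2) * Cr (line_const (other i) d)
  - Cr (qn d.+1) * Cr (line_const i d).
Proof.
rewrite /xi /line_const otherK /=; case: (odd d) => /=; by rewrite right_elB !right_elM.
Qed.

Lemma xi_otherE i d : Cr (xi (other i) d) = Cr (qn d.+1) * Cr (line_const (other i) d)
  - Cr (qn d) * Cr (line_const i d).
Proof.
rewrite /xi /line_const otherK /=; case: (odd d) => /=; by rewrite right_elB !right_elM.
Qed.

Lemma line_constS i d : line_const i d.+1 = line_const (other i) d.
Proof. by rewrite /line_const otherK /=; case: (odd d). Qed.

Lemma right_quad_line i d : Cr quad =
  Cr (line_const i d) * Cr (line_const i d) - Cr two * Cr (line_const i d) * Cr (line_const (other i) d)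
  + Cr (line_const (other i) d) * Cr (line_const (other i) d).
Proof.
rewrite /line_const otherK; case: (odd d); last exact: right_quad.
by rewrite (right_quad (other i)) otherK.
Qed.

Lemma qnE_SS d : Cr (qn d.+2) = Cr two * Cr (qn d.+1) - Cr (qn d).
Proof. by rewrite qnR_SS right_elB right_elM. Qed.

(* Over each of the first d roots of desc_poly (other i) both points of the conic
   cent = 0 are zeros of desc_poly i d.+1; the quotient is linear. *)
Lemma desc_poly_line i d :
  exists e, desc_poly i d.+1 = desc_poly (other i) d * line i d + e * cent.
Proof.
elim: d => [|d [e IH]].
  exists 0; rewrite desc_poly1 desc_poly0 mul0r addr0 mul1r /line /line_const /=.
  by rewrite mpolyC1 mpolyC0 right_el1 right_el0 mul1r mul0r subr0.
exists (e * (X i - Cr (xi i d.+1)) + desc_poly (other i) d * Cr (qn d.+1)).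
rewrite desc_polyS IH [desc_poly _ d.+1]desc_polyS.
have {}IH : line i d * (X i - Cr (xi i d.+1)) =
    (X (other i) - Cr (xi (other i) d)) * line i d.+1 + Cr (qn d.+1) * cent.
  rewrite {2}/line line_constS.
  exact: (line_step (qnE_quadric d) (qnE_SS d) (left_quad i)
    (right_quad_line i d) (xi_otherE i d) (xiE i d)).
have comb (S : comNzRingType) (a l e' c y f g q : S) : l * y = f * g + q * c ->
    (a * l + e' * c) * y = a * f * g + (e' * y + a * q) * c by move=> h; ring: h.
exact: comb IH.
Qed.

End RankTwo.

(** * Regular operators *)

Section Regularity.
Variables (k : idomainType) (n : nat).
Local Notation R := {mpoly k[n]}.
Local Notation E := {mpoly R[n]}.

Lemma right_hom_eq (M N : grmod k n) l l' (f : M -> N) : l = l' -> right_hom l f -> right_hom l' f.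
Proof. by move=> ->. Qed.

Lemma right_hom_add (M N : grmod k n) l (f g : M -> N) :
  right_hom l f -> right_hom l g -> right_hom l (fun x => f x + g x).
Proof.
move=> [f1 f2] [g1 g2]; split=> [r x y|d x gx].
  by rewrite f1 g1 scalerDr addrACA.
by apply: (gsD (grading_subgroups (gr_grading N))); [exact: f2|exact: g2].
Qed.

Lemma right_hom_opp (M N : grmod k n) l (f : M -> N) :
  right_hom l f -> right_hom l (fun x => - f x).
Proof.
move=> [f1 f2]; split=> [r x y|d x gx]; first by rewrite f1 opprD scalerN.
by apply: (gsN (grading_subgroups (gr_grading N))); exact: f2.
Qed.

Lemma right_hom_comp (M N N' : grmod k n) l l' (f : M -> N) (g : N -> N') :
  right_hom l f -> right_hom l' g -> right_hom (l + l') (fun x => g (f x)).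
Proof.
move=> [f1 f2] [g1 g2]; split=> [r x y|d x gx]; first by rewrite f1 g1.
by rewrite addrA; exact/g2/f2.
Qed.

Lemma right_hom_id (M : grmod k n) : right_hom 0 (fun x : M => x).
Proof. by split=> // d x gx; rewrite addr0. Qed.

Lemma right_hom_lmul (M : grbimod k n) d a : rdeg d a -> right_hom d (@lmul _ _ M a).
Proof.
move=> ha; split=> [r x y|c x gx]; first exact: left_linear (lmul_action M) _ _ _ _.
exact: left_deg (lmul_action M) _ _ _ _ ha gx.
Qed.

Lemma right_hom_eact (M : grbimod k n) d e : edeg d e -> right_hom d (@eact _ _ M e).
Proof.
move=> he; split=> [r x y|c x gx]; first exact: eact_linear.
exact: eact_deg.
Qed.

(* Von Neumann regularity in the graded ring of right R-linear endomorphisms. *)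
Definition regular_on (M : grbimod k n) (l : int) (e : E) : Prop :=
  exists g : M -> M, right_hom (- l) g /\ forall x, eact e (g (eact e x)) = eact e x.

Lemma regular_on1 (M : grbimod k n) : regular_on M 0 1.
Proof.
exists (fun x => x); rewrite oppr0; split; first exact: right_hom_id.
by move=> x; rewrite !eact1.
Qed.

Lemma regular_on_eq (M : grbimod k n) l e e' :
  (forall x : M, eact e x = eact e' x) -> regular_on M l e -> regular_on M l e'.
Proof.
by move=> ee [g [hg Hg]]; exists g; split=> // x; rewrite -!ee Hg.
Qed.

Lemma regular_onN (M : grbimod k n) l e : regular_on M l e -> regular_on M l (- e).
Proof.
move=> [g [hg Hg]]; exists (fun x => - g x); split; first exact: right_hom_opp.
move=> x; rewrite !eactNl eactNr opprK.
by rewrite -[in LHS]scaleN1r (right_homZ hg) eactZ Hg scaleN1r.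
Qed.

Variables (m : nat) (Rz : realization k n m) (i : gen).
Variables (M T : grbimod k n) (j : M -> T) (c0 c1 : T -> M).
Hypothesis (hj : induced Rz i j c0 c1).
Local Notation lrho := (linform (rho Rz i)).
Local Notation X := (left_el lrho).

(** Such an [e] acts separately on the coordinates c0 and c1. Elements of the right factor and left
    invariants of i have this property. *)
Definition commutes_ind (e : E) : Prop := forall x, j (eact e x) = eact e (j x).

Lemma commutes_indD e e' : commutes_ind e -> commutes_ind e' -> commutes_ind (e + e').
Proof. by move=> h h' x; rewrite !eactDl (right_homD (ind_j hj)) h h'. Qed.
Lemma commutes_indN e : commutes_ind e -> commutes_ind (- e).
Proof.
move=> h x; rewrite !eactNl -h -scaleN1r (right_homZ (ind_j hj)).
by rewrite scaleN1r.
Qed.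
Lemma commutes_indM e e' : commutes_ind e -> commutes_ind e' -> commutes_ind (e * e').
Proof. by move=> h h' x; rewrite !eactM h h'. Qed.
Lemma commutes_ind_right r : commutes_ind (right_el r).
Proof. by move=> x; rewrite !eact_right (right_homZ (ind_j hj)). Qed.
Lemma commutes_ind_left a : Defs.invariant Rz i a -> commutes_ind (left_el a).
Proof. by move=> ha x; rewrite !eact_left (ind_inv hj). Qed.

Lemma commutes_ind_eact e (x0 x1 : M) : commutes_ind e ->
  eact e (j x0 + lmul lrho (j x1)) = j (eact e x0) + lmul lrho (j (eact e x1)).
Proof. by move=> h; rewrite eactDr -!eact_left -eactM mulrC eactM !h. Qed.

(** The operator is diagonal, so the quasi-inverse may be applied to each coordinate. *)
Lemma regular_diag l e : commutes_ind e -> regular_on M l e -> regular_on T l e.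
Proof.
move=> he [g [hg Hg]].
exists (fun t => j (g (c0 t)) + lmul lrho (j (g (c1 t)))); split.
  have hr := right_hom_lmul T (@linform_deg k n (rho Rz i)).
  apply: right_hom_add.
    by refine (right_hom_eq _ (right_hom_comp (right_hom_comp (ind_c0 hj) hg) (ind_j hj))); ring.
  by refine (right_hom_eq _ (right_hom_comp (right_hom_comp (right_hom_comp
    (ind_c1 hj) hg) (ind_j hj)) hr)); ring.
move=> t /=; have := ind_split hj t; move: (c0 t) (c1 t) => x0 x1 ->.
by rewrite !commutes_ind_eact // (ind_c0K hj) (ind_c1K hj) !Hg.
Qed.

Section OffDiagonal.
(** In the application P is [desc_poly (other i) d], L is [line i d], Y is rho_(other i) on the
    left, c and w are [d+1] and [2], u is the inverse of c, q is 1 \otimes [quad], and D is the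
    product of the next two factors of [desc_poly (other i)], supplied by [line_norm]. *)
Variables (P L Y l D c u w q cent : E) (de : int).
Hypotheses (hP : commutes_ind P) (hY : commutes_ind Y) (hl : commutes_ind l)
  (hc : commutes_ind c) (hu : commutes_ind u) (hw : commutes_ind w) (hD : commutes_ind D).
Hypotheses (EL : L = c * X - l) (Eu : u * c = 1)
  (ED : D = l * l - c * w * Y * l + c * c * (Y * Y - q))
  (Ecent : cent = X * X - w * X * Y + Y * Y - q)
  (cent0 : forall t : T, eact cent t = 0).

(** The rho_i-coordinate of L applied to j x0 + rho_i j x1, once X * X is rewritten by cent = 0.
    Since c is invertible, it can replace x0 as a coordinate. *)
Definition line_coord (x0 x1 : M) : M := eact c x0 + eact (c * w * Y - l) x1.
Local Notation U := line_coord.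

(* In the coordinates (U, x1) the operator P * L is diag(P, P * D), up to an
   invertible matrix on the other side. *)
Lemma eact_line x0 x1 : eact (P * L) (j x0 + lmul lrho (j x1)) =
  j (eact (- (P * u)) (eact l (U x0 x1) + eact D x1)) + lmul lrho (j (eact P (U x0 x1))).
Proof.
have hcwY : commutes_ind (c * w * Y - l).
  by apply: commutes_indD; [do 2!apply: commutes_indM => //|exact: commutes_indN].
have hPu : commutes_ind (- (P * u)) by apply: commutes_indN; exact: commutes_indM.
rewrite /line_coord hPu (right_homD (ind_j hj)) hl (right_homD (ind_j hj)) hc hcwY hD hP.
rewrite (right_homD (ind_j hj)) hc hcwY -!eact_left.
rewrite !eactDr -!eactM.
have E0 : P * L = - (P * u) * l * c + X * P * c.
  rewrite EL; transitivity (P * (c * X - (u * c) * l)); first by rewrite Eu mul1r.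
  by ring.
have E1 : P * L * X = - (P * u) * l * (c * w * Y - l) + - (P * u) * D
    + X * P * (c * w * Y - l) + P * c * cent.
  rewrite EL ED Ecent.
  transitivity (P * ((u * c) * ((X * X - w * X * Y + Y * Y - q) * c) 
    - (u * c) * c * (Y * Y - q) + X * c * w * Y - X * l)).
    by rewrite Eu; ring.
  transitivity (P * (c * (X * X - w * X * Y + Y * Y - q)
    - u * c * c * (Y * Y - q) + X * c * w * Y - X * l)); last by ring.
  by rewrite Eu; ring.
transitivity (eact (- (P * u) * l * c + X * P * c) (j x0) +
    eact (- (P * u) * l * (c * w * Y - l) + - (P * u) * D +
    X * P * (c * w * Y - l) + P * c * cent) (j x1)).
  by congr (eact _ _ + eact _ _).
have ab (V : zmodType) (a b d e f : V) : a + b + (d + e + f + 0) = a + d + e + (b + f).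
  by rewrite addr0 -!addrA; congr (_ + _); rewrite addrCA; congr (_ + _); rewrite addrCA.
rewrite !eactDl (eactM (P * c) cent) cent0 eact0; exact: ab.
Qed.

Hypotheses (gY : edeg 2 Y) (gl : edeg 2 l) (gc : edeg 0 c) (gu : edeg 0 u) (gw : edeg 0 w).
Variable du : R.
Hypothesis Edu : u = right_el du.

(** By commutativity of R^e the factor P can be moved next to a0 and to D a1, so the output depends
    only on P a0 and P D a1. *)
Lemma line_eq (a0 a1 b0 b1 : M) :
  eact P a0 = eact P b0 -> eact (P * D) a1 = eact (P * D) b1 ->
  j (eact (- (P * u)) (eact l a0 + eact D a1)) + lmul lrho (j (eact P a0)) =
  j (eact (- (P * u)) (eact l b0 + eact D b1)) + lmul lrho (j (eact P b0)).
Proof.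
move=> E0 E1; congr (j _ + lmul _ (j _)); last exact: E0.
rewrite !eactDr -!(eactM (- (P * u))).
have -> : - (P * u) * l = - (u * l) * P by ring.
have -> : - (P * u) * D = - u * (P * D) by ring.
by rewrite !(eactM (- (u * l))) !(eactM (- u)) E0 E1.
Qed.

(** Regularity is insensitive to invertible changes of coordinates on either side, so the two
    diagonal entries found in [eact_line] suffice; D has degree 4 and L degree 2. *)
Lemma regular_off_diag : regular_on M de P -> regular_on M (de + 4) (P * D) ->
  regular_on T (de + 2) (P * L).
Proof.
move=> [g [hg Hg]] [g' [hg' Hg']].
(* [x0] and [x1] form the quasi-inverse in the coordinates (U, x1), the term u * l removing the
   contribution of U from c0; [y0] solves U(y0, x1) = x0 for the old coordinate. *)
pose x0 t := g (c1 t).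
pose x1 t := eact (- c) (g' (c0 t + eact (u * l) (c1 t))).
pose y0 t := eact u (x0 t) + eact (- (u * (c * w * Y - l))) (x1 t).
have gul : edeg 2 (u * l) by rewrite -[2]add0r; exact: edegM.
have gc' : edeg 0 (- c) by exact: edegN.
have gcwY : edeg 2 (c * w * Y - l).
  by apply: edegB => //; have := edegM (edegM gc gw) gY; rewrite !add0r.
have gv : edeg 2 (- (u * (c * w * Y - l))).
  by apply: edegN; have := edegM gu gcwY; rewrite add0r.
have h0 : right_hom (-1 - de) x0 by exact: right_hom_comp (ind_c1 hj) hg.
have h1 : right_hom (1 - (de + 4)) x1.
  refine (right_hom_eq _ (right_hom_comp (right_hom_comp (right_hom_add (ind_c0 hj) _) hg')
    (right_hom_eact M gc'))); first by rewrite addr0.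
  refine (right_hom_eq _ (right_hom_comp (ind_c1 hj) (right_hom_eact M gul))); ring.
have h2 : right_hom (-1 - de) y0.
  apply: right_hom_add.
    refine (right_hom_eq _ (right_hom_comp h0 (right_hom_eact M gu))); ring.
  refine (right_hom_eq _ (right_hom_comp h1 (right_hom_eact M gv))); ring.
exists (fun t => j (y0 t) + lmul lrho (j (x1 t))); split.
  have hr := right_hom_lmul T (@linform_deg k n (rho Rz i)).
  apply: right_hom_add.
    refine (right_hom_eq _ (right_hom_comp h2 (ind_j hj))); ring.
  refine (right_hom_eq _ (right_hom_comp (right_hom_comp h1 (ind_j hj)) hr)); ring.
move=> t; rewrite (ind_split hj t); move: (c0 t) (c1 t) => m0 m1.
rewrite [eact (P * L) (j m0 + _)]eact_line.
set U0 := U m0 m1.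
set v := (X in _ = X).
have v0 : c0 v = eact (- (P * u)) (eact l U0 + eact D m1) by rewrite /v (ind_c0K hj).
have v1 : c1 v = eact P U0 by rewrite /v (ind_c1K hj).
rewrite eact_line.
have EU : U (y0 v) (x1 v) = x0 v.
  have Ez : c * - (u * (c * w * Y - l)) + (c * w * Y - l) = 0.
    transitivity ((c * w * Y - l) - (u * c) * (c * w * Y - l)); first by ring.
    by rewrite Eu; ring.
  transitivity (eact (c * u) (x0 v) + (eact (c * - (u * (c * w * Y - l))) (x1 v) +
      eact (c * w * Y - l) (x1 v))).
    by rewrite /line_coord /y0 eactDr -!eactM addrA.
  rewrite -(eactDl (c * - (u * (c * w * Y - l)))) Ez.
  by rewrite eact0l addr0 mulrC Eu eact1.
have E0 : eact P (x0 v) = eact P U0 by rewrite /x0 v1 Hg.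
have E1 : eact (P * D) (x1 v) = eact (P * D) m1.
  have -> : x1 v = g' (eact (P * D) m1).
    rewrite /x1 v0 v1 eactDr -!eactM.
    rewrite addrAC -eactDl.
    have -> : - (P * u) * l + u * l * P = 0 by ring.
    rewrite eact0l add0r.
    (* [g'] is only right R-linear; u passes through it because it comes from the right factor. *)
    have -> : - (P * u) * D = right_el (- du) * (P * D).
      by rewrite right_elN -Edu; ring.
    rewrite eactM eact_right (right_homZ hg') -[_ *: _]eact_right -eactM right_elN -Edu.
    by rewrite mulrNN mulrC Eu eact1.
  exact: Hg'.
rewrite EU; exact: (line_eq E0 E1).
Qed.
End OffDiagonal.
End Regularity.

(** * Regularity on Bott-Samelson bimodules *)

Section BottSamelson.
Variables (k : idomainType) (n m : nat) (Rz : realization k n m).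
Hypotheses (rank2 : Lambda_st_trivial Rz) (m_ge2 : (2 <= m)%N).
Local Notation R := {mpoly k[n]}.
Local Notation E := {mpoly R[n]}.
Local Notation lrho i := (linform (rho Rz i)).
Local Notation two := ((- a_st Rz)%:MP : R).
Local Notation qn d := ((qnum (- a_st Rz) d)%:MP : R).
Local Notation X i := (left_el (lrho i)).
Local Notation Cr := (@right_el k n).
Local Notation cent := (left_el (quad Rz) - right_el (quad Rz) : E).

Lemma BS_induced i w : exists (j : BS Rz w -> BS Rz (i :: w)) c0 c1, induced Rz i j c0 c1.
Proof. by do 3!eexists; exact: (tensor_induced Rz i (BS Rz w)). Qed.

Lemma BS_pairing w : exists b : BS Rz w -> BS Rz w -> R, perfect_pairing b.
Proof.
elim: w => [|i w [b hb]]; first by eexists; exact: perfect_pairing_regular.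
have [j [c0 [c1 hj]]] := BS_induced i w.
by exists (induced_pairing Rz i c0 c1 b); exact: induced_pairing_perfect hj _ hb.
Qed.

(** An invariant of both reflections crosses every tensor sign, down to R, where the two actions
    agree. *)
Lemma BS_central w (x : BS Rz w) : eact cent x = 0.
Proof.
rewrite eactBl eact_left eact_right; apply/eqP; rewrite subr_eq0; apply/eqP.
elim: w x => [//|i w IH] x; have [j [c0 [c1 hj]]] := BS_induced i w.
have hq := invariant_quad rank2 i.
have sw y : lmul (quad Rz) (lmul (lrho i) y) = lmul (lrho i) (lmul (quad Rz) y).
  by rewrite -!(leftM (lmul_action _)) mulrC.
rewrite (ind_split hj x) lmulDr sw -!(ind_inv hj _ hq) !IH !(right_homZ (ind_j hj)) lmulZ.
by rewrite scalerDr.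
Qed.

Lemma edeg_X i : edeg 2 (X i).
Proof. by apply: edeg_left; exact: linform_deg. Qed.

Lemma edeg_Cr_const (c : k) : edeg 0 (Cr c%:MP).
Proof. by apply: edeg_right; exact: rdegC. Qed.

Lemma edeg_line_const i d : edeg 2 (Cr (line_const Rz i d)).
Proof.
by apply: edeg_right; rewrite /line_const; case: (odd d); exact: linform_deg.
Qed.

Section Step.
Variables (i : gen) (w : seq gen).
Hypothesis reg : forall d, (d <= m)%N ->
  regular_on (BS Rz w) (2 * d)%:Z (desc_poly Rz (other i) d).

Lemma commutes_desc_poly d (j : BS Rz w -> BS Rz (i :: w)) c0 c1 :
  induced Rz i j c0 c1 -> commutes_ind j (desc_poly Rz (other i) d).
Proof.
move=> hj; elim: d => [|d IH].
  by rewrite desc_poly0 -right_el1; exact: commutes_ind_right hj _.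
rewrite desc_polyS; apply: commutes_indM IH _.
apply: (commutes_indD hj); last first.
  by apply: (commutes_indN hj); exact: commutes_ind_right hj _.
by apply: (commutes_ind_left hj); exact: invariant_other.
Qed.

Lemma regular_other d : (d <= m)%N ->
  regular_on (BS Rz (i :: w)) (2 * d)%:Z (desc_poly Rz (other i) d).
Proof.
move=> dm; have [j [c0 [c1 hj]]] := BS_induced i w.
by apply: (regular_diag hj); [exact: commutes_desc_poly hj|exact: reg].
Qed.

Lemma regular_line d (x : BS Rz (i :: w)) : 
  eact (desc_poly Rz (other i) d * line Rz i d) x = eact (desc_poly Rz i d.+1) x.
Proof.
have [e ->] := desc_poly_line Rz i d.
by rewrite (eactDl (_ * _)) (eactM e) BS_central eact0 addr0.
Qed.

Lemma regular_same d : (d <= m)%N ->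
  regular_on (BS Rz (i :: w)) (2 * d)%:Z (desc_poly Rz i d).
Proof.
case: d => [|d] dm; first by rewrite desc_poly0; exact: regular_on1.
apply: (regular_on_eq (@regular_line d)).
move: dm; rewrite leq_eqVlt => /orP[/eqP dm|dm].
  (* At the top degree d + 1 = m the coefficient [d+1] of rho_i in the line vanishes and [d] = 1:
     the line is minus the next factor of [desc_poly (other i)], so the product is diagonal. *)
  have q0 : qnum (- a_st Rz) d.+1 = 0 by rewrite dm; exact: qnum_order.
  have q1 : qnum (- a_st Rz) d = 1.
    by rewrite -[d in LHS]/(d.+1.-1) [d.+1 in LHS]dm; exact: balanced_qnum.
  have -> : desc_poly Rz (other i) d * line Rz i d = - desc_poly Rz (other i) d.+1.
    rewrite desc_polyS xi_otherE /line q0 q1 mpolyC0 mpolyC1 right_el0 right_el1.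
    move: (desc_poly _ _ _) (X _) (X _) (Cr _) (Cr _) => a b c e f; ring.
  by apply: regular_onN; apply: regular_other; rewrite dm.
(* Now d + 1 < m, so [d+1] is invertible and both d and d + 2 stay in the range of the induction
   hypothesis. *)
have /unitrP[u [uc _]] : qnum (- a_st Rz) d.+1 \is a GRing.unit.
  by apply: lesser_invertibility.
have [j [c0 [c1 hj]]] := BS_induced i w.
have hP := commutes_desc_poly d hj.
have hY : commutes_ind j (X (other i)).
  by apply: (commutes_ind_left hj); exact: invariant_other.
have hr r : commutes_ind j (Cr r) := commutes_ind_right hj r.
have hl : commutes_ind j (Cr (qn d) * X (other i) + Cr (line_const Rz i d)).
  by apply: (commutes_indD hj) => //; exact: commutes_indM.
have hX r : commutes_ind j (X (other i) - Cr r).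
  by apply: (commutes_indD hj) => //; exact: commutes_indN hj _ _.
have hD := commutes_indM (hX (xi Rz (other i) d)) (hX (xi Rz (other i) d.+1)).
have gl : edeg 2 (Cr (qn d) * X (other i) + Cr (line_const Rz i d)).
  apply: edegD; last exact: edeg_line_const.
  by have := edegM (@edeg_Cr_const (qnum (- a_st Rz) d)) (@edeg_X (other i)); rewrite add0r.
have -> : (2 * d.+1)%:Z = (2 * d)%:Z + 2 by rewrite mulnS addnC PoszD.
have EL : line Rz i d = Cr (qn d.+1) * X i
    - (Cr (qn d) * X (other i) + Cr (line_const Rz i d)) by rewrite /line opprD addrA.
have Eu : Cr u%:MP * Cr (qn d.+1) = 1 by rewrite -right_elM -mpolyCM uc mpolyC1 right_el1.
have xi2 := xiE Rz (other i) d; rewrite otherK in xi2.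
have ED := esym (line_norm (X (other i)) (qnE_quadric Rz d) (qnE_SS Rz d)
  (right_quad_line Rz i d) (xi_otherE Rz i d) xi2).
have Ec : cent = X i * X i - Cr two * X i * X (other i) + X (other i) * X (other i)
    - Cr (quad Rz) by rewrite (left_quad Rz i).
have gconst (c : k) : edeg 0 (Cr c%:MP) by exact: edeg_Cr_const.
have hPD : regular_on (BS Rz w) ((2 * d)%:Z + 4) (desc_poly Rz (other i) d *
    ((X (other i) - Cr (xi Rz (other i) d)) * (X (other i) - Cr (xi Rz (other i) d.+1)))).
  have -> : (2 * d)%:Z + 4 = (2 * d.+2)%:Z by rewrite -PoszD !mulnS addnC.
  by rewrite mulrA -!desc_polyS; exact: reg.
have hPd : regular_on (BS Rz w) (2 * d)%:Z (desc_poly Rz (other i) d).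
  by apply: reg; exact: ltnW (ltnW dm).
exact: (regular_off_diag hj hP hY hl (hr _) (hr _) (hr _) hD EL Eu ED Ec
  (@BS_central _) (@edeg_X _) gl (gconst _) (gconst _) (gconst _) (erefl _) hPd hPD).
Qed.
End Step.

Theorem desc_poly_regular w i d : (d <= m)%N ->
  regular_on (BS Rz w) (2 * d)%:Z (desc_poly Rz i d).
Proof.
elim: w i d => [|i0 w IH] i d dm; last first.
  have [->|->] : i = i0 \/ i = other i0 by case: i i0 {IH} => -[]; auto.
    by apply: regular_same => // d' hd; exact: IH.
  by apply: regular_other => // d' hd; exact: IH.
(* On R itself the first factor rho_i \otimes 1 - 1 \otimes rho_i acts as 0, so for d > 0 the
   operator is zero and 0 is a quasi-inverse. *)
case: d {dm} => [|d]; first by rewrite desc_poly0; exact: regular_on1.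
have [h0 _] := @right_hom_subgroups _ _ (BS Rz [::]) (BS Rz [::]) (- (2 * d.+1)%:Z).
exists (fun=> 0); split=> // x; rewrite eact0; symmetry.
rewrite /desc_poly big_ord_recl /xi /= mpolyC0 mpolyC1 mul1r mul0r subr0 mulrC eactM.
have -> : eact (X i - Cr (lrho i)) x = 0 by rewrite eactBl eact_left eact_right subrr.
by rewrite eact0.
Qed.
End BottSamelson.

(** * Ext does not depend on the resolution *)

Section Isomorphisms.
Variables (k : idomainType) (n : nat).
Implicit Types M N : grmod k n.

Lemma inj_surj_bij (S T : Type) (f : S -> T) :
  injective f -> (forall y, exists x, f x = y) -> bijective f.
Proof.
move=> fI fS; pose g y := projT1 (cid (fS y)).
have fg y : f (g y) = y by rewrite /g; case: cid.
by exists g => // x; apply: fI; rewrite fg.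
Qed.

Lemma griso_trans M N N' : griso M N -> griso N N' -> griso M N'.
Proof.
move=> [f [hf bf]] [g [hg bg]]; exists (g \o f); split; last exact: bij_comp.
by have := right_hom_comp hf hg; rewrite addr0.
Qed.

Lemma griso_shift M a b c : a + b = c -> griso (shift (shift M a) b) (shift M c).
Proof.
move=> abc; exists (fun x => x); split; last by exists (fun x => x).
by split=> // d x /= gx; rewrite addr0 -abc [a + b]addrC addrA.
Qed.

Lemma griso_dsum M N M' N' : griso M M' -> griso N N' -> griso (dsum M N) (dsum M' N').
Proof.
move=> [f [[f1 f2] [f' fK f'K]]] [g [[g1 g2] [g' gK g'K]]].
exists (fun x => (f x.1, g x.2)); split; last first.
  exists (fun x => (f' x.1, g' x.2)) => -[x y] /=; first by rewrite fK gK.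
  by rewrite f'K g'K.
split=> [r x y|d x [h1 h2]]; first by rewrite /= f1 g1.
by split; [exact: f2|exact: g2].
Qed.

(** First isomorphism theorem with conditions on homogeneous elements only: these span N, and the
    kernel of a homogeneous map is spanned by its homogeneous elements. *)
Lemma graded_quot_griso M N (b : int -> M -> Prop) (hb : is_graded_family b) (F : M -> N) :
  right_hom 0 F -> (forall d y, gr d y -> exists x, F x = y) ->
  (forall d x, gr d x -> (F x = 0 <-> b d x)) -> griso (graded_quot hb) N.
Proof.
move=> hF Fsurj Fker.
have kerF x : F x = 0 <-> gspan b x.
  have [_ _ _ hs _] := kernel_is_graded hF.
  split=> [/hs|].
    move: x; apply: gspan_ind => [|d x y [gx Fx] IH]; first exact: gspan0.
    by apply: gspanD IH; apply: (gspan1 (d := d)); apply/Fker.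
  move: x; apply: gspan_ind => [|d x y bx IH]; first exact: (right_hom0 hF).
  rewrite (right_homD hF) IH addr0; apply/(Fker d) => //; exact: gfam_sub hb _ _ bx.
pose q x := qproj (gquot_submod hb) x.
pose f (y : graded_quot hb) := F (repr y).
have fq x : f (q x) = F x.
  apply/eqP; rewrite -subr_eq0 -scaleN1r addrC -hF.1; apply/eqP/kerF.
  rewrite scaleN1r addrC; apply/(qprojP (gquot_submod hb)).
  by rewrite {1}/qproj reprK.
have qS (y : graded_quot hb) : exists x, y = q x by exact: qproj_surj.
exists f; split; last first.
  apply: inj_surj_bij => [y y'|y].
    have [x ->] := qS y; have [x' ->] := qS y'; rewrite !fq => Exx'.
    apply/qprojP/kerF; rewrite -scaleN1r addrC hF.1 Exx' scaleN1r addNr //.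
  suff [x <-] : exists x, F x = y by exists (q x).
  move: y (grading_span (gr_grading N) y); apply: gspan_ind => [|d y y' gy [x' <-]].
    by exists 0; exact: (right_hom0 hF).
  by have [x <-] := Fsurj _ _ gy; exists (x + x'); exact: (right_homD hF).
split=> [r y y'|d y [x [gx ->]]]; last by rewrite fq; exact: hF.2.
have [x ->] := qS y; have [x' ->] := qS y'.
by rewrite -qprojZ -qprojD !fq hF.1.
Qed.

End Isomorphisms.

Section Independence.
Variables (k : idomainType) (n : nat).
Local Notation R := {mpoly k[n]}.
Local Notation grbimod := (grbimod k n).

Section BimoduleKernel.
Variables (M N : grbimod) (l : int) (f : M -> N) (hf : bimod_hom l f).

Fact ker_lmul_subproof a (x : kernel hf.1) : f (lmul a (val x)) = 0.
Proof. by rewrite hf.2 (submoduleP x) lmul0r. Qed.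

Definition ker_lmul a (x : kernel hf.1) : kernel hf.1 :=
  to_submodule _ (ker_lmul_subproof a x).

Fact ker_lmul_action : is_left_action ker_lmul.
Proof.
have [h1 hM hD hL hC hd] := lmul_action M.
split=> [x|a b x|a b x|a r x y|c x|e d a x ha [gx fx]]; try apply: val_inj => /=.
- exact: h1.
- exact: hM.
- exact: hD.
- exact: hL.
- exact: hC.
- by split; [exact: hd|exact: ker_lmul_subproof].
Qed.
Definition bikernel : grbimod := Grbimod ker_lmul_action.
End BimoduleKernel.

Lemma bimod_homB (M N : grbimod) l (f g : M -> N) :
  bimod_hom l f -> bimod_hom l g -> bimod_hom l (fun x => f x - g x).
Proof.
by move=> hf hg; have [_ hB] := @bimod_hom_subgroups k n M N l; exact: hB hf hg.
Qed.

(** Projectivity lifts along surjections only, so C is cut down to ker d', onto which exactness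
    makes d surjective. *)
Lemma projective_lift (P B C D : grbimod) (d : B -> C) (d' : C -> D) (phi : P -> C) :
  projective P -> bimod_hom 0 d -> bimod_hom 0 d' -> bimod_hom 0 phi ->
  (forall x, d' x = 0 <-> exists z, d z = x) -> (forall p, d' (phi p) = 0) ->
  exists psi : P -> B, bimod_hom 0 psi /\ forall p, d (psi p) = phi p.
Proof.
move=> projP hd hd' hphi ex phi0.
have dd z : d' (d z) = 0 by apply/ex; exists z.
pose pd z : bikernel hd' := to_submodule _ (dd z).
pose pphi p : bikernel hd' := to_submodule _ (phi0 p).
have [|| |psi [hpsi Epsi]] := projP B (bikernel hd') pd pphi.
- split; first split.
  + by move=> r x y; apply: val_inj; exact: hd.1.1.
  + by move=> e x gx; split; [exact: hd.1.2|exact: dd].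
  + by move=> r x; apply: val_inj; exact: hd.2.
- split; first split.
  + by move=> r x y; apply: val_inj; exact: hphi.1.1.
  + by move=> e x gx; split; [exact: hphi.1.2|exact: phi0].
  + by move=> r x; apply: val_inj; exact: hphi.2.
- move=> y; have [z Ez] := iffLR (ex (val y)) (submoduleP y).
  by exists z; apply: val_inj.
- by exists psi; split=> // p; have := congr1 val (Epsi p).
Qed.

Variables (M : grbimod).
Implicit Types P Q : projective_resolution M.

Record chain_map P Q (phi : forall i, P i -> Q i) : Prop := ChainMap {
  chain_hom : forall i, bimod_hom 0 (phi i);
  chain_aug : forall x, res_aug (phi 0%N x) = res_aug x;
  chain_d : forall i x, res_d (phi i.+1 x) = phi i (res_d x) }.

Lemma res_dd P i (x : P i.+2) : res_d (res_d x) = 0.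
Proof. by apply/res_exact; exists x. Qed.

Lemma res_aug_d P (x : P 1%N) : res_aug (res_d x) = 0.
Proof. by apply/res_exact0; exists x. Qed.

Lemma chain_map_exists P Q : exists phi : forall i, P i -> Q i, chain_map phi.
Proof.
have [phi0 [h0 E0]] := res_projective (p := P) (i := 0%N) (res_aug_hom Q) (res_aug_hom P)
  (res_aug_surj Q).
(* A stage stores two consecutive maps with their commutation, because the next lift exists only
   thanks to the latter; successive stages share one map. *)
pose step i := {pr : (P i -> Q i) * (P i.+1 -> Q i.+1) |
  [/\ bimod_hom 0 pr.1, bimod_hom 0 pr.2 & forall x, res_d (pr.2 x) = pr.1 (res_d x)]}.
have [phi1 [h1 E1]] := projective_lift (phi := phi0 \o @res_d _ _ _ P 0%N)
  (@res_projective _ _ _ P 1%N)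
  (res_d_hom Q 0) (res_aug_hom Q) (bimod_hom_comp (res_d_hom P 0) h0)
  (@res_exact0 _ _ _ Q) (fun x => etrans (E0 _) (res_aug_d x)).
have H0 : [/\ bimod_hom 0 (phi0, phi1).1, bimod_hom 0 (phi0, phi1).2 &
  forall x, res_d ((phi0, phi1).2 x) = (phi0, phi1).1 (res_d x)] by [].
pose s0 : step 0%N := exist _ (phi0, phi1) H0.
have nx i (s : step i) : {s' : step i.+1 | (sval s').1 = (sval s).2}.
  case: s => -[f f'] [/= hf hf' E]; apply: cid.
  have z x : res_d (f' (@res_d _ _ _ P i.+1 x)) = 0.
    by rewrite E res_dd (right_hom0 hf.1).
  have [f'' [hf'' E'']] := projective_lift (phi := f' \o @res_d _ _ _ P i.+1)
    (@res_projective _ _ _ P i.+2) (res_d_hom Q i.+1) (res_d_hom Q i)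
    (bimod_hom_comp (res_d_hom P i.+1) hf') (@res_exact _ _ _ Q i) z.
  have Hs : [/\ bimod_hom 0 (f', f'').1, bimod_hom 0 (f', f'').2 &
    forall x, res_d ((f', f'').2 x) = (f', f'').1 (res_d x)] by [].
  by exists (exist _ (f', f'') Hs).
have nxE i (s : step i) : (sval (sval (nx i s))).1 = (sval s).2 by case: (nx i s).
pose st := nat_rect step s0 (fun i s => sval (nx i s)).
have stE i : (sval (st i.+1)).1 = (sval (st i)).2 by exact: nxE.
have st0 : (sval (st 0%N)).1 = phi0 by [].
exists (fun i => (sval (st i)).1); split=> [i|x|i x].
- by case: (st i) => pr [].
- by rewrite st0.
- by rewrite stE; case: (st i) => pr [].
Qed.

Lemma chain_map_comp P Q P' (phi : forall i, P i -> Q i) (psi : forall i, Q i -> P' i) :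
  chain_map phi -> chain_map psi -> chain_map (fun i => psi i \o phi i).
Proof.
move=> [u1 u2 u3] [v1 v2 v3]; split=> [j|x|j x] /=; last by rewrite v3 u3.
- by rewrite -[0](addr0 0); exact: bimod_hom_comp.
- by rewrite v2.
Qed.

Lemma chain_map_id P : chain_map (fun i (x : P i) => x).
Proof. by split=> // j; split=> //; exact: right_hom_id. Qed.

(** The homotopy equation in degree i + 1 is stated up to its unknown last term, as a cycle
    condition. Each degree then needs a single map, and no coherent family of choices has to be
    built. *)
Lemma chain_map_homotopy P Q (phi psi : forall i, P i -> Q i) :
  chain_map phi -> chain_map psi -> forall i, exists h : P i -> Q i.+1,
  bimod_hom 0 h /\ forall x, res_d (phi i.+1 x - psi i.+1 x - h (res_d x)) = 0.
Proof.
move=> hphi hpsi.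
have dB i (x y : Q i.+1) : res_d (x - y) = res_d x - res_d y.
  have [h _] := res_d_hom Q i.
  by rewrite (right_homD h) -[- y]scaleN1r (right_homZ h) scaleN1r.
elim=> [|i [h [hh Eh]]].
  have Ez x : res_aug (phi 0%N x - psi 0%N x) = 0.
    have [ha _] := res_aug_hom Q.
    rewrite (right_homD ha) -[- psi _ _]scaleN1r (right_homZ ha) scaleN1r.
    by rewrite (chain_aug hphi) (chain_aug hpsi) subrr.
  have [h [hh Eh]] := projective_lift (@res_projective _ _ _ P 0%N) (res_d_hom Q 0)
    (res_aug_hom Q) (bimod_homB (chain_hom hphi 0) (chain_hom hpsi 0)) (@res_exact0 _ _ _ Q) Ez.
  exists h; split=> // x.
  by rewrite !dB Eh (chain_d hphi) (chain_d hpsi) subrr.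
have hB := bimod_homB (bimod_homB (chain_hom hphi i.+1) (chain_hom hpsi i.+1))
  (bimod_hom_comp (res_d_hom P i) hh).
have [h' [hh' Eh']] := projective_lift (@res_projective _ _ _ P i.+1) (res_d_hom Q i.+1)
  (res_d_hom Q i) hB (@res_exact _ _ _ Q i) Eh.
exists h'; split=> // x.
have [h0 _] := hh.
by rewrite !dB Eh' /= res_dd (right_hom0 h0) subr0 (chain_d hphi) (chain_d hpsi) subrr.
Qed.

Section ExtFunctor.
Variable N : grbimod.

Lemma cocycle_pullback P Q (phi : forall i, P i -> Q i) i l (f : Q i -> N) :
  chain_map phi -> cocycle l f -> cocycle l (f \o phi i).
Proof.
move=> hphi [hf f0]; split; first by rewrite -[l]add0r; exact: bimod_hom_comp (chain_hom hphi i) hf.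
by move=> x /=; rewrite -(chain_d hphi) f0.
Qed.

Lemma coboundary_pullback P Q (phi : forall i, P i -> Q i) i l (f : Q i -> N) :
  chain_map phi -> coboundary l f -> coboundary l (f \o phi i).
Proof.
move=> hphi; case: i f => [f -> |i f [g [hg ->]]] //=.
exists (g \o phi i); split; first by rewrite -[l]add0r; exact: bimod_hom_comp (chain_hom hphi i) hg.
by apply/funext => x /=; rewrite (chain_d hphi).
Qed.

(** By exactness phi - psi - h d takes values in boundaries, which f kills, so f h is the bounding
    cochain. In degree 0 the difference phi - psi is itself a boundary. *)
Lemma homotopic_coboundary P Q (phi psi : forall i, P i -> Q i) i l (f : Q i -> N) :
  chain_map phi -> chain_map psi -> cocycle l f ->
  coboundary l (fun x => f (phi i x) - f (psi i x)).
Proof.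
move=> hphi hpsi [hf f0].
have fB x y : f (x - y) = f x - f y.
  by rewrite (right_homD hf.1) -[- y]scaleN1r (right_homZ hf.1) scaleN1r.
case: i f hf f0 fB => [|i] f hf f0 fB.
  apply/funext => x; rewrite -fB.
  have Ez : res_aug (phi 0%N x - psi 0%N x) = 0.
    have [ha _] := res_aug_hom Q.
    rewrite (right_homD ha) -[- psi _ _]scaleN1r (right_homZ ha) scaleN1r.
    by rewrite (chain_aug hphi) (chain_aug hpsi) subrr.
  by have [z <-] := iffLR (res_exact0 _) Ez; rewrite f0.
have [h [hh Eh]] := chain_map_homotopy hphi hpsi i.
exists (f \o h); split; first by rewrite -[l]add0r; exact: bimod_hom_comp hh hf.
apply/funext => x /=; rewrite -fB.
have [z Ez] := iffLR (res_exact _) (Eh x).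
by apply/eqP; rewrite -subr_eq0 -fB -Ez f0.
Qed.

Lemma graded_family_homog (M' : grmod k n) (b : int -> M' -> Prop) d x :
  is_graded_family b -> gspan b x -> gr d x -> b d x.
Proof.
move=> hb /(gspan_decomp (gfam_subgroups hb)) [s [c [us bc c0 Ex]]] gx.
have Dc : decomp (@gr _ _ M') x s c by split=> // e; exact: gfam_sub hb _ _ (bc e).
by have := gcomp_eq Dc d; rewrite (gcomp_homog d gx) eqxx => ->.
Qed.

Lemma gspan_cocycle_pullback P Q (phi : forall i, P i -> Q i) i (f : Q i -> N) :
  chain_map phi -> gspan (V := (Q i -> N) : lmodType R) (@cocycle k n M Q N i) f ->
  gspan (V := (P i -> N) : lmodType R) (@cocycle k n M P N i) (f \o phi i).
Proof.
move=> hphi; move: f; apply: gspan_ind => [|d f g hf IH]; first exact: gspan0.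
exact: gspanD (gspan1 (cocycle_pullback hphi hf)) IH.
Qed.

Theorem Ext_griso P Q i : griso (Ext P N i) (Ext Q N i).
Proof.
have [phi hphi] := chain_map_exists P Q; have [psi hpsi] := chain_map_exists Q P.
have hpull f : gspan (V := (P i -> N) : lmodType R) (@cocycle k n M P N i) f ->
    gspan (V := (Q i -> N) : lmodType R) (@cocycle k n M Q N i) (f \o psi i).
  exact: gspan_cocycle_pullback.
pose pull (f : cocycles P N i) : cocycles Q N i :=
  to_submodule _ (hpull _ (submoduleP f)).
pose hbQ := coboundaries_are_graded Q N i.
pose F (f : cocycles P N i) : Ext Q N i := qproj (gquot_submod hbQ) (pull f).
have pull_lin r f g : pull (r *: f + g) = r *: pull f + pull g.
  by apply: val_inj; apply/funext => x.
have hF : right_hom 0 F.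
  split=> [r f g|d f gf]; first by rewrite /F pull_lin qprojD qprojZ.
  by exists (pull f); split=> //; rewrite addr0; exact: cocycle_pullback.
apply: (graded_quot_griso _ hF).
  move=> d y [g [gg ->]].
  have hc := cocycle_pullback hphi gg.
  exists (to_submodule _ (gspan1 hc)).
  apply/qprojP; apply: (gspan1 (d := d)).
  exact: (homotopic_coboundary (chain_map_comp hpsi hphi) (@chain_map_id Q) gg).
move=> d f gf; split=> [|bf].
  rewrite /F -(qproj0 (gquot_submod hbQ)) => /qprojP; rewrite subr0 => hb.
  have gpf : gr d (pull f) by exact: cocycle_pullback.
  (* Pulled back along phi as well, the coboundary becomes f psi phi, which differs from f by a
     coboundary. *)
  have {hb} /(coboundary_pullback hphi) hb := graded_family_homog hbQ hb gpf.
  have hh := homotopic_coboundary (chain_map_comp hphi hpsi) (@chain_map_id P) gf.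
  have := coboundaryB hb hh.
  congr coboundary; apply/funext => x.
  rewrite /= -[LHS]/(val f (psi i (phi i x)) - (val f (psi i (phi i x)) - val f x)).
  by rewrite opprB addrCA subrr addr0.
rewrite /F -(qproj0 (gquot_submod hbQ)); apply/qprojP; rewrite subr0.
by apply: (gspan1 (d := d)); exact: coboundary_pullback.
Qed.

End ExtFunctor.
End Independence.

(** * The Koszul resolution of B_t *)

Section FreeBimodules.
Variables (k : idomainType) (n : nat).
Local Notation R := {mpoly k[n]}.
Local Notation E := {mpoly R[n]}.
Local Notation grbimod := (grbimod k n).

Section DirectSum.
Variables M N : grbimod.
Fact bidsum_action : is_left_action (M := dsum M N)
  (fun a x => (lmul a x.1, lmul a x.2)).
Proof.
have [h1 hM hD hL hC hd] := lmul_action M; have [h1' hM' hD' hL' hC' hd'] := lmul_action N.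
split=> [[x y]|a b [x y]|a b [x y]|a r [x y] [x' y']|c [x y]|e d a [x y] ha [gx gy]] /=.
- by rewrite h1 h1'.
- by rewrite hM hM'.
- by rewrite hD hD'.
- by rewrite hL hL'.
- by rewrite hC hC'.
- by split; [exact: hd|exact: hd'].
Qed.
Definition bidsum : grbimod := Grbimod bidsum_action.

Lemma projective_bidsum : projective M -> projective N -> projective bidsum.
Proof.
move=> hM hN A A' p f hp [[f1 f2] f3] psurj.
have z0 (X : grbimod) d : gr d (0 : X) by exact: gr0.
have fl : bimod_hom 0 (fun x : M => f (x, 0)).
  split; first split=> [r x y|d x gx].
  - by rewrite -f1; congr f; congr (_, _); rewrite /= ?scaler0 ?addr0.
  - by apply: f2; split=> //; exact: z0.
  - by move=> r x; rewrite -f3; congr f; congr (_, _); rewrite /= ?lmul0r.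
have fr : bimod_hom 0 (fun x : N => f (0, x)).
  split; first split=> [r x y|d x gx].
  - by rewrite -f1; congr f; congr (_, _); rewrite /= ?scaler0 ?addr0.
  - by apply: f2; split=> //; exact: z0.
  - by move=> r x; rewrite -f3; congr f; congr (_, _); rewrite /= ?lmul0r.
have [g [[[g1 g2] g3] Eg]] := hM _ _ p _ hp fl psurj.
have [h [[[h1 h2] h3] Eh]] := hN _ _ p _ hp fr psurj.
exists (fun x => g x.1 + h x.2); split.
  split; first split=> [r x y|d x [gx gy]].
  - by rewrite g1 h1 scalerDr addrACA.
  - by apply: (gsD (grading_subgroups (gr_grading A))); [exact: g2|exact: h2].
  - by move=> r x; rewrite /= g3 h3 lmulDr.
move=> x; rewrite (right_homD hp.1) Eg Eh.
have := f1 1 (x.1, 0) (0, x.2); rewrite !scale1r => <-.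
by case: x => x y; congr f; congr (_, _); rewrite /= ?addr0 ?add0r.
Qed.
End DirectSum.

(** The kernel of the identity of R, which provides a zero object with all its structure. *)
Definition zero_bimod : grbimod :=
  bikernel (conj (right_hom_id (Rbim k n)) (fun r x => erefl (lmul r x))).

Lemma zero_bimodP (x y : zero_bimod) : x = y.
Proof. by apply: val_inj; rewrite (submoduleP x) (submoduleP y). Qed.

Lemma bimod_hom0 (M N : grbimod) l : bimod_hom l (fun _ : M => 0 : N).
Proof. by have [] := @bimod_hom_subgroups k n M N l. Qed.

Lemma projective_zero : projective zero_bimod.
Proof.
move=> M N p f hp hf _; exists (fun=> 0); split; first exact: bimod_hom0.
by move=> x; rewrite (right_hom0 hp.1) (zero_bimodP x 0) (right_hom0 hf.1).
Qed.

Lemma free_hom (N : grbimod) d l (x : N) : gr d x ->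
  bimod_hom (d + l) (fun e : bishift (Ebim k n) l => eact e x).
Proof.
move=> gx; split; first split=> [r e e'|c e ge].
- by rewrite eactDl eactZl.
- have -> : c + (d + l) = d + (c + l) by rewrite addrCA.
  exact: eact_deg.
- by move=> r e; rewrite -[lmul r e]/(left_el r * (e : E)) eactM eact_left.
Qed.

Lemma free_homE (N : grbimod) d l (f : bishift (Ebim k n) l -> N) e :
  bimod_hom d f -> f e = eact e (f (1 : E)).
Proof.
move=> hf; pose u : bishift (Ebim k n) l := (1 : E).
have Ee : e = eact e u.
  by apply: etrans (esym (eact_E (e : Ebim k n) (1 : E))); rewrite mulr1.
by rewrite {1}Ee (bimod_hom_eact _ _ hf).
Qed.

Lemma edeg1 : edeg 0 (1 : E).
Proof. by rewrite -right_el1; apply: edeg_right; rewrite -mpolyC1; exact: rdegC. Qed.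

Lemma projective_free l : projective (bishift (Ebim k n) l).
Proof.
move=> M N p f hp hf psurj.
have g1 : gr (- l) (f (1 : E)).
  by rewrite -[- l]addr0; apply: hf.1.2; rewrite /= addNr; exact: edeg1.
have [x0 Ex0] := psurj (f (1 : E)).
(* The preimage [x0] need not be homogeneous; its component in the degree of the generator has the
   same image. *)
pose x := gcomp x0 (- l).
have Ex : p x = f (1 : E).
  rewrite /x -[- l]subr0 -(gcomp_map (e := 0) (f := p)).
  - by rewrite Ex0 (gcomp_homog _ g1) eqxx.
  - exact: right_homD hp.1.
  - exact: hp.1.2.
exists (fun e : bishift (Ebim k n) l => eact e x); split.
  by rewrite -[0](addNr l); apply: free_hom; exact: gcomp_gr.
by move=> e; rewrite (bimod_hom_eact _ _ hp) Ex -(free_homE _ hf).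
Qed.

End FreeBimodules.

Section Koszul.
Variables (k : idomainType) (n m : nat) (Rz : realization k n m).
Hypothesis (rank2 : Lambda_st_trivial Rz).
Local Notation R := {mpoly k[n]}.
Local Notation E := {mpoly R[n]}.
Local Notation lrho i := (linform (rho Rz i)).
Local Notation two := ((- a_st Rz)%:MP : R).
Local Notation X i := (left_el (lrho i)).
Local Notation Cr := (@right_el k n).

Definition rel_rho : E := X gen_s - Cr (lrho gen_s).

(* nu_t = rho_t t(rho_t), since t(rho_t) = - a_st rho_s - rho_t. *)
Definition nu_t : R := lrho gen_s * lrho gen_s - quad Rz.

Definition rel_nu : E := left_el nu_t - right_el nu_t.

Lemma nu_tE : nu_t = two * lrho gen_s * lrho gen_t - lrho gen_t * lrho gen_t.
Proof. by rewrite /nu_t /quad; ring. Qed.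

Lemma invariant_nu_t : Defs.invariant Rz gen_t nu_t.
Proof.
have hs := invariant_other Rz gen_t.
by apply: invariantB (invariant_quad rank2 _); exact: invariantM.
Qed.

Lemma left_nu_t : left_el nu_t = Cr two * X gen_s * X gen_t - X gen_t * X gen_t :> E.
Proof.
rewrite nu_tE left_elB [left_el (_ * lrho gen_t)]left_elM.
by rewrite [left_el (two * _)]left_elM left_elC [left_el (lrho gen_t * _)]left_elM.
Qed.

Lemma right_nu_t :
  Cr nu_t = Cr two * Cr (lrho gen_s) * Cr (lrho gen_t) - Cr (lrho gen_t) * Cr (lrho gen_t).
Proof. by rewrite nu_tE right_elB !right_elM. Qed.

Lemma rel_nuE : rel_nu = (X gen_s + Cr (lrho gen_s)) * rel_rho
   - (left_el (quad Rz) - right_el (quad Rz)).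
Proof.
rewrite /rel_nu /rel_rho left_nu_t right_nu_t (left_quad Rz gen_s) (right_quad Rz gen_s) /=.
move: (X gen_s) (X gen_t) (Cr two) (Cr _) (Cr _) => a b c d e; ring.
Qed.

Lemma var_rho j : exists c d : k, 'X_j = c%:MP * lrho gen_s + d%:MP * lrho gen_t.
Proof.
exists (pairing (coroot Rz gen_s) (delta_mx 0 j)), (pairing (coroot Rz gen_t) (delta_mx 0 j)).
by rewrite -!linformZ -linformD -(rho_span rank2) linform_delta.
Qed.

(** Modulo [rel_rho] the left rho_s moves to the right, and modulo [rel_nu] the left rho_t satisfies
    a monic quadratic equation over the right factor. *)
Lemma koszul_normal_form (e : E) : exists r0 r1 a b,
  e = Cr r0 + Cr r1 * X gen_t + a * rel_rho + b * rel_nu.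
Proof.
elim/polyE_ind: e => [r|j e [r0 [r1 [a [b ->]]]]|e e' [r0 [r1 [a [b ->]]]] [r0' [r1' [a' [b' ->]]]]].
- by exists r, 0, 0, 0; rewrite right_el0 !mul0r !addr0.
- have [c [d Ej]] := var_rho j.
  have -> : 'X_j = Cr c%:MP * X gen_s + Cr d%:MP * X gen_t :> E.
    by rewrite -left_elX Ej left_elD left_elM left_elM !left_elC.
  (* The coefficients come from reducing X_t^2 = [2] X_s X_t - [left_el nu_t]. *)
  exists (c%:MP * lrho gen_s * r0 - d%:MP * r1 * nu_t),
         (c%:MP * lrho gen_s * r1 + d%:MP * r0 + d%:MP * r1 * two * lrho gen_s).
  set x := Cr c%:MP * X gen_s + Cr d%:MP * X gen_t.
  exists (Cr c%:MP * (Cr r0 + Cr r1 * X gen_t) + x * a + Cr d%:MP * Cr r1 * Cr two * X gen_t),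
         (x * b - Cr d%:MP * Cr r1).
  rewrite right_elB !right_elD !right_elM /x /rel_rho /rel_nu left_nu_t.
  move: (X gen_s) (X gen_t) (Cr _) (Cr _) (Cr _) (Cr _) (Cr _) (Cr _) (Cr _) => *; ring.
- exists (r0 + r0'), (r1 + r1'), (a + a'), (b + b').
  rewrite !right_elD; move: (X _) (Cr _) (Cr _) (Cr _) (Cr _) rel_rho rel_nu => *; ring.
Qed.

Local Notation one := (one_B Rz gen_t).

Lemma inv_one_B a : Defs.invariant Rz gen_t a -> eact (left_el a - right_el a) one = 0.
Proof.
move=> ha; have [_ _ ub] := tens_balanced (invariant_scalars Rz gen_t) (Rbim k n) (Rbim k n).
rewrite eactBl eact_left eact_right.
have -> : lmul a one = a *: one; last by rewrite subrr.
rewrite [LHS]tlmul_tens [RHS]tscale_tens.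
transitivity (tens (invariant_scalars Rz gen_t) (a *: (1 : Rbim k n)) (1 : Rbim k n)) => //.
by rewrite ub.
Qed.

Lemma rel_rho_one : eact rel_rho one = 0.
Proof. exact: inv_one_B (invariant_other Rz gen_t). Qed.

Lemma rel_nu_one : eact rel_nu one = 0.
Proof. exact: inv_one_B invariant_nu_t. Qed.

(** The normal form of e maps to its coordinates in the right basis 1, rho_t of B_t, so r0 and r1
    vanish. *)
Lemma koszul_aug_exact (e : E) : eact e one = 0 ->
  exists a b, e = a * rel_rho + b * rel_nu.
Proof.
have [r0 [r1 [a [b ->]]]] := koszul_normal_form e.
rewrite !eactDl (eactM a) (eactM b) rel_rho_one rel_nu_one !eact0 !addr0.
rewrite eactM !eact_right eact_left => Er.
have h0 := Bcoef_hom (@coef0D _ _ _ Rz gen_t) (@coef0M _ _ _ Rz gen_t) (@coef0_deg0 _ _ _ Rz gen_t).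
have h1 := Bcoef_hom (@coef1D _ _ _ Rz gen_t) (@coef1M _ _ _ Rz gen_t) (@coef1_deg _ _ _ Rz gen_t).
have [l0 l1] := coef_rho_one_B Rz gen_t.
have E0 : r0 * Bcoef (coef0 Rz gen_t) one + r1 * Bcoef (coef0 Rz gen_t) (lmul (lrho gen_t) one) = 0.
  apply: etrans (right_hom0 h0); rewrite -Er [RHS]h0.1; congr (_ + _).
  by rewrite [RHS](right_homZ h0).
have E1 : r0 * Bcoef (coef1 Rz gen_t) one + r1 * Bcoef (coef1 Rz gen_t) (lmul (lrho gen_t) one) = 0.
  apply: etrans (right_hom0 h1); rewrite -Er [RHS]h1.1; congr (_ + _).
  by rewrite [RHS](right_homZ h1).
rewrite l0 coef0_one_B mulr0 addr0 mulr1 in E0.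
rewrite l1 coef1_one_B mulr0 add0r mulr1 in E1.
exists a, b; rewrite E0 E1.
by rewrite right_el0 mul0r !add0r.
Qed.

Definition kill_var j : E :=
  Cr ((pairing (coroot Rz gen_s) (delta_mx 0 j))%:MP * lrho gen_s) +
  Cr (pairing (coroot Rz gen_t) (delta_mx 0 j))%:MP * X gen_t.

(* The right R-algebra endomorphism of R^e fixing rho_t \otimes 1 and mapping
   rho_s \otimes 1 to 1 \otimes rho_s; its kernel is generated by rel_rho, so
   rel_rho, rel_nu is a regular sequence as soon as kill_rho rel_nu != 0. *)
Definition kill_rho : E -> E := mmap (@mpolyC n R) kill_var.

Lemma kill_rhoD e e' : kill_rho (e + e') = kill_rho e + kill_rho e'.
Proof. exact: rmorphD. Qed.
Lemma kill_rhoM e e' : kill_rho (e * e') = kill_rho e * kill_rho e'.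
Proof. exact: rmorphM. Qed.
Lemma kill_rhoN e : kill_rho (- e) = - kill_rho e.
Proof. exact: rmorphN. Qed.
Lemma kill_rhoC r : kill_rho (Cr r) = Cr r.
Proof. exact: mmapC. Qed.
Lemma kill_rhoX j : kill_rho 'X_j = kill_var j.
Proof. by rewrite /kill_rho mmapX mmap1U. Qed.

Lemma var_kill j : exists c : k, 'X_j - kill_var j = Cr c%:MP * rel_rho.
Proof.
exists (pairing (coroot Rz gen_s) (delta_mx 0 j)).
have -> : 'X_j = left_el (linform (delta_mx 0 j)) :> E by rewrite linform_delta left_elX.
rewrite {1}[delta_mx 0 j](rho_span rank2) linformD !linformZ left_elD 2!left_elM !left_elC.
rewrite /kill_var /rel_rho right_elM.
move: (X _) (X _) (Cr _) (Cr _) (Cr _) => *; ring.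
Qed.

Lemma kill_rho_cong e : exists c, e - kill_rho e = c * rel_rho.
Proof.
elim/polyE_ind: e => [r|j e [c Ec]|e e' [c Ec] [c' Ec']].
- by exists 0; rewrite kill_rhoC subrr mul0r.
- have [d Ed] := var_kill j.
  exists ('X_j * c + Cr d%:MP * kill_rho e); rewrite kill_rhoM kill_rhoX.
  transitivity ('X_j * (e - kill_rho e) + ('X_j - kill_var j) * kill_rho e); first by ring.
  by rewrite Ec Ed; ring.
- have comb (S : comNzRingType) (a a' b b' d d' r : S) : a - b = d * r -> a' - b' = d' * r ->
      a + a' - (b + b') = (d + d') * r by move=> h h'; rewrite mulrDl -h -h'; ring.
  by exists (c + c'); rewrite kill_rhoD; exact: comb Ec Ec'.
Qed.

Lemma kill_linform lam : kill_rho (left_el (linform lam)) =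
  Cr ((pairing (coroot Rz gen_s) lam)%:MP * lrho gen_s) +
  Cr (pairing (coroot Rz gen_t) lam)%:MP * X gen_t.
Proof.
have comb (S : comNzRingType) (a b c d e r : S) :
    a * r + b * e + (c * r + d * e) = (a + c) * r + (b + d) * e by ring.
rewrite right_elM {1}[lam]row_sum_delta [in RHS](row_sum_delta lam).
apply: (big_ind (fun mu : 'rV[k]_n => kill_rho (left_el (linform mu)) =
  Cr (pairing (coroot Rz gen_s) mu)%:MP * Cr (lrho gen_s) +
  Cr (pairing (coroot Rz gen_t) mu)%:MP * X gen_t)) => [|mu mu' h h'|j _].
- by rewrite linform0 left_el0 !pairing0 mpolyC0 right_el0 !mul0r addr0; exact: rmorph0.
- have Ek : kill_rho (left_el (linform (mu + mu'))) =
      kill_rho (left_el (linform mu)) + kill_rho (left_el (linform mu')).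
    by rewrite linformD left_elD kill_rhoD.
  have Ep v : Cr (pairing v (mu + mu'))%:MP = Cr (pairing v mu)%:MP + Cr (pairing v mu')%:MP.
    by rewrite pairingD mpolyCD right_elD.
  rewrite Ek !Ep; apply: etrans (congr2 +%R h h') _; exact: comb.
- have Ep v : Cr (pairing v (lam 0 j *: delta_mx 0 j : 'rV[k]_n))%:MP =
      Cr (lam 0 j)%:MP * Cr (pairing v (delta_mx 0 j : 'rV[k]_n))%:MP.
    by rewrite pairingZ mpolyCM right_elM.
  have distr (S : comNzRingType) (a b c d e : S) : a * (b * d + c * e) = a * b * d + a * c * e.
    by ring.
  rewrite !Ep linformZ linform_delta left_elM left_elC left_elX (kill_rhoM (Cr _)).
  rewrite kill_rhoC kill_rhoX /kill_var right_elM; exact: distr.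
Qed.

Lemma kill_left i : kill_rho (X i) = if i is gen_s then Cr (lrho gen_s) else X gen_t.
Proof.
rewrite kill_linform; case: i; rewrite ?rho_ss ?rho_tt ?rho_st ?rho_ts.
- by rewrite mpolyC1 mpolyC0 mul1r right_el0 mul0r addr0.
- by rewrite mpolyC1 mpolyC0 mul0r right_el0 right_el1 mul1r add0r.
Qed.

(** Equality would kill the linear part of X i, hence rho_i, which pairs to 1 with its coroot. *)
Lemma X_sub_neq0 i r : X i - Cr r != 0.
Proof.
apply/negP; rewrite subr_eq0 => /eqP Er.
have : rho Rz i = 0.
  apply/rowP => j; rewrite mxE.
  have := congr1 (mcoeff U_(j)) Er.
  have -> : (Cr r)@_U_(j) = 0.
    by rewrite mcoeffC; case: eqP => [/(congr1 mdeg)|_]; rewrite ?mdeg1 ?mdeg0 ?mulr0.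
  rewrite mcoeff_map_mpoly => /eqP; rewrite /= mpolyC_eq0 => /eqP <-.
  rewrite raddf_sum /= (bigD1 j) //= big1 ?addr0 => [|j' ne].
    by rewrite mcoeffZ mcoeffXU eqxx mulr1.
  by rewrite mcoeffZ mcoeffXU (negPf ne) mulr0.
move=> h; have := rho_pairing Rz i.
by rewrite h pairing0 => /esym/eqP; rewrite oner_eq0.
Qed.

Lemma rel_rho_neq0 : rel_rho != 0.
Proof. exact: X_sub_neq0. Qed.

(** [kill_rho] sends [rel_nu] to -(X_t - rho_t)(X_t - t(rho_t)), nonzero in a domain, so it kills b;
    hence b is a multiple of [rel_rho], which can then be cancelled. *)
Lemma koszul_exact a b : a * rel_rho + b * rel_nu = 0 ->
  exists c, a = c * rel_nu /\ b = - (c * rel_rho).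
Proof.
move=> Eab.
have kr : kill_rho rel_rho = 0.
  by rewrite /rel_rho kill_rhoD kill_rhoN kill_rhoC kill_left subrr.
have kn : kill_rho rel_nu =
    (X gen_t - Cr (lrho gen_t)) * - (X gen_t - Cr (two * lrho gen_s - lrho gen_t)).
  have morph (S : comNzRingType) (h : S -> S) (w x y y' x0 y0 : S) :
      {morph h : u v / u + v} -> {morph h : u / - u} -> {morph h : u v / u * v} ->
      h w = w -> h x = x0 -> h y = y -> h y' = y' -> h x0 = x0 -> y0 = w * x0 - y' ->
      h (w * x * y - y * y - (w * x0 * y' - y' * y')) = (y - y') * - (y - y0).
    move=> hD hN hM hw hx hy hy' hx0 ->.
    by rewrite !(hD, hN, hM) hw hx hy hy' hx0; ring.
  rewrite /rel_nu left_nu_t right_nu_t.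
  apply: (morph _ _ _ _ _ _ _ _ kill_rhoD kill_rhoN kill_rhoM (kill_rhoC _) (kill_left gen_s)
    (kill_left gen_t) (kill_rhoC _) (kill_rhoC _)).
  by rewrite (right_elB (two * lrho gen_s)) (right_elM two).
have kb : kill_rho b = 0.
  have k0 : kill_rho 0 = 0 by exact: rmorph0.
  have Ek : kill_rho (a * rel_rho + b * rel_nu) =
      kill_rho a * kill_rho rel_rho + kill_rho b * kill_rho rel_nu.
    by rewrite kill_rhoD (kill_rhoM a) (kill_rhoM b).
  have zero (S : idomainType) (p q z w : S) : 0 = p * 0 + z * (q * - w) ->
      q != 0 -> w != 0 -> z = 0.
    move=> h q0 w0; apply/eqP; move: h; rewrite mulr0 add0r => /esym/eqP.
    by rewrite !mulf_eq0 oppr_eq0 (negPf q0) (negPf w0) !orbF.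
  rewrite Eab k0 kr kn in Ek.
  exact: zero Ek (X_sub_neq0 _ _) (X_sub_neq0 _ _).
have [c Ec] := kill_rho_cong b; rewrite kb subr0 in Ec.
have cancel (S : idomainType) (p q z r w : S) : p * r + q * w = 0 -> q = z * r -> r != 0 ->
    p = - z * w /\ q = - (- z * r).
  move=> h Eq r0; split; last by rewrite Eq mulNr opprK.
  by apply: (mulIf r0); apply/eqP; rewrite -subr_eq0 -h Eq; apply/eqP; ring.
by exists (- c); exact: cancel Eab Ec rel_rho_neq0.
Qed.

Local Notation Ebim := (Ebim k n).
Local Notation K0 := (bishift Ebim 1).
Local Notation K1 := (bidsum (bishift Ebim (-1)) (bishift Ebim (-3))).
Local Notation K2 := (bishift Ebim (-5)).

(** After the overall shift by 1 the generators lie in degrees -1, then 1 and 3, then 5, since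
    [rel_rho] and [rel_nu] have degrees 2 and 4. *)
Definition koszul_obj (i : nat) : grbimod k n :=
  match i with 0%N => K0 | 1%N => K1 | 2%N => K2 | _ => zero_bimod k n end.

Definition koszul_aug (e : koszul_obj 0) : B Rz gen_t := eact (e : E) one.

Definition koszul_d0 (x : K1) : K0 := (x.1 : E) * rel_rho + (x.2 : E) * rel_nu.
Definition koszul_d1 (e : K2) : K1 := ((e : E) * rel_nu, - ((e : E) * rel_rho)).

Definition koszul_d (i : nat) : koszul_obj i.+1 -> koszul_obj i :=
  match i with
  | 0%N => koszul_d0 | 1%N => koszul_d1 | _ => fun=> 0 end.

Lemma edeg_rel_rho : edeg 2 rel_rho.
Proof. by apply: edegB; [apply: edeg_left|apply: edeg_right]; exact: linform_deg. Qed.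

Lemma nu_t_deg : rdeg 4 nu_t.
Proof.
rewrite nu_tE; apply: (gsB (V := R^o) (@rdeg_subgroups k n)).
  rewrite -mulrA; exact: (rdegM (@rdegC k n _) (rdegM (@linform_deg k n _) (@linform_deg k n _))).
exact: (rdegM (@linform_deg k n _) (@linform_deg k n _)).
Qed.

Lemma edeg_rel_nu : edeg 4 rel_nu.
Proof. by apply: edegB; [apply: edeg_left|apply: edeg_right]; exact: nu_t_deg. Qed.

Lemma one_B_deg : gr (-1) one.
Proof.
exists [:: (1, 1)]; rewrite big_seq1; split=> // p; rewrite inE => /eqP -> /=.
by exists 0; split; rewrite -mpolyC1; exact: rdegC.
Qed.

Lemma koszul_d0_hom : bimod_hom 0 koszul_d0.
Proof.
split; first split=> [r x y|d x [g1 g2]].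
- have comb (S : comNzRingType) (q a b c d e f : S) :
    (q * a + b) * e + (q * c + d) * f = q * (a * e + c * f) + (b * e + d * f) by ring.
  rewrite -[RHS]/(r *: ((x.1 : E) * rel_rho + (x.2 : E) * rel_nu) + koszul_d0 y).
  rewrite -[r *: _ in RHS]right_el_scale /koszul_d0.
  rewrite -[(r *: x + y).1]/(r *: (x.1 : E) + (y.1 : E)) -[(r *: x + y).2]/(r *: (x.2 : E) + (y.2 : E)).
  rewrite -!right_el_scale; exact: comb.
- rewrite addr0; apply: edegD.
    by have := edegM g1 edeg_rel_rho; congr edeg; ring.
  by have := edegM g2 edeg_rel_nu; congr edeg; ring.
- move=> r x; rewrite /koszul_d0.
  rewrite -[LHS]/(left_el r * (x.1 : E) * rel_rho + left_el r * (x.2 : E) * rel_nu).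
  by rewrite -!mulrA -mulrDr.
Qed.

Lemma koszul_d1_hom : bimod_hom 0 koszul_d1.
Proof.
split; first split=> [r x y|d x g].
- congr (_, _).
    rewrite -[(r *: x + y) * _]/((r *: (x : E) + (y : E)) * rel_nu).
    apply: etrans (mulrDl _ _ _) _; congr (_ + _); exact: esym (scalerAl _ _ _).
  rewrite -[(r *: x + y) * _]/((r *: (x : E) + (y : E)) * rel_rho).
  apply: etrans (congr1 -%R (mulrDl _ _ _)) _; apply: etrans (opprD _ _) _; congr (_ + _).
  by apply: etrans (congr1 -%R (esym (scalerAl _ _ _))) _; exact: esym (scalerN _ _).
- rewrite addr0; split.
    by have := edegM g edeg_rel_nu; congr edeg; ring.
  by apply: edegN; have := edegM g edeg_rel_rho; congr edeg; ring.
- move=> r x; congr (_, _); first by rewrite -[lmul r x]/(left_el r * (x : E)) -mulrA.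
  by rewrite -[lmul r x]/(left_el r * (x : E)) -mulrA -mulrN.
Qed.

Lemma koszul_d_hom i : bimod_hom 0 (@koszul_d i).
Proof.
case: i => [|[|i]]; [exact: koszul_d0_hom|exact: koszul_d1_hom|exact: bimod_hom0].
Qed.

Lemma koszul_aug_hom : bimod_hom 0 koszul_aug.
Proof. by have := free_hom 1 one_B_deg; rewrite addNr. Qed.

Lemma koszul_projective i : projective (koszul_obj i).
Proof.
case: i => [|[|[|i]]]; try exact: projective_free; last exact: projective_zero.
by apply: projective_bidsum; exact: projective_free.
Qed.

Lemma koszul_aug_surj y : exists x, koszul_aug x = y.
Proof.
rewrite (B_split y); exists (Cr (Bcoef (coef0 Rz gen_t) y) + Cr (Bcoef (coef1 Rz gen_t) y) * X gen_t).
by rewrite /koszul_aug eactDl eactM !eact_right eact_left.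
Qed.

Lemma koszul_res_exact0 x : koszul_aug x = 0 <-> exists z, @koszul_d 0 z = x.
Proof.
split=> [/koszul_aug_exact[a [b Ex]]|[z <-]]; first by exists (a, b).
rewrite /koszul_aug /= /koszul_d0 eactDl !(eactM z.1) !(eactM z.2).
by rewrite rel_rho_one rel_nu_one !eact0 addr0.
Qed.

Lemma koszul_res_exact i x : @koszul_d i x = 0 <-> exists z, @koszul_d i.+1 z = x.
Proof.
case: i x => [|[|i]] x.
- split=> [/koszul_exact[c [E1 E2]]|[z <-]]; first by exists c; rewrite [x]surjective_pairing E1 E2.
  rewrite /= /koszul_d0 /koszul_d1 /=; move: (z : E) rel_rho rel_nu => *; ring.
- split=> [Ex|[z <-]]; last first.
    by rewrite /= /koszul_d1; congr (_, _); rewrite mul0r ?oppr0.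
  exists 0; symmetry; have := congr1 snd Ex => /= /eqP.
  by rewrite oppr_eq0 mulf_eq0 (negPf rel_rho_neq0) orbF => /eqP.
- split=> _; last by [].
  by exists 0; exact: zero_bimodP.
Qed.

Definition koszul_resolution : projective_resolution (B Rz gen_t) :=
  ProjectiveResolution (res_obj := koszul_obj) (res_d := koszul_d) koszul_projective
    koszul_aug_hom koszul_d_hom koszul_aug_surj koszul_res_exact0 koszul_res_exact.

End Koszul.

(** * Kernel, cokernel and duality *)

Section CokernelDual.
Variables (k : idomainType) (n : nat) (M : grbimod k n).
Local Notation R := {mpoly k[n]}.
Variables (b : M -> M -> R) (hb : perfect_pairing b).
Variables (l : int) (f : M -> M) (hf : right_hom l f).
Hypothesis f_adj : forall x y, b (f x) y = b x (f y).
Local Notation K := (kernel hf).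

Lemma pair_right_hom d x : gr d x -> right_hom (N := Rmod k n) d (b x).
Proof.
move=> gx; split=> [r y z|e y gy]; first by rewrite (pairDr hb) (pairZr hb).
by rewrite addrC; exact: (pair_deg hb).
Qed.

Lemma pair_kernel_hom d x : gr d x ->
  right_hom (N := Rmod k n) d (fun y : K => b x (val y)).
Proof.
move=> /pair_right_hom [h1 h2]; split=> [r y z|e y [gy _]]; last exact: h2.
by rewrite linearD linearZ; exact: h1.
Qed.

(** The graded dual contains only finite sums of homogeneous functionals; these come from the
    components of x. *)
Fact pair_kernel_span x : gspan (V := (K -> Rmod k n) : lmodType R)
  (@right_hom k n K (Rmod k n)) (fun y : K => b x (val y)).
Proof.
move: x (grading_span (gr_grading M) x); apply: gspan_ind => [|d x y gx IH].
  rewrite (_ : (fun y : K => b 0 (val y)) = 0); first exact: gspan0.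
  by apply/funext => y; rewrite (pair0l hb).
rewrite (_ : (fun z : K => b (x + y) (val z)) =
  (fun z : K => b x (val z)) + (fun z : K => b y (val z)) :> (K -> R)).
  by apply: gspanD IH; exact: gspan1 (pair_kernel_hom gx).
by apply/funext => z; rewrite (pairDl hb).
Qed.

Definition to_dual (x : M) : dual K :=
  to_submodule (gsub_mod (right_hom_is_graded K (Rmod k n))) (pair_kernel_span x).

Lemma to_dual_hom : right_hom 0 to_dual.
Proof.
split=> [r x y|d x gx]; last by rewrite addr0; exact: pair_kernel_hom.
by apply: val_inj; apply/funext => z; exact: (pair_linear hb).
Qed.

Lemma to_dual_eq0 x : to_dual x = 0 <-> forall y : K, b x (val y) = 0.
Proof.
split=> [E y|E]; first exact: (congr1 (fun h => val h y) E).
by apply: val_inj; apply/funext => y; exact: E.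
Qed.

Variables (g : M -> M) (hg : right_hom (- l) g) (fgf : forall x, f (g (f x)) = f x).

(** The projection z - g(f z) onto the kernel extends phi to all of M, where the pairing represents
    it. *)
Lemma to_dual_surj d phi : gr d phi -> exists x, gr d x /\ to_dual x = phi.
Proof.
move=> hphi.
have pK z : f (z - g (f z)) = 0.
  by rewrite (right_homD hf) -scaleN1r (right_homZ hf) scaleN1r fgf subrr.
pose p z : K := to_submodule _ (pK z).
have hp : right_hom 0 p.
  split=> [r x y|e x gx].
    apply: val_inj; rewrite /= hf.1 hg.1.
    rewrite -[RHS]/(r *: (x - g (f x)) + (y - g (f y))).
    by rewrite scalerBr opprD addrACA.
  split; last exact: pK.
  apply: (gsB (grading_subgroups (gr_grading M))); rewrite addr0 //.
  by rewrite -[e](addrK l); apply: hg.2; exact: hf.2.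
have [x [gx Ex]] := pair_repr hb (right_hom_comp hp hphi).
exists x; split; first by rewrite -[d]add0r.
apply: val_inj; apply/funext => y.
rewrite -[LHS]/(b x (val y)) -Ex; congr (val phi _); apply: val_inj.
by rewrite /= (submoduleP y) (right_hom0 hg) subr0.
Qed.

(** If b(x, -) vanishes on ker f, then b(x, z) = b(x, g(f z)). The functional b(x, g -) is
    represented by some y, and self-adjointness turns b(y, f z) into b(f y, z), so x = f y. *)
Lemma to_dual_ker d x : gr d x ->
  (to_dual x = 0 <-> exists y, gr (d - l) y /\ f y = x).
Proof.
move=> gx; split=> [/to_dual_eq0 x0|[y [_ <-]]]; last first.
  by apply/to_dual_eq0 => z; rewrite f_adj (submoduleP z) (pair0r hb).
have hpsi := right_hom_comp hg (pair_right_hom gx).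
have [y [gy Ey]] := pair_repr hb hpsi.
exists y; split; first by rewrite addrC.
apply/eqP; rewrite -subr_eq0; apply/eqP; apply: (pair_nondeg hb) => z.
have pK : f (z - g (f z)) = 0.
  by rewrite (right_homD hf) -scaleN1r (right_homZ hf) scaleN1r fgf subrr.
have := x0 (to_submodule _ pK); rewrite /= -scaleN1r (pairDr hb) (pairZr hb) mulN1r => Ez.
rewrite (pairBl hb) f_adj -Ey -[RHS]oppr0 -Ez; ring.
Qed.

End CokernelDual.

Lemma gr_eq (k : idomainType) (n : nat) (M : grmod k n) d d' (x : M) :
  d = d' -> gr d x -> gr d' x.
Proof. by move=> ->. Qed.

(** * Cohomology of the Koszul complex with values in BS(w) *)

Section KoszulExt.
Variables (k : idomainType) (n m : nat) (Rz : realization k n m).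
Hypotheses (rank2 : Lambda_st_trivial Rz) (m_ge2 : (2 <= m)%N).
Variable (w : seq gen).
Local Notation R := {mpoly k[n]}.
Local Notation E := {mpoly R[n]}.
Local Notation N := (BS Rz w).
Local Notation K := (ker_rho_s_e Rz w).
Local Notation Q := (koszul_resolution rank2).
Local Notation rr := (rel_rho Rz).
Local Notation rn := (rel_nu Rz).
Local Notation lrho i := (linform (rho Rz i)).
Local Notation rse := (@rho_s_e k n m Rz w).
Local Notation hh := (left_el (lrho gen_s) + right_el (lrho gen_s) : E).

Lemma rho_s_eE (x : N) : rse x = eact rr x.
Proof. by rewrite /rel_rho eactBl eact_left eact_right. Qed.

Lemma rel_nu_act (x : N) : eact rn x = eact hh (eact rr x).
Proof. by rewrite rel_nuE eactBl (BS_central rank2) subr0 eactM. Qed.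

Lemma rel_comm (e e' : E) (x : N) : eact e (eact e' x) = eact e' (eact e x).
Proof. by rewrite -(eactM e) mulrC eactM. Qed.

Lemma edeg_hh : edeg 2 hh.
Proof. by apply: edegD; [apply: edeg_left|apply: edeg_right]; exact: linform_deg. Qed.

Lemma rho_s_e_regular : exists g : N -> N, right_hom (- 2) g /\
  forall x, rse (g (rse x)) = rse x.
Proof.
have [g [hg Hg]] := desc_poly_regular rank2 m_ge2 w gen_s (ltnW m_ge2).
exists g; split=> // x; rewrite !rho_s_eE; have := Hg x.
by rewrite desc_poly1.
Qed.

Lemma koszul1_hom d (x y : N) : gr (d + 1) x -> gr (d + 3) y ->
  bimod_hom d (fun e : Q 1%N => eact (e.1 : E) x + eact (e.2 : E) y).
Proof.
move=> gx gy.
have [[a1 a2] a3] : bimod_hom d (fun e : bishift (Ebim k n) (-1) => eact e x).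
  by have := free_hom (-1) gx; rewrite addrK.
have [[b1 b2] b3] : bimod_hom d (fun e : bishift (Ebim k n) (-3) => eact e y).
  by have := free_hom (-3) gy; rewrite addrK.
split; first split=> [r e e'|c e [g1 g2]].
- by rewrite [eact _ x]a1 [eact _ y]b1 scalerDr addrACA.
- by apply: (gsD (grading_subgroups (gr_grading N))); [exact: a2|exact: b2].
- by move=> r e; rewrite [eact _ x]a3 [eact _ y]b3 lmulDr.
Qed.

Lemma koszul1_homE d (f : Q 1%N -> N) e : bimod_hom d f ->
  f e = eact (e.1 : E) (f ((1 : E), (0 : E))) + eact (e.2 : E) (f ((0 : E), (1 : E))).
Proof.
move=> hf.
have h1 : bimod_hom d (fun e : bishift (Ebim k n) (-1) => f ((e : E), (0 : E))).
  split; first split=> [r x y|c x gx].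
  - by rewrite -hf.1.1; congr f; congr (_, _); rewrite /= ?scaler0 ?addr0.
  - by apply: hf.1.2; split=> //; exact: gr0.
  - by move=> r x; rewrite -hf.2; congr f; congr (_, _); rewrite /= ?mulr0.
have h2 : bimod_hom d (fun e : bishift (Ebim k n) (-3) => f ((0 : E), (e : E))).
  split; first split=> [r x y|c x gx].
  - by rewrite -hf.1.1; congr f; congr (_, _); rewrite /= ?scaler0 ?addr0.
  - by apply: hf.1.2; split=> //; exact: gr0.
  - by move=> r x; rewrite -hf.2; congr f; congr (_, _); rewrite /= ?mulr0.
rewrite -(free_homE e.1 h1) -(free_homE e.2 h2) -(right_homD hf.1); congr f.
by case: e => e1 e2; congr (_, _); rewrite /= ?addr0 ?add0r.
Qed.

Lemma koszul0_value (f : cocycles Q N 0) : rse (val f (1 : E)) = 0.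
Proof.
rewrite rho_s_eE; move: (submoduleP f); move: (val f) => {}f.
move: f; apply: gspan_ind => [|d f f' [hf f0] IH]; first exact: eact0.
rewrite eactDr IH addr0; have := f0 ((1 : E), (0 : E)).
rewrite /= /koszul_d0 /= mul0r addr0 mul1r => <-.
exact: esym (free_homE _ hf).
Qed.

Theorem Ext0_koszul : griso (Ext Q N 0) (shift (at_gen K ul_one) (-1)).
Proof.
pose F (f : cocycles Q N 0) : shift (at_gen K ul_one) (-1) :=
  to_submodule (gsub_mod (kernel_is_graded (rho_s_e_hom Rz w))) (koszul0_value f).
have hF : right_hom 0 F.
  split=> [r f f'|d f gf]; first by apply: val_inj.
  split; last exact: koszul0_value.
  have -> : d + 0 + -1 + koszul_deg ul_one = -1 + d by rewrite /=; ring.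
  by apply: gf.1.1.2; exact: edeg1.
apply: (graded_quot_griso _ hF).
  move=> d x [gx x0].
  have gx' : gr (d + -1) (val x) by rewrite -[d + -1]addr0.
  have hf := free_hom 1 gx'; rewrite subrK in hf.
  have f0 (e : Q 1%N) : eact (res_d e : E) (val x) = 0.
    rewrite /= /koszul_d0 eactDl (eactM e.1) (eactM e.2) rel_nu_act -rho_s_eE x0.
    by rewrite !eact0 addr0.
  exists (to_submodule (gsub_mod (cocycles_are_graded Q N 0)) (gspan1 (conj hf f0))).
  by apply: val_inj; exact: eact1.
move=> d f gf; split=> [E0|E0]; last first.
  by apply: val_inj; rewrite /= [val f]E0.
have Ef := congr1 val E0.
by apply/funext => e; rewrite (free_homE e gf.1) [val f _]Ef eact0.
Qed.

(** For the values x, y on the two generators the cocycle condition reads [rel_nu] x = [rel_rho] y.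
    As [rel_nu] acts as [hh] after [rel_rho], the combination y - hh x lies in the kernel while x is
    free. *)
Lemma koszul1_value (f : cocycles Q N 1) :
  rse (val f ((0 : E), (1 : E)) - eact hh (val f ((1 : E), (0 : E)))) = 0.
Proof.
pose u1 : Q 1%N := ((1 : E), (0 : E)); pose u2 : Q 1%N := ((0 : E), (1 : E)).
pose ev (h : Q 1%N -> N) := eact rr (h u2 - eact hh (h u1)).
have evD (h h' : Q 1%N -> N) : ev (fun x => h x + h' x) = ev h + ev h'.
  by rewrite /ev /= (eactDr hh) opprD addrACA [LHS]eactDr.
rewrite rho_s_eE -[LHS]/(ev (val f)); move: (submoduleP f); move: (val f) => {}f.
move: f; apply: gspan_ind => [|d f f' [hf f0] IH].
  by rewrite /ev -[X in X - _]/(0 : N) -[X in eact hh X]/(0 : N) eact0 subr0 eact0.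
rewrite -[f + f']/(fun x => f x + f' x) evD IH addr0.
have := f0 (1 : E); rewrite (koszul1_homE _ hf) /= !mul1r eactNl rel_nu_act => f1.
by rewrite /ev eactBr (rel_comm rr hh) -opprB f1 oppr0.
Qed.

Section Pairing.
Variables (b : N -> N -> R) (hb : perfect_pairing b).
Variables (g : N -> N) (hg : right_hom (- 2) g) (fgf : forall x, rse (g (rse x)) = rse x).
Local Notation dl := (to_dual hb (rho_s_e_hom Rz w)).

Lemma rho_s_e_adj x y : b (rse x) y = b x (rse y).
Proof.
rewrite /rho_s_e (pairBl hb) (pair_lmul hb) (pairZl hb) (pair_sym hb x (_ - _)).
by rewrite (pairBl hb) (pairZl hb) ![b _ x](pair_sym hb).
Qed.

Lemma Ext1_pairing : griso (Ext Q N 1)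
  (dsum (shift (at_gen K ul_rho_t_t_rho_t) (-1)) (shift (at_gen (tilde (dual K)) ul_rho_s) (-1))).
Proof.
pose F (f : cocycles Q N 1) :
    dsum (shift (at_gen K ul_rho_t_t_rho_t) (-1)) (shift (at_gen (tilde (dual K)) ul_rho_s) (-1)) :=
  (to_submodule (gsub_mod (kernel_is_graded (rho_s_e_hom Rz w))) (koszul1_value f),
   dl (val f ((1 : E), (0 : E)))).
have hdl := to_dual_hom hb (rho_s_e_hom Rz w).
have g0 : forall d, edeg d (0 : E) by move=> d; exact: gs0 (grading_subgroups (@edeg_grading k n)) d.
have hF : right_hom 0 F.
  split=> [r f f'|d f gf].
    congr (_, _); last exact: hdl.1.
    apply: val_inj; rewrite /=.
    rewrite -[LHS]/(r *: val f ((0 : E), (1 : E)) + val f' ((0 : E), (1 : E))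
      - eact hh (r *: val f ((1 : E), (0 : E)) + val f' ((1 : E), (0 : E)))).
    rewrite eact_linear opprD addrACA -scalerBr.
    by [].
  have g1 : gr (1 + d) (val f ((1 : E), (0 : E))).
    by apply: gf.1.1.2; split; [exact: edeg1|exact: g0].
  have g3 : gr (3 + d) (val f ((0 : E), (1 : E))).
    by apply: gf.1.1.2; split; [exact: g0|exact: edeg1].
  split; last by refine (@gr_eq k n (dual K) _ _ _ _ (hdl.2 _ _ g1)); rewrite /=; ring.
  split; last exact: koszul1_value.
  refine (@gr_eq k n N (3 + d) _ _ _ _); first by rewrite /=; ring.
  apply: (gsB (grading_subgroups (gr_grading N))); first exact: g3.
  by refine (@gr_eq k n N _ _ _ _ (eact_deg edeg_hh g1)); ring.
apply: (graded_quot_griso _ hF).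
  move=> d [kap phi] [[gk k0] gphi].
  have {}k0 : eact rr (val kap : N) = 0 by rewrite -rho_s_eE; exact: k0.
  have {}gphi : gr (d + 1) (phi : dual K).
    by refine (@gr_eq k n (dual K) _ _ _ _ gphi); rewrite /=; ring.
  have {}gk : gr (d + 3) (val kap).
    by refine (@gr_eq k n N _ _ _ _ gk); rewrite /=; ring.
  have [x [gx Ex]] := to_dual_surj hb (hf := rho_s_e_hom Rz w) hg fgf gphi.
  (* The lift of a class of the cokernel to a cocycle: x on the first generator forces the
     correction hh x on the second. *)
  have gy : gr (d + 3) (val kap + eact hh x).
    apply: (gsD (grading_subgroups (gr_grading N))) => //.
    by refine (@gr_eq k n N _ _ _ _ (eact_deg edeg_hh gx)); ring.
  have hf := koszul1_hom gx gy.
  have f0 (e : Q 2%N) : eact ((res_d e).1 : E) x + eact ((res_d e).2 : E) (val kap + eact hh x) = 0.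
    rewrite /= eactNl !(eactM (e : E)) rel_nu_act -eactBr (eactDr rr) k0 add0r.
    by rewrite (rel_comm rr hh) subrr eact0.
  exists (to_submodule (gsub_mod (cocycles_are_graded Q N 1)) (gspan1 (conj hf f0))).
  congr (_, _).
    apply: val_inj; rewrite /= !eact1 !eact0l add0r addr0.
    by rewrite addrK.
  by rewrite /= eact1 eact0l addr0.
move=> d f gf.
have g1 : gr (d + 1) (val f ((1 : E), (0 : E))).
  by rewrite addrC; apply: gf.1.1.2; split; [exact: edeg1|exact: g0].
split=> [E0|[psi [hpsi Epsi]]].
  have Ey : val f ((0 : E), (1 : E)) = eact hh (val f ((1 : E), (0 : E))).
    by apply/eqP; rewrite -subr_eq0; apply/eqP; exact: (congr1 (fun h => val h.1) E0).
  have Ex := congr1 snd E0.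
  have [y [gy Ry]] := iffLR (to_dual_ker hb (rho_s_e_hom Rz w) rho_s_e_adj hg fgf g1) Ex.
  have gy' : gr (d + -1) y by refine (gr_eq _ gy); ring.
  have hpsi := free_hom 1 gy'; rewrite subrK in hpsi.
  (* With x = f y, the values f y and hh (f y) are those of the coboundary of y. *)
  exists (fun e : Q 0%N => eact (e : E) y); split=> //.
  apply/funext => e; rewrite (koszul1_homE _ gf.1) Ey -Ry rho_s_eE.
  by rewrite /= /koszul_d0 (eactDl (e.1 * rr)) (eactM e.1) (eactM e.2) rel_nu_act.
have ev e : val f e = eact ((res_d e) : E) (psi (1 : E)).
  by rewrite Epsi /=; exact: free_homE hpsi.
congr (_, _).
  apply: val_inj; rewrite /= !ev /= /koszul_d0 /= !mul0r !mul1r addr0 add0r.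
  by rewrite rel_nu_act subrr.
apply/(to_dual_ker hb (rho_s_e_hom Rz w) rho_s_e_adj hg fgf g1); exists (psi (1 : E)); split.
  rewrite (_ : d + 1 - 2 = -1 + d); last by ring.
  by apply: hpsi.1.2; exact: edeg1.
by rewrite rho_s_eE ev /= /koszul_d0 /= mul0r mul1r addr0.
Qed.

Lemma Ext2_pairing : griso (Ext Q N 2)
  (shift (at_gen (dual K) ul_rho_s_wedge_rho_t_t_rho_t) (-1)).
Proof.
pose F (f : cocycles Q N 2) :
  shift (at_gen (dual K) ul_rho_s_wedge_rho_t_t_rho_t) (-1) := dl (val f (1 : E)).
have hdl := to_dual_hom hb (rho_s_e_hom Rz w).
have hF : right_hom 0 F.
  split=> [r f f'|d f gf]; first exact: hdl.1.
  have g5 : gr (5 + d) (val f (1 : E)) by apply: gf.1.1.2; exact: edeg1.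
  by refine (@gr_eq k n (dual K) _ _ _ _ (hdl.2 _ _ g5)); rewrite /=; ring.
apply: (graded_quot_griso _ hF).
  move=> d phi gphi.
  have {}gphi : gr (d + 5) (phi : dual K).
    by refine (@gr_eq k n (dual K) _ _ _ _ gphi); rewrite /=; ring.
  have [x [gx Ex]] := to_dual_surj hb (hf := rho_s_e_hom Rz w) hg fgf gphi.
  have hf := free_hom (-5) gx; rewrite addrK in hf.
  have f0 (e : Q 3%N) : eact (res_d e : E) x = 0 by exact: eact0l.
  exists (to_submodule (gsub_mod (cocycles_are_graded Q N 2)) (gspan1 (conj hf f0))).
  by rewrite /F /= eact1.
move=> d f gf.
have g5 : gr (d + 5) (val f (1 : E)).
  by rewrite addrC; apply: gf.1.1.2; exact: edeg1.
split=> [E0|[psi [hpsi Epsi]]].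
  have [y [gy Ry]] := iffLR (to_dual_ker hb (rho_s_e_hom Rz w) rho_s_e_adj hg fgf g5) E0.
  have gy' : gr (d + 3) (- y).
    apply: (gsN (grading_subgroups (gr_grading N))).
    by refine (gr_eq _ gy); ring.
  have g1 : gr (d + 1) (0 : N) by exact: gr0.
  (* The second generator alone suffices; the sign compensates the one in [koszul_d1]. *)
  exists (fun e : Q 1%N => eact (e.1 : E) (0 : N) + eact (e.2 : E) (- y)).
  split; first exact: koszul1_hom g1 gy'.
  apply/funext => e; rewrite (free_homE e gf.1) -Ry rho_s_eE.
  by rewrite /= eact0 add0r eactNl eactNr opprK (eactM (e : E)).
apply/(to_dual_ker hb (rho_s_e_hom Rz w) rho_s_e_adj hg fgf g5).
pose x1 := psi ((1 : E), (0 : E)); pose x2 := psi ((0 : E), (1 : E)).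
(* The coboundary [rel_nu] x1 - [rel_rho] x2 is f applied to this element, so coboundaries in degree
   2 lie in the image of f. *)
exists (eact hh x1 - x2); split.
  apply: (gsB (grading_subgroups (gr_grading N))).
    have h1 : gr (1 + d) x1.
      by apply: hpsi.1.2; split; [exact: edeg1|exact: gs0 (grading_subgroups (@edeg_grading k n)) _].
    by refine (gr_eq _ (eact_deg edeg_hh h1)); ring.
  have h3 : gr (3 + d) x2.
    by apply: hpsi.1.2; split; [exact: gs0 (grading_subgroups (@edeg_grading k n)) _|exact: edeg1].
  by refine (gr_eq _ h3); ring.
rewrite rho_s_eE Epsi /= (koszul1_homE _ hpsi) /= !mul1r eactNl rel_nu_act.
by rewrite eactBr (rel_comm rr hh).
Qed.
End Pairing.

End KoszulExt.

Theorem theorem7p2 (k : idomainType) (n m : nat) (Rz : realization k n m)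
    (char_k : [pchar k] =i pred0) (m_ge2 : (2 <= m)%N)
    (Lambda_st_eq_k : Lambda_st_trivial Rz)
    (w : seq gen) (P : projective_resolution (B Rz gen_t)) :
  let K := ker_rho_s_e Rz w in
  let DK := dual K in
  [/\ griso (Ext P (BS Rz w) 0) (shift (at_gen K ul_one) (-1)) /\
      griso (shift (at_gen K ul_one) (-1)) (shift K (-1)),
      griso (Ext P (BS Rz w) 1)
            (dsum (shift (at_gen K ul_rho_t_t_rho_t) (-1))
                  (shift (at_gen (tilde DK) ul_rho_s) (-1))) /\
      griso (dsum (shift (at_gen K ul_rho_t_t_rho_t) (-1))
                  (shift (at_gen (tilde DK) ul_rho_s) (-1)))
            (dsum (shift K 3) (shift DK 1))
    & griso (Ext P (BS Rz w) 2)
            (shift (at_gen DK ul_rho_s_wedge_rho_t_t_rho_t) (-1)) /\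
      griso (shift (at_gen DK ul_rho_s_wedge_rho_t_t_rho_t) (-1)) (shift DK 5)].
Proof.
move=> K DK; have [b hb] := BS_pairing Rz w.
have [g [hg fgf]] := rho_s_e_regular Lambda_st_eq_k m_ge2 w.
have EQ i := Ext_griso (BS Rz w) P (koszul_resolution Lambda_st_eq_k) i.
split; split; try exact: griso_shift.
- exact: griso_trans (EQ 0%N) (Ext0_koszul Lambda_st_eq_k w).
- exact: griso_trans (EQ 1%N) (Ext1_pairing Lambda_st_eq_k hb hg fgf).
- by apply: griso_dsum; exact: griso_shift.
- exact: griso_trans (EQ 2%N) (Ext2_pairing Lambda_st_eq_k hb hg fgf).
Qed.
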